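(* Let $C=11\cdot 195^2+4$. Let $n\ge 2$ and let $\mathbf G=(G_1,G_2,G_3)$ be a graph triple of order $n$ with $\Delta_1,\Delta_2\le n-2$ and $\Delta_3\le n-1$. If $F(\mathbf G):=e_1+e_2+e_3+\mathcal D\le 3n-C$, then $\mathbf G$ packs.
   Context: A graph triple $\mathbf G=(G_1,G_2,G_3)$ of order $n$ consists of two disjoint $n$-vertex graphs $G_1=(V_1,E_1)$, $G_2=(V_2,E_2)$ and a bipartite graph $G_3=(V_1\cup V_2,E_3)$ with parts $V_1,V_2$. $\mathbf G$ packs if there is a bijection $f:V_1\to V_2$ with $vf(v)\notin E_3$ for all $v\in V_1$ and such that $uv\in E_1$ implies $f(u)f(v)\notin E_2$. For $v\in V_i$ ($i=1,2$), $d_i(v)$ is its degree in $G_i$ and $d_3(v)$ its degree in $G_3$. Let $e_i=|E_i|$, $\Delta_i=\max_v d_i(v)$ for $i=1,2,3$, $\Delta_{3|i}=\max_{v\in V_i}d_3(v)$, and $\mathcal D=\max\{\Delta_1+\max\{\Delta_{3|2}-4,0\},\ \Delta_2+\max\{\Delta_{3|1}-4,0\}\}$. *)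

(* Defs.v *)
From mathcomp Require Import all_boot.
Set Implicit Arguments. Unset Strict Implicit. Unset Printing Implicit Defensive.

Definition simple_graph (V : finType) (e : rel V) : Prop :=
  symmetric e /\ irreflexive e.

Definition deg (V : finType) (e : rel V) (v : V) : nat := #|[set u | e v u]|.

Definition nedges (V : finType) (e : rel V) : nat :=
  #|[set A : {set V} | [exists u, exists w, (A == [set u; w]) && e u w]]|.

Definition maxdeg (V : finType) (e : rel V) : nat := \max_(v : V) deg e v.

(* The bipartite graph G3 between V1 and V2 is given by a relation e3 : V1 -> V2 -> bool
   (e3 x y  <->  xy is an edge of G3). *)
Definition deg3_1 (V1 V2 : finType) (e3 : V1 -> V2 -> bool) (x : V1) : nat :=
  #|[set y | e3 x y]|.
Definition deg3_2 (V1 V2 : finType) (e3 : V1 -> V2 -> bool) (y : V2) : nat :=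
  #|[set x | e3 x y]|.
Definition nedges3 (V1 V2 : finType) (e3 : V1 -> V2 -> bool) : nat :=
  #|[set p : V1 * V2 | e3 p.1 p.2]|.
Definition maxdeg3_1 (V1 V2 : finType) (e3 : V1 -> V2 -> bool) : nat :=
  \max_(x : V1) deg3_1 e3 x.
Definition maxdeg3_2 (V1 V2 : finType) (e3 : V1 -> V2 -> bool) : nat :=
  \max_(y : V2) deg3_2 e3 y.
Definition maxdeg3 (V1 V2 : finType) (e3 : V1 -> V2 -> bool) : nat :=
  maxn (maxdeg3_1 e3) (maxdeg3_2 e3).

(* script D = max{Delta1 + max{Delta_{3|2}-4,0}, Delta2 + max{Delta_{3|1}-4,0}}
   (truncated nat subtraction m - 4 equals max{m-4,0}) *)
Definition scriptD (V1 V2 : finType) (e1 : rel V1) (e2 : rel V2)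
  (e3 : V1 -> V2 -> bool) : nat :=
  maxn (maxdeg e1 + (maxdeg3_2 e3 - 4)) (maxdeg e2 + (maxdeg3_1 e3 - 4)).

Definition Fval (V1 V2 : finType) (e1 : rel V1) (e2 : rel V2)
  (e3 : V1 -> V2 -> bool) : nat :=
  nedges e1 + nedges e2 + nedges3 e3 + scriptD e1 e2 e3.

Definition packs (V1 V2 : finType) (e1 : rel V1) (e2 : rel V2)
  (e3 : V1 -> V2 -> bool) : Prop :=
  exists f : V1 -> V2, [/\ bijective f,
    forall v, ~~ e3 v (f v) &
    forall u v, e1 u v -> ~~ e2 (f u) (f v)].

Definition Cconst : nat := 11 * 195 ^ 2 + 4.

(* Main.v *)
Require Import Defs.
From mathcomp Require Import all_boot zify.
From Stdlib Require Import Classical.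
Set Implicit Arguments. Unset Strict Implicit. Unset Printing Implicit Defensive.

(** Let k ~ sqrt(n/20) and call a vertex heavy if its degree exceeds k.

    If no vertex is isolated, both degree sums are at least n.  When no vertex has degree near n, the heavy vertices of G2 are placed first, on
    vertices of G1 of degree at most 3 with at most one heavy neighbour; a step can only be stuck
    if about 4n of the degree sum of G1 is used up, which the bound on F excludes for one of the
    two orders (V1, V2) or (V2, V1), possibly after moving one earlier host.  Then the heavy
    vertices of G1 are placed on light vertices, then the vertices with many G3-neighbours, and
    the remaining sparse part packs by a maximal-partial-packing argument.  When there is a giant
    vertex, it is sent to a vertex of small degree, the neighbours of the latter are hosted outside
    the neighbourhood of the giant, and the previous case applies to what is left.

    Isolated vertices are handled by induction on n: pairing an isolated x with some y lowers F by
    at least 3 unless every y not joined to x satisfies d2(y) + d3(y) + d3(x) <= 2, and then G2 is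
    so simple that a packing, or a reduction by up to three pairs, is found by hand. *)

(** The scale k balances two costs. Placing light vertices creates at most k^2 conflicts at any
    unplaced light vertex, which the final argument tolerates because 20 k^2 <= n; and the degree
    sums, together below 6n < 120 (k+1)^2, leave at most 120 k + 119 heavy vertices. All losses are
    then linear in k, and C absorbs them through the tangent inequality 40 q k <= n + 20 q^2. The
    room of 390 k = 2 * 195 k kept free during the hosting has to exceed 372 k + 450, the price of
    hosting one heavy vertex of G1. The degree term of F rules out the stuck situation: there two
    vertices of G1 are nearly saturated at once, G2 is correspondingly large, and only the extra
    degree in F cancels the degree of the vertex that cannot be hosted. Pairs placed in advance (for
    giants and nearly full vertices of G3) are not removed: they stay as isolated vertices of a
    residual triple, and the conflicts they cause become edges of G3, so n and k do not change. Only
    the induction for isolated vertices really shrinks n. *)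

Ltac nlia :=
  repeat match goal with
  | H : is_true (leq _ _) |- _ => revert H
  | H : @eq nat _ _ |- _ => revert H
  end; clear; intros; lia.

(** * Counting preliminaries *)

Lemma leq_card_bigcup (I V : finType) (Q : pred I) (A : I -> {set V}) :
  #|\bigcup_(i | Q i) A i| <= \sum_(i | Q i) #|A i|.
Proof.
elim/big_rec2: _ => [|i m B _ le_Bm]; first by rewrite cards0.
by apply: leq_trans (leq_add (leqnn _) le_Bm); rewrite leq_card_setU.
Qed.

Lemma ex_max_card (T : finType) (Q : {set T} -> Prop) (P0 : {set T}) :
  Q P0 -> exists2 P, Q P & forall P', Q P' -> #|P'| <= #|P|.
Proof.
have: #|T| <= #|P0| + #|T| by exact: leq_addl.
elim: {2}#|T| P0 => [|m IHm] P0 le_m QP0.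
  by exists P0 => // P' _; have := max_card P'; lia.
have [[P' [QP' gtP]] | noP] := classic (exists P', Q P' /\ #|P0| < #|P'|).
  by apply: (IHm P') => //; lia.
exists P0 => // P' QP'; rewrite leqNgt; apply/negP => gtP; apply: noP.
by exists P'.
Qed.

Lemma sum_card_mul (T : finType) (A : {set T}) (f : T -> nat) c :
  (forall x, x \in A -> c <= f x) -> c * #|A| <= \sum_(x in A) f x.
Proof. by move=> le_cf; rewrite mulnC -sum_nat_const leq_sum. Qed.

Lemma sum_subset (T : finType) (A B : {set T}) (f : T -> nat) :
  A \subset B -> \sum_(x in A) f x <= \sum_(x in B) f x.
Proof.
move=> sAB; rewrite [leqRHS](big_setID A) /= (setIidPr sAB); exact: leq_addr.
Qed.

Lemma sum_inT (T : finType) (A : {set T}) (f : T -> nat) :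
  \sum_(x in A) f x <= \sum_x f x.
Proof. by rewrite [leqRHS](bigID (mem A)) /= leq_addr. Qed.

Lemma card_ge_sub (T : finType) (A B : {set T}) : #|A| - #|B| <= #|A :\: B|.
Proof. by rewrite cardsD leq_sub2l // subset_leq_card // subsetIr. Qed.

Lemma set_exists_of_card (T : finType) (A B : {set T}) :
  #|A| < #|B| -> exists2 x, x \in B & x \notin A.
Proof.
move=> ltAB; have: 0 < #|B :\: A| by have := card_ge_sub B A; lia.
by case/card_gt0P => x; rewrite inE => /andP[xA xB]; exists x.
Qed.

(** * Partial packings *)

Definition nb (V W : finType) (r : V -> W -> bool) (x : V) : {set W} := [set y | r x y].
Definition dg (V W : finType) (r : V -> W -> bool) (x : V) : nat := #|nb r x|.
Definition tr (V W : Type) (r : V -> W -> bool) : W -> V -> bool := fun y x => r x y.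
(* Twice the number of edges of a graph, but the number of edges of a bipartite graph. *)
Definition size_e (V W : finType) (r : V -> W -> bool) : nat := \sum_x dg r x.

Lemma double_count (V W : finType) (r : V -> W -> bool) (A : {set V}) (B : {set W}) :
  \sum_(x in A) #|nb r x :&: B| = \sum_(y in B) #|nb (tr r) y :&: A|.
Proof.
transitivity (\sum_(x in A) \sum_(y in B) (r x y : nat)).
  apply: eq_bigr => x _; rewrite -sum1_card big_mkcond [RHS]big_mkcond /=.
  by apply: eq_bigr => y _; rewrite !inE; case: (r x y); case: (y \in B).
rewrite exchange_big; apply: eq_bigr => y _.
rewrite -sum1_card big_mkcond [RHS]big_mkcond /=.
by apply: eq_bigr => x _; rewrite !inE /tr; case: (r x y); case: (x \in A).
Qed.

Lemma size_e_tr (V W : finType) (r : V -> W -> bool) : size_e (tr r) = size_e r.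
Proof.
have := double_count r [set: V] [set: W]; rewrite /size_e /dg.
under eq_bigr do rewrite setIT; under [X in _ = X -> _]eq_bigr do rewrite setIT.
by move=> E; rewrite -(eq_bigl _ _ (in_setT (T := V))) -(eq_bigl _ _ (in_setT (T := W))).
Qed.

Lemma leq_dg (V W : finType) (r r' : V -> W -> bool) x :
  (forall y, r x y -> r' x y) -> dg r x <= dg r' x.
Proof.
by move=> s; apply/subset_leq_card/subsetP => y; rewrite !inE; apply: s.
Qed.

Lemma size_e_count (V W : finType) (r : V -> W -> bool) c :
  c * #|[set x | c <= dg r x]| <= size_e r.
Proof.
apply: leq_trans (sum_inT [set x | c <= dg r x] (dg r)).
by apply: sum_card_mul => x; rewrite inE.
Qed.

Section Placements.
Variables (V1 V2 : finType).
Variables (e1 : rel V1) (e2 : rel V2) (e3 : V1 -> V2 -> bool).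
Implicit Types P : {set V1 * V2}.

(** A partial packing is a set of pairs; the first clause says that it is the graph of an injective
    partial map. In this form exchanging the two graphs is just the reversal of the pairs. *)
Definition okp P : Prop :=
  [/\ forall p q, p \in P -> q \in P -> (p.1 == q.1) = (p.2 == q.2),
      forall p, p \in P -> ~~ e3 p.1 p.2 &
      forall p q, p \in P -> q \in P -> e1 p.1 q.1 -> ~~ e2 p.2 q.2].

Definition dom P : {set V1} := [set p.1 | p in P].
Definition cod P : {set V2} := [set p.2 | p in P].

(** The pairs that may not be added to [P]: the placement acts like additional edges of G3. The
    degree in [conf P] is the quantity controlled throughout. *)
Definition conf P (x : V1) (y : V2) : bool :=
  e3 x y || [exists p in P, e1 x p.1 && e2 y p.2].

Lemma confP P x y :
  reflect (e3 x y \/ exists2 p, p \in P & e1 x p.1 /\ e2 y p.2) (conf P x y).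
Proof.
apply: (iffP orP) => -[->|H]; try by left.
  by right; case/existsP: H => p /and3P[pP p1 p2]; exists p.
by right; case: H => p pP [p1 p2]; apply/existsP; exists p; rewrite pP p1.
Qed.

Lemma mem_dom P p : p \in P -> p.1 \in dom P.
Proof. exact: imset_f. Qed.

Lemma mem_cod P p : p \in P -> p.2 \in cod P.
Proof. exact: imset_f. Qed.

Lemma domP P x : reflect (exists y, (x, y) \in P) (x \in dom P).
Proof.
apply: (iffP imsetP) => [[[x' y] pP /= ->]|[y pP]]; first by exists y.
by exists (x, y).
Qed.

Lemma codP P y : reflect (exists x, (x, y) \in P) (y \in cod P).
Proof.
apply: (iffP imsetP) => [[[x y'] pP /= ->]|[x pP]]; first by exists x.
by exists (x, y).
Qed.

Lemma card_dom P : okp P -> #|dom P| = #|P|.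
Proof.
case=> inj _ _; apply: card_in_imset => -[x y] [x' y'] pP qP /= E.
by have := inj _ _ pP qP; rewrite /= E eqxx => /esym/eqP ->.
Qed.

Lemma card_cod P : okp P -> #|cod P| = #|P|.
Proof.
case=> inj _ _; apply: card_in_imset => -[x y] [x' y'] pP qP /= E.
by have := inj _ _ pP qP; rewrite /= E eqxx => /eqP ->.
Qed.

Lemma card_dom_le P : #|dom P| <= #|P|. Proof. exact: leq_imset_card. Qed.
Lemma card_cod_le P : #|cod P| <= #|P|. Proof. exact: leq_imset_card. Qed.

Lemma okp_sub P P' : P' \subset P -> okp P -> okp P'.
Proof.
move=> /subsetP s [inj ne nc]; split=> [p q /s pP /s|p /s|p q /s pP /s].
- exact: inj. - exact: ne. - exact: nc.
Qed.

Lemma okp_ext P x y :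
  symmetric e1 -> symmetric e2 -> irreflexive e1 -> okp P ->
  x \notin dom P -> y \notin cod P -> ~~ conf P x y ->
  okp ((x, y) |: P).
Proof.
move=> s1 s2 i1 [inj ne nc] xP yP; rewrite negb_or => /andP[nxy ncf].
have ncf' p : p \in P -> e1 x p.1 -> ~~ e2 y p.2.
  move=> pP e; apply: contra ncf => e'; apply/existsP; exists p.
  by rewrite pP e e'.
have nx p : p \in P -> (x == p.1) = false.
  by move=> pP; apply: contraNF xP => /eqP ->; apply: mem_dom.
have ny p : p \in P -> (y == p.2) = false.
  by move=> pP; apply: contraNF yP => /eqP ->; apply: mem_cod.
split=> [p q|p|p q]; rewrite !inE.
- case/predU1P=> [->|pP] /predU1P[->|qP] /=; rewrite ?eqxx //; last exact: inj.
    by rewrite nx ?ny.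
  by rewrite eq_sym nx // eq_sym ny.
- by case/predU1P=> [->|/ne].
- case/predU1P=> [->|pP] /predU1P[->|qP] /=; last exact: nc.
  + by rewrite i1.
  + exact: ncf'.
  + by rewrite s1 s2; apply: ncf'.
Qed.

Lemma conf_ext P u w x y :
  conf ((u, w) |: P) x y = conf P x y || (e1 x u && e2 y w).
Proof.
apply/confP/orP => [[e|[p]]|[/confP[e|[p pP ep]]|/andP[e e']]].
- by left; rewrite /conf e.
- rewrite !inE => /predU1P[-> [-> ->]|pP ep]; first by right.
  by left; apply/confP; right; exists p.
- by left.
- by right; exists p => //; rewrite inE pP orbT.
- by right; exists (u, w) => //; rewrite setU11.
Qed.

Lemma conf_sub P P' x y :
  P' \subset P -> conf P' x y -> conf P x y.
Proof.
move=> /subsetP s /confP[e|[p /s pP e]]; apply/confP; first by left.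
by right; exists p.
Qed.

Lemma nb_conf P x : symmetric e2 ->
  nb (conf P) x = nb e3 x :|: \bigcup_(p in P | e1 x p.1) nb e2 p.2.
Proof.
move=> s2; apply/setP => y; rewrite !inE; congr (_ || _).
apply/existsP/bigcupP => [[p /and3P[pP e e']]|[p /andP[pP e]]].
  by exists p; rewrite ?pP ?e // inE s2.
by rewrite inE s2 => e'; exists p; rewrite pP e.
Qed.

Lemma dg_conf P x : symmetric e2 ->
  dg (conf P) x <= dg e3 x + \sum_(p in P | e1 x p.1) dg e2 p.2.
Proof.
move=> s2; rewrite /dg nb_conf //.
apply: leq_trans (leq_add (leqnn _) (leq_card_bigcup _ _)).
by rewrite leq_card_setU.
Qed.

Lemma nb_conf_ext P u w x : symmetric e2 ->
  nb (conf ((u, w) |: P)) x =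
  nb (conf P) x :|: (if e1 x u then nb e2 w else set0).
Proof.
move=> s2; apply/setP => y; rewrite inE conf_ext !inE; congr (_ || _).
by case: (e1 x u); rewrite !inE //= s2.
Qed.

Lemma packs_of_okp P : okp P -> #|V1| = #|V2| -> #|P| = #|V1| ->
  packs e1 e2 e3.
Proof.
move=> ok eqV cP; have [inj ne nc] := ok.
have dT : dom P = setT.
  by apply/eqP; rewrite eqEcard subsetT cardsT (card_dom ok) cP /=.
have img x : {y | (x, y) \in P}.
  have: x \in dom P by rewrite dT.
  case: (pickP [pred y | (x, y) \in P]) => [y /= pP _|no]; first by exists y.
  by move=> /domP H; exfalso; case: H => y; have := no y; rewrite /= => ->.
pose f x := sval (img x).
have fP x : (x, f x) \in P by rewrite /f; case: (img x).
have injf : injective f.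
  by move=> x x' E; have /= := inj _ _ (fP x) (fP x'); rewrite E eqxx => /eqP.
exists f; split=> [|v|u v].
- exact: inj_card_bij injf (eq_leq (esym eqV)).
- exact: (ne _ (fP v)).
- exact: (nc _ _ (fP u) (fP v)).
Qed.

End Placements.

(** * Exchanging the two graphs *)

Definition sw (V1 V2 : finType) (P : {set V1 * V2}) : {set V2 * V1} :=
  [set p | (p.2, p.1) \in P].

Section Swap.
Variables (V1 V2 : finType) (e1 : rel V1) (e2 : rel V2) (e3 : V1 -> V2 -> bool).
Implicit Types (P : {set V1 * V2}).

Lemma sw_sw P : sw (sw P) = P.
Proof. by apply/setP => -[x y]; rewrite !inE. Qed.

Lemma card_sw P : #|sw P| = #|P|.
Proof.
have -> : sw P = [set (p.2, p.1) | p in P].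
  apply/setP => -[y x]; rewrite inE /=; apply/idP/imsetP => [pP|[[x' y'] pP [-> ->]]] //.
  by exists (x, y).
by apply: card_imset => -[x y] [x' y'] [-> ->].
Qed.

Lemma dom_sw P : dom (sw P) = cod P.
Proof.
apply/setP => y; apply/domP/codP => -[x]; rewrite ?inE => pP; exists x => //.
by rewrite inE.
Qed.

Lemma cod_sw P : cod (sw P) = dom P.
Proof.
apply/setP => x; apply/codP/domP => -[y]; rewrite ?inE => pP; exists y => //.
by rewrite inE.
Qed.

Lemma okp_sw P : okp e1 e2 e3 P -> okp e2 e1 (tr e3) (sw P).
Proof.
case=> inj ne nc; split=> [[y x] [y' x']|[y x]|[y x] [y' x']]; rewrite !inE /=.
- by move=> pP qP; rewrite -(inj _ _ pP qP).
- exact: ne.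
- by move=> pP qP; apply: contraTN => /(nc _ _ pP qP).
Qed.

Lemma conf_sw P y x : conf e2 e1 (tr e3) (sw P) y x = tr (conf e1 e2 e3 P) y x.
Proof.
apply/confP/confP => -[e|[p pP [e e']]]; try by left.
  by right; exists (p.2, p.1) => //; rewrite inE in pP.
by right; exists (p.2, p.1) => //; rewrite inE -surjective_pairing.
Qed.

Lemma nb_conf_sw P y : nb (conf e2 e1 (tr e3) (sw P)) y = nb (tr (conf e1 e2 e3 P)) y.
Proof. by apply/setP => x; rewrite !inE conf_sw. Qed.

Lemma dg_conf_sw P y : dg (conf e2 e1 (tr e3) (sw P)) y = dg (tr (conf e1 e2 e3 P)) y.
Proof. by rewrite /dg nb_conf_sw. Qed.

Lemma sub_sw P P' : P \subset P' -> sw P \subset sw P'.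
Proof. by move=> /subsetP s; apply/subsetP => p; rewrite !inE => /s. Qed.

Lemma sw_setU1 P x y : sw ((x, y) |: P) = (y, x) |: sw P.
Proof. by apply/setP => -[y' x']; rewrite !inE !xpair_eqE andbC. Qed.

End Swap.

(** * Growth of conflict degrees under extension *)

Section Growth.
Variables (V1 V2 : finType) (e1 : rel V1) (e2 : rel V2) (e3 : V1 -> V2 -> bool).
Hypotheses (s1 : symmetric e1) (i1 : irreflexive e1) (s2 : symmetric e2) (i2 : irreflexive e2).
Implicit Types P : {set V1 * V2}.
Local Notation ok := (okp e1 e2 e3).
Local Notation cf := (conf e1 e2 e3).

Lemma card_pairs_nb P (A : {set V1}) : ok P -> #|[set p in P | p.1 \in A]| <= #|A|.
Proof.
move=> okP; rewrite -(card_dom (okp_sub (P' := [set p in P | p.1 \in A]) _ okP)).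
  apply/subset_leq_card/subsetP => x /imsetP[p].
  by rewrite inE => /andP[_ pA] ->.
by apply/subsetP => p; rewrite inE => /andP[].
Qed.

Lemma dg_conf_grow P P' x : P \subset P' ->
  dg (cf P') x <= dg (cf P) x + \sum_(p in P' :\: P | e1 x p.1) dg e2 p.2.
Proof.
move=> sPP'; rewrite /dg !nb_conf //.
apply: leq_trans (leq_add (leqnn _) (leq_card_bigcup _ _)).
apply: leq_trans (_ : #|nb (cf P) x :|: \bigcup_(p in P' :\: P | e1 x p.1) nb e2 p.2| <= _).
  rewrite nb_conf //; apply/subset_leq_card/subsetP => y; rewrite !in_setU.
  case/orP=> [-> //|/bigcupP[p /andP[pP' e] yp]].
  have [pP|npP] := boolP (p \in P).
    by apply/orP; left; apply/orP; right; apply/bigcupP; exists p; rewrite ?pP ?e.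
  by apply/orP; right; apply/bigcupP; exists p => //; rewrite in_setD npP pP' e.
rewrite [X in #|X :|: _|]nb_conf //; exact: leq_card_setU.
Qed.

Lemma sum_pairs_le P (A : {set V1}) k (f : V2 -> nat) : ok P ->
  (forall p, p \in P -> p.1 \in A -> f p.2 <= k) ->
  \sum_(p in P | p.1 \in A) f p.2 <= k * #|A|.
Proof.
move=> okP le_k; apply: leq_trans (_ : \sum_(p in P | p.1 \in A) k <= _).
  by apply: leq_sum => p /andP[]; apply: le_k.
rewrite sum_nat_const mulnC leq_mul2l; apply/orP; right.
have -> : #|[pred p | p \in P & p.1 \in A]| = #|[set p in P | p.1 \in A]|.
  by apply: eq_card => p; rewrite !inE.
exact: card_pairs_nb.
Qed.

(** Only new pairs at neighbours of [x] add conflicts at [x]: at most [dg e1 x] pairs, each adding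
    at most [k]. *)
Lemma dg_conf_grow_le P P' x k : ok P' -> P \subset P' ->
  (forall p, p \in P' -> p \notin P -> dg e2 p.2 <= k) ->
  dg (cf P') x <= dg (cf P) x + k * dg e1 x.
Proof.
move=> okP' sPP' lek; apply: leq_trans (dg_conf_grow x sPP') _; rewrite leq_add2l.
have okD : ok (P' :\: P) by apply: okp_sub okP'; exact: subsetDl.
apply: leq_trans (sum_pairs_le (A := nb e1 x) (k := k) okD _).
  by apply/eq_leq/eq_bigl => p; rewrite [p.1 \in _]inE.
by move=> p; rewrite inE => /andP[npP pP'] _; apply: lek.
Qed.

Lemma dg_conf_ext P x u w : dg (cf ((u, w) |: P)) x <= dg (cf P) x + (if e1 x u then dg e2 w else 0).
Proof.
rewrite /dg nb_conf_ext //; case: (e1 x u); last by rewrite setU0 addn0.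
by rewrite leq_card_setU.
Qed.

Lemma place_one P x : ok P -> x \notin dom P -> dg (cf P) x + #|P| < #|V2| ->
  exists2 y, y \notin cod P & ok ((x, y) |: P).
Proof.
move=> okP xP lt.
have: #|nb (cf P) x :|: cod P| < #|[set: V2]|.
  rewrite cardsT; apply: leq_ltn_trans (leq_card_setU _ _) _.
  by rewrite (card_cod okP).
case/set_exists_of_card => y _; rewrite !inE negb_or => /andP[nc yP].
by exists y => //; apply: okp_ext.
Qed.

End Growth.

(** * Completing a placement when only light vertices are left *)

Section Finish.
Variables (V1 V2 : finType) (e1 : rel V1) (e2 : rel V2) (e3 : V1 -> V2 -> bool).
Hypotheses (s1 : symmetric e1) (i1 : irreflexive e1) (s2 : symmetric e2) (i2 : irreflexive e2).
Implicit Types P : {set V1 * V2}.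
Local Notation ok := (okp e1 e2 e3).
Local Notation cf := (conf e1 e2 e3).
Variables (n k : nat).
Hypotheses (n1 : #|V1| = n) (n2 : #|V2| = n).

(** Take a placement of maximal size above [P] and suppose that [x] and [y] are left over. Lightness
    bounds their conflict degrees by [l + k * k], and every vertex without conflict with [x] is
    already used, or [x] could be placed. Among the pairs using such vertices some [p] tolerates [y]
    at [p.1]; trading [p] for [(p.1, y)] and [(x, p.2)] enlarges the placement. *)
Lemma finish0 l P : ok P ->
  (forall x, x \notin dom P -> dg e1 x <= k /\ dg (cf P) x <= l) ->
  (forall y, y \notin cod P -> dg e2 y <= k /\ dg (tr (cf P)) y <= l) ->
  2 * l + 2 * (k * k) + k + #|P| < n ->
  exists P', [/\ ok P', P \subset P' & #|P'| = n].
Proof.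
move=> okP t1 t2 lt.
have [P' [okP' sPP'] maxP'] := @ex_max_card _ (fun Q => ok Q /\ P \subset Q) P (conj okP (subxx _)).
exists P'; split=> //; apply/eqP; rewrite eqn_leq; apply/andP; split.
  by rewrite -n1 -(card_dom okP') max_card.
rewrite leqNgt; apply/negP => ltP'.
have [x _ xP'] : exists2 x, x \in [set: V1] & x \notin dom P'.
  by apply: set_exists_of_card; rewrite cardsT n1 (card_dom okP').
have [y _ yP'] : exists2 x, x \in [set: V2] & x \notin cod P'.
  by apply: set_exists_of_card; rewrite cardsT n2 (card_cod okP').
have xP : x \notin dom P.
  by apply: contra xP' => /imsetP[p pP ->]; apply: mem_dom; apply: (subsetP sPP').
have yP : y \notin cod P.
  by apply: contra yP' => /imsetP[p pP ->]; apply: mem_cod; apply: (subsetP sPP').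
have inj := let: And3 H _ _ := okP' in H.
have ndom p : p \in P' -> p \notin P -> p.1 \notin dom P.
  move=> pP' npP; apply: contra npP => /imsetP[q qP] E.
  have qP' := subsetP sPP' _ qP.
  have := inj _ _ pP' qP'; rewrite E eqxx => /esym/eqP E2.
  by rewrite (surjective_pairing p) E E2 -surjective_pairing.
have ncod p : p \in P' -> p \notin P -> p.2 \notin cod P.
  move=> pP' npP; apply: contra npP => /imsetP[q qP] E.
  have qP' := subsetP sPP' _ qP.
  have := inj _ _ pP' qP'; rewrite E eqxx => /eqP E2.
  by rewrite (surjective_pairing p) E E2 -surjective_pairing.
have [x1 x2] := t1 x xP; have [y1 y2] := t2 y yP.
have fx : dg (cf P') x <= l + k * k.
  apply: leq_trans (dg_conf_grow_le s2 x okP' sPP' (k := k) _) _.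
    by move=> p pP' npP; have [] := t2 _ (ncod p pP' npP).
  by rewrite leq_add // leq_mul2l x1 orbT.
have fy : dg (tr (cf P')) y <= l + k * k.
  rewrite -dg_conf_sw.
  apply: leq_trans (dg_conf_grow_le s1 y (okp_sw okP') (sub_sw sPP') (k := k) _) _.
    move=> p; rewrite !inE => pP' npP.
    by have [] := t1 _ (ndom (p.2, p.1) pP' npP).
  by rewrite dg_conf_sw leq_add // leq_mul2l y1 orbT.
have ext_cod z : ~~ cf P' x z -> z \in cod P'.
  move=> nc; apply/negPn/negP => zP'.
  have := maxP' ((x, z) |: P'); rewrite cardsU1 (contra (@mem_dom _ _ P' (x,z)) xP') /=.
  have H : ok ((x, z) |: P') /\ P \subset (x, z) |: P'.
    split; first exact: okp_ext.
    by apply: subset_trans sPP' (subsetUr _ _).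
  by move/(_ H); rewrite add1n ltnn.
pose W := [set p in P' | ~~ cf P' x p.2 & p \notin P].
have cW : n <= #|W| + (l + k * k) + #|P|.
  have : [set: V2] \subset [set p.2 | p in W] :|: nb (cf P') x :|: cod P.
    apply/subsetP => z _; rewrite !inE.
    case: (boolP (cf P' x z)) => [_|nc]; first by rewrite orbT.
    rewrite orbF; case: (boolP (z \in cod P)) => [_|zP]; rewrite ?orbT ?orbF //.
    have /imsetP[p pP' zE] := ext_cod z nc; apply/imsetP; exists p => //.
    rewrite inE pP' -zE nc /=; apply: contra zP => pP; rewrite zE; exact: mem_cod.
  move/subset_leq_card; rewrite cardsT n2 => /leq_trans; apply.
  apply: leq_trans (leq_card_setU _ _) _; rewrite leq_add ?card_cod_le //.
  apply: leq_trans (leq_card_setU _ _) _; rewrite leq_add //.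
  exact: leq_imset_card.
(* [p.1] is also kept outside [nb e1 x], so that the two new pairs do not conflict with each
   other. *)
have [p pW pn] : exists2 p, p \in W & p \notin [set p in P' | p.1 \in nb (tr (cf P')) y :|: nb e1 x].
  apply: set_exists_of_card; apply: leq_ltn_trans (card_pairs_nb _ okP') _.
  apply: leq_ltn_trans (leq_card_setU _ _) _.
  move: fy x1; rewrite /dg; move: (k * k) cW lt; lia.
move: pW; rewrite inE => /and3P[pP' ncx npP].
move: pn; rewrite inE pP' /= !inE negb_or => /andP[ncy nex].
pose Q := (x, p.2) |: ((p.1, y) |: (P' :\ p)).
have sP : P' :\ p \subset P' by apply: subsetDl.
have okQ0 : ok (P' :\ p) by apply: okp_sub okP'.
have pd : p.1 \notin dom (P' :\ p).
  apply/imsetP => -[q]; rewrite !inE => /andP[qp qP'] E.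
  have := inj _ _ pP' qP'; rewrite E eqxx => /esym/eqP E2.
  by case/negP: qp; apply/eqP; rewrite (surjective_pairing p) E E2 -surjective_pairing.
have pc : p.2 \notin cod (P' :\ p).
  apply/imsetP => -[q]; rewrite !inE => /andP[qp qP'] E.
  have := inj _ _ pP' qP'; rewrite E eqxx => /eqP E2.
  by case/negP: qp; apply/eqP; rewrite (surjective_pairing p) E E2 -surjective_pairing.
have yc : y \notin cod (P' :\ p) by apply: contra yP' => /(subsetP (imsetS _ sP)).
have xd : x \notin dom (P' :\ p) by apply: contra xP' => /(subsetP (imsetS _ sP)).
have xnp : x != p.1 by apply: contraNneq xP' => ->; apply: mem_dom.
have ynp : p.2 != y by apply: contraNneq yP' => <-; apply: mem_cod.
have okQ1 : ok ((p.1, y) |: (P' :\ p)).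
  by apply: okp_ext => //; apply: contra ncy; apply: conf_sub.
have xd1 : x \notin dom ((p.1, y) |: (P' :\ p)).
  by rewrite /dom imsetU1 in_setU1 /= negb_or xnp.
have pc1 : p.2 \notin cod ((p.1, y) |: (P' :\ p)).
  by rewrite /cod imsetU1 in_setU1 /= negb_or ynp.
have okQ : ok Q.
  apply: okp_ext => //; rewrite conf_ext (negbTE nex) /= orbF.
  by apply: contra ncx; apply: conf_sub.
have := maxP' Q; rewrite {2}/Q cardsU1 (contra (@mem_dom _ _ _ (x, p.2)) xd1) cardsU1.
rewrite (contra (@mem_dom _ _ _ (p.1, y)) pd) [#|P'|](cardsD1 p) pP'.
rewrite /= !add1n => H; suff /H : ok Q /\ P \subset Q by rewrite ltnn.
split=> //; apply/subsetP => q qP; rewrite !inE (subsetP sPP' _ qP).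
by rewrite (contraNneq (_ : q = p -> p \in P) npP) ?orbT // => <-.
Qed.

(** Greedy placement. A step uses up one vertex and, its partner being light, adds at most [k]
    conflicts to any vertex of either side; hence the price [k.+1] per step. *)
Lemma place_set m P (W1 : {set V1}) (W2 : {set V2}) : ok P ->
  (forall x, x \notin dom P -> dg e1 x <= k) ->
  (forall y, y \notin cod P -> dg e2 y <= k) ->
  #|W1| + #|W2| <= m ->
  (forall x, x \in W1 -> x \notin dom P -> dg (cf P) x + #|P| + m * k.+1 <= n) ->
  (forall y, y \in W2 -> y \notin cod P -> dg (tr (cf P)) y + #|P| + m * k.+1 <= n) ->
  exists P', [/\ ok P', P \subset P', #|P'| <= #|P| + m,
     W1 \subset dom P' /\ W2 \subset cod P' &
     (forall x, dg (cf P') x <= dg (cf P) x + m * k) /\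
     (forall y, dg (tr (cf P')) y <= dg (tr (cf P)) y + m * k)].
Proof.
elim: m P W1 W2 => [|m IHm] P W1 W2 okP t1 t2 cW f1 f2.
  exists P; split=> //; rewrite ?addn0 //.
    move: cW; rewrite leqn0 addn_eq0 !cards_eq0 => /andP[/eqP -> /eqP ->].
    by rewrite !sub0set.
  by split=> z; rewrite addn0.
have [/subsetPn[x xW xP]|/negbNE sW1] := boolP (~~ (W1 \subset dom P)).
  have [y yP okP'] : exists2 y, y \notin cod P & ok ((x, y) |: P).
    by apply: place_one => //; have := f1 x xW xP; rewrite n2; nlia.
  have nP : (x, y) \notin P by apply: contra xP => /mem_dom.
  have cP : #|(x, y) |: P| = #|P|.+1 by rewrite cardsU1 nP.
  have g1 z : dg (cf ((x, y) |: P)) z <= dg (cf P) z + k.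
    apply: leq_trans (dg_conf_ext _ _ s2 _ _ _ _) _; rewrite leq_add2l.
    by case: (e1 z x) => //; apply: t2.
  have g2 z : dg (tr (cf ((x, y) |: P))) z <= dg (tr (cf P)) z + k.
    rewrite -!dg_conf_sw sw_setU1.
    apply: leq_trans (dg_conf_ext _ _ s1 _ _ _ _) _; rewrite leq_add2l.
    by case: (e2 z y) => //; apply: t1.
  have dP z : z \notin dom ((x, y) |: P) -> z \notin dom P.
    by rewrite /dom imsetU1 in_setU1 negb_or => /andP[].
  have cdP z : z \notin cod ((x, y) |: P) -> z \notin cod P.
    by rewrite /cod imsetU1 in_setU1 negb_or => /andP[].
  have [|||z zW zP|z zW zP|P' [okP'' sP' cP' [s1' s2'] [l1 l2]]] :=
      IHm ((x, y) |: P) (W1 :\ x) W2 okP'.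
  + by move=> z /dP; apply: t1.
  + by move=> z /cdP; apply: t2.
  + by have := cardsD1 x W1; rewrite xW; nlia.
  + have := f1 z; rewrite (dP z zP) cP; move: zW; rewrite !inE => /andP[_ ->].
    by move/(_ isT isT); have := g1 z; nlia.
  + by have := f2 z zW (cdP z zP); have := g2 z; rewrite cP; nlia.
  exists P'; split=> //.
  + exact: subset_trans (subsetUr _ _) sP'.
  + by move: cP'; rewrite cP; nlia.
  + split=> //; apply/subsetP => z zW; have [->|nzx] := eqVneq z x.
      by apply: (@mem_dom _ _ _ (x, y)); apply: (subsetP sP'); rewrite setU11.
    by apply: (subsetP s1'); rewrite !inE nzx.
  + by split=> z; [have := l1 z; have := g1 z | have := l2 z; have := g2 z]; nlia.
have [/subsetPn[y yW yP]|/negbNE sW2] := boolP (~~ (W2 \subset cod P)).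
  have [x xP okP'] : exists2 x, x \notin dom P & ok ((x, y) |: P).
    have [] := @place_one _ _ e2 e1 (tr e3) s2 i2 s1 (sw P) y (okp_sw okP).
    + by rewrite dom_sw.
    + by rewrite dg_conf_sw card_sw n1; have := f2 y yW yP; nlia.
    move=> x xP /okp_sw; rewrite sw_setU1 sw_sw => ok'; exists x => //.
    by rewrite -cod_sw.
  have nP : (x, y) \notin P by apply: contra xP => /mem_dom.
  have cP : #|(x, y) |: P| = #|P|.+1 by rewrite cardsU1 nP.
  have g1 z : dg (cf ((x, y) |: P)) z <= dg (cf P) z + k.
    apply: leq_trans (dg_conf_ext _ _ s2 _ _ _ _) _; rewrite leq_add2l.
    by case: (e1 z x) => //; apply: t2.
  have g2 z : dg (tr (cf ((x, y) |: P))) z <= dg (tr (cf P)) z + k.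
    rewrite -!dg_conf_sw sw_setU1.
    apply: leq_trans (dg_conf_ext _ _ s1 _ _ _ _) _; rewrite leq_add2l.
    by case: (e2 z y) => //; apply: t1.
  have dP z : z \notin dom ((x, y) |: P) -> z \notin dom P.
    by rewrite /dom imsetU1 in_setU1 negb_or => /andP[].
  have cdP z : z \notin cod ((x, y) |: P) -> z \notin cod P.
    by rewrite /cod imsetU1 in_setU1 negb_or => /andP[].
  have [|||z zW zP|z zW zP|P' [okP'' sP' cP' [s1' s2'] [l1 l2]]] :=
      IHm ((x, y) |: P) W1 (W2 :\ y) okP'.
  + by move=> z /dP; apply: t1.
  + by move=> z /cdP; apply: t2.
  + by have := cardsD1 y W2; rewrite yW; nlia.
  + by have := f1 z zW (dP z zP); have := g1 z; rewrite cP; nlia.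
  + have := f2 z; rewrite (cdP z zP) cP; move: zW; rewrite !inE => /andP[_ ->].
    by move/(_ isT isT); have := g2 z; nlia.
  exists P'; split=> //.
  + exact: subset_trans (subsetUr _ _) sP'.
  + by move: cP'; rewrite cP; nlia.
  + split=> //; apply/subsetP => z zW; have [->|nzx] := eqVneq z y.
      by apply: (@mem_cod _ _ _ (x, y)); apply: (subsetP sP'); rewrite setU11.
    by apply: (subsetP s2'); rewrite !inE nzx.
  + by split=> z; [have := l1 z; have := g1 z | have := l2 z; have := g2 z]; nlia.
by exists P; split=> //; rewrite ?leq_addr //; split=> z; rewrite leq_addr.
Qed.

End Finish.

(** * Hosting the heavy vertices of G2 *)

Section Hosting.
Variables (V1 V2 : finType) (e1 : rel V1) (e2 : rel V2) (e3 : V1 -> V2 -> bool).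
Hypotheses (s1 : symmetric e1) (i1 : irreflexive e1) (s2 : symmetric e2) (i2 : irreflexive e2).
Variables (n k T : nat) (P0 : {set V1 * V2}).
Hypotheses (n1 : #|V1| = n) (n2 : #|V2| = n) (k12 : 12 <= k).
Hypothesis iso1 : forall p x, p \in P0 -> ~~ e1 x p.1.
Hypothesis iso2 : forall p y, p \in P0 -> ~~ e2 y p.2.
Implicit Types P : {set V1 * V2}.
Local Notation ok := (okp e1 e2 e3).
Local Notation cf := (conf e1 e2 e3).

Definition H1 : {set V1} := [set x | k < dg e1 x].
Definition H2 : {set V2} := [set y | k < dg e2 y].
Definition Bad : {set V2} := [set w | 12 <= dg e2 w].
(* The weights sum to at most the degree sum of G1, and light vertices that are not good weigh at least 4. *)
Definition wt (u : V1) : nat := 2 * #|nb e1 u :&: H1| + #|nb e1 u :\: H1|.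
Definition good (u : V1) : bool := (u \notin H1) && (wt u <= 3).

(* T is the room kept free at each unplaced vertex.  For heavy x the set Bad counts as forbidden too,
   since the hosts of the heavy vertices of G1 will be taken outside Bad. *)
Definition InvA P : Prop :=
  [/\ ok P /\ P0 \subset P,
      forall p, p \in P -> p \notin P0 -> p.2 \in H2 /\ good p.1,
      forall x, x \in H1 -> #|nb (cf P) x :|: Bad| + T <= n &
      forall x, x \notin H1 -> x \notin dom P -> dg (cf P) x + T <= n].

(* The heavy, resp. unplaced light, vertices that would be overloaded if a neighbour of theirs hosted y. *)
Definition Ov P y : {set V1} :=
  [set x in H1 | n < #|nb (cf P) x :|: Bad :|: nb e2 y| + T].
Definition Ovt P y : {set V1} :=
  [set x | [&& x \notin H1, x \notin dom P & n < #|nb (cf P) x :|: nb e2 y| + T]].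
Definition Hosts P y : {set V1} :=
  [set u | [&& u \notin H1, u \notin dom P, ~~ cf P u y & [disjoint nb e1 u & Ovt P y]]].

Lemma H2_Bad : H2 \subset Bad.
Proof. by apply/subsetP => y; rewrite !inE; apply: leq_trans; apply: leqW. Qed.

Lemma wt_ge u : dg e1 u <= wt u.
Proof. by rewrite /dg /wt -(cardsID H1 (nb e1 u)) leq_add2r leq_pmull. Qed.

Lemma good_dg u : good u -> dg e1 u <= 3.
Proof. by case/andP=> _; apply: leq_trans (wt_ge u). Qed.

Lemma good_H1 u : good u -> #|nb e1 u :&: H1| <= 1.
Proof. by case/andP=> _; rewrite /wt; lia. Qed.

(** An edge between a light and a heavy vertex has weight 2 at its light end, which accounts for
    both of its ends. *)
Lemma sum_wt : \sum_(u in ~: H1) wt u <= size_e e1.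
Proof.
rewrite /wt big_split /= -big_distrr /= mul2n -addnn -addnA addnC.
have -> : size_e e1 = \sum_(u in ~: H1) dg e1 u + \sum_(u in H1) dg e1 u.
  rewrite /size_e (bigID (mem H1)) /= addnC; congr (_ + _).
  by apply: eq_bigl => x; rewrite in_setC.
apply: leq_add; last first.
  rewrite double_count; apply: leq_sum => x _.
  rewrite /dg; apply/subset_leq_card/subsetP => z; by rewrite !inE /tr s1 => /andP[->].
rewrite -big_split /=; apply: leq_sum => x _.
by rewrite /dg -[leqRHS](cardsID H1 (nb e1 x)).
Qed.

Lemma good_H1_eq u x x' : good u -> x \in H1 -> x' \in H1 -> e1 x u -> e1 x' u -> x = x'.
Proof.
move=> /good_H1/card_le1_eqP H hx hx' e e'.
by apply: H; rewrite in_setI ?hx ?hx' inE s1 ?e ?e'.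
Qed.

Lemma InvA_step P y u : InvA P -> y \in H2 -> y \notin cod P -> good u ->
  u \notin dom P -> ~~ cf P u y ->
  (forall x, x \in H1 -> e1 x u -> #|nb (cf P) x :|: Bad :|: nb e2 y| + T <= n) ->
  (forall x, x \notin H1 -> x \notin dom P -> e1 x u -> #|nb (cf P) x :|: nb e2 y| + T <= n) ->
  InvA ((u, y) |: P).
Proof.
move=> [[okP sP] hP b1 b2] yH yP gu uP nc o1 o2; split.
- by split; [apply: okp_ext | apply: subset_trans (subsetUr _ _)].
- by move=> p; rewrite in_setU1 => /predU1P[->|pP] //; apply: hP.
- move=> x xH; rewrite nb_conf_ext //; case: (boolP (e1 x u)) => e.
    by rewrite setUAC; apply: o1.
  by rewrite setU0; apply: b1.
- move=> x xH; rewrite /dom imsetU1 in_setU1 negb_or => /andP[_ xP].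
  rewrite /dg nb_conf_ext //; case: (boolP (e1 x u)) => e; first exact: o2.
  by rewrite setU0; apply: b2.
Qed.

Lemma InvA_host P y u : InvA P -> y \in H2 -> y \notin cod P -> good u ->
  u \in Hosts P y -> [disjoint nb e1 u & Ov P y] -> InvA ((u, y) |: P).
Proof.
move=> invP yH yP gu; rewrite inE => /and4P[uH uP nc dt] d1.
apply: InvA_step => // x xH; [move=> e | move=> xP e]; rewrite leqNgt; apply/negP => lt.
  move/disjoint_setI0: d1 => /setP/(_ x); rewrite !inE s1 e lt.
  by move: xH; rewrite inE => ->.
move/disjoint_setI0: dt => /setP/(_ x); rewrite !inE s1 e lt xP.
by move: xH; rewrite inE => ->.
Qed.

Lemma card_Hosts P y : n <= #|Hosts P y| + (#|H1| + #|P| + dg (tr (cf P)) y + k * #|Ovt P y|).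
Proof.
have : [set: V1] \subset Hosts P y :|: (H1 :|: dom P :|: nb (tr (cf P)) y
    :|: \bigcup_(x in Ovt P y) nb e1 x).
  apply/subsetP => u _; rewrite !in_setU [u \in Hosts _ _]inE.
  case: (u \in H1) => //=; rewrite ?orbT ?orbF //=.
  case: (u \in dom P) => //=; rewrite ?orbT ?orbF //=.
  rewrite [u \in nb (tr _) _]inE /tr; case: (cf P u y) => //=; rewrite ?orbT ?orbF //=.
  rewrite -implyNb; apply/implyP => /pred0Pn[x /andP[/= ux xO]].
  by apply/bigcupP; exists x => //; move: ux; rewrite !inE s1.
move/subset_leq_card; rewrite cardsT n1 => /leq_trans; apply.
apply: leq_trans (leq_card_setU _ _) _; rewrite leq_add2l.
apply: leq_trans (leq_card_setU _ _) _; apply: leq_add.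
  apply: leq_trans (leq_card_setU _ _) _; rewrite leq_add2r.
  by apply: leq_trans (leq_card_setU _ _) _; rewrite leq_add2l card_dom_le.
apply: leq_trans (leq_card_bigcup _ _) _; rewrite mulnC -sum_nat_const.
by apply: leq_sum => x; rewrite !inE => /and3P[]; rewrite -leqNgt.
Qed.

(** If no good host avoids [Ov P y], then every good host has a heavy neighbour and weighs at least
    2, while every other host weighs at least 4; this gives the bound on [4 * #|Hosts P y|]. A
    single overloaded vertex would have all good hosts among its neighbours, too few by the last
    hypothesis, so there are two overloaded vertices. *)
Lemma host_or_stuck P y L : InvA P -> y \in H2 -> y \notin cod P ->
  n <= #|Hosts P y| + (dg (tr e3) y + L) ->
  (forall x, size_e e1 + 2 * dg e1 x + 4 * dg (tr e3) y + 4 * L < 4 * n) ->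
  (exists2 u, good u /\ u \in Hosts P y & InvA ((u, y) |: P)) \/
  exists x x', [/\ x != x', x \in Ov P y, x' \in Ov P y,
     4 * #|Hosts P y| <= size_e e1 + 2 * #|[set u in Hosts P y | good u]| &
     [set u in Hosts P y | good u] \subset \bigcup_(z in Ov P y) nb e1 z].
Proof.
move=> invP yH yP cZ cc.
have [[u [gu uZ du]]|no] := classic (exists u, [/\ good u, u \in Hosts P y & [disjoint nb e1 u & Ov P y]]).
  by left; exists u => //; apply: InvA_host.
right.
have sub : [set u in Hosts P y | good u] \subset \bigcup_(z in Ov P y) nb e1 z.
  apply/subsetP => u; rewrite inE => /andP[uZ gu].
  case: (boolP [disjoint nb e1 u & Ov P y]) => [du|]; first by case: no; exists u.
  move/pred0Pn => [x /andP[/= ux xO]]; apply/bigcupP; exists x => //.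
  by move: ux; rewrite !inE s1.
have cnt : 4 * #|Hosts P y| <= size_e e1 + 2 * #|[set u in Hosts P y | good u]|.
  apply: leq_trans (_ : \sum_(u in Hosts P y) (wt u + 2 * good u) <= _).
    apply: sum_card_mul => u uZ; case: (boolP (good u)) => [gu|].
      have : 0 < #|nb e1 u :&: H1|.
        case: (boolP [disjoint nb e1 u & Ov P y]) => [du|]; first by case: no; exists u.
        move/pred0Pn => [x /andP[/= ux xO]]; apply/card_gt0P; exists x.
        by rewrite in_setI ux; move: xO; rewrite inE => /andP[].
      by rewrite /wt; lia.
    by move: uZ; rewrite inE => /and4P[uH _ _ _]; rewrite /good uH -ltnNge addn0.
  rewrite big_split /= leq_add //.
    apply: leq_trans sum_wt; apply: sum_subset; apply/subsetP => u.
    by rewrite !inE => /and4P[].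
  rewrite -big_distrr leq_mul2l /= -sum1_card big_mkcond [leqRHS]big_mkcond /=.
  by apply: leq_sum => u _; rewrite inE; case: (u \in Hosts P y) => //; case: (good u).
have card_le z : Ov P y \subset [set z] -> False.
  move=> s; have: #|[set u in Hosts P y | good u]| <= dg e1 z.
    apply: leq_trans (subset_leq_card sub) _; apply/subset_leq_card/subsetP => u.
    by case/bigcupP => x /(subsetP s); rewrite inE => /eqP ->.
  move: (cc z) cnt cZ; move: #|Hosts P y| #|[set u in _ | _]| => a b; clear; lia.
have [z _] : exists z, z \in V1.
  apply/existsP; case: (pickP [pred z : V1 | true]) => [z _|no1]; first by apply/existsP; exists z.
  have : n = 0 by rewrite -n1; apply: eq_card0 => z; have := no1 z.
  have V20 : #|V2| = 0 -> False by move=> h; have := card0_eq h y; rewrite inE.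
  by move=> n0; case: V20; rewrite n2.
have [x xO] : exists x, x \in Ov P y.
  apply/set0Pn/negP => /eqP E; apply: (card_le z); rewrite E sub0set.
  done.
have /subsetPn[x' xO' nx] : ~~ (Ov P y \subset [set x]) by apply/negP => /card_le.
by exists x, x'; split=> //; move: nx; rewrite inE eq_sym.
Qed.

(** Neighbours in [Bad] are left out because [Bad] is already counted as forbidden at every heavy
    vertex of G1. *)
Definition beta (y : V2) : nat := #|nb e2 y :\: Bad|.
Definition Rl P (x : V1) : {set V2} := (\bigcup_(p in P | e1 x p.1) nb e2 p.2) :\: Bad.
Definition Sl P (x : V1) : nat := \sum_(p in P | e1 x p.1) beta p.2.

Lemma card_Rl P x : #|Rl P x| <= Sl P x.
Proof.
rewrite /Rl setDE big_distrl /=; apply: leq_trans (leq_card_bigcup _ _) _.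
by apply: leq_sum => p _; rewrite -setDE.
Qed.

Lemma beta_le y : dg e2 y <= beta y + #|Bad|.
Proof.
rewrite /dg /beta -(cardsID Bad (nb e2 y)) addnC leq_add2l.
by apply/subset_leq_card; apply: subsetIr.
Qed.

(** A good host has at most one heavy neighbour, so a hosted vertex loads at most one member of [A];
    the pairs of [P0] are isolated and load none. *)
Lemma sum_loads P (A : {set V1}) y : InvA P -> A \subset H1 -> y \in H2 -> y \notin cod P ->
  \sum_(x in A) Sl P x + beta y <= \sum_(w in H2) beta w.
Proof.
move=> [[okP _] hP _ _] sA yH yP.
have okD : ok (P :\: P0) by apply: okp_sub okP; apply: subsetDl.
apply: leq_trans (_ : \sum_(w in y |: cod (P :\: P0)) beta w <= _); last first.
  apply: sum_subset; apply/subsetP => w; rewrite in_setU1 => /predU1P[->//|].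
  by case/imsetP => p; rewrite inE => /andP[npP pP] ->; have [] := hP p pP npP.
rewrite big_setU1 /=; last first.
  by apply: contra yP; apply/subsetP/imsetS/subsetDl.
rewrite addnC leq_add2l /cod big_imset /=; last first.
  have [inj _ _] := okD => p q pP qP E; have := inj _ _ pP qP.
  rewrite E eqxx => /eqP E1; by rewrite (surjective_pairing p) E1 E -surjective_pairing.
rewrite /Sl.
under eq_bigr do rewrite big_mkcondr /=.
rewrite exchange_big /= (bigID (mem P0)) /= big1 ?add0n; last first.
  move=> p /andP[_ pP0]; apply: big1 => x _.
  by rewrite (negbTE (iso1 _ pP0)).
rewrite (eq_bigl (fun p => p \in P :\: P0)); last by move=> p; rewrite inE andbC.
apply: leq_sum => p; rewrite inE => /andP[npP pP].
have [_ gp] := hP p pP npP.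
rewrite -big_mkcondr /= sum_nat_const -{2}[beta p.2]mul1n leq_mul2r; apply/orP; right.
apply: leq_trans (good_H1 gp); apply/subset_leq_card/subsetP => x.
by rewrite !inE => /andP[/(subsetP sA) xH e]; rewrite s1 e; move: xH; rewrite inE.
Qed.

(** An edge from [H2] to the complement of [Bad] contributes at both ends to the degree sum, and
    each vertex of [Bad] outside [H2] contributes at least 12 more. *)
Lemma beta_edges : 2 * \sum_(w in H2) beta w + 12 * #|Bad| <= size_e e2 + 12 * #|H2|.
Proof.
have E : size_e e2 = \sum_(w in ~: Bad) dg e2 w + (\sum_(w in Bad :\: H2) dg e2 w + \sum_(w in H2) dg e2 w).
  rewrite /size_e (bigID (mem Bad)) /= addnC; congr (_ + _).
    by apply: eq_bigl => x; rewrite in_setC.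
  rewrite (big_setID H2) /= addnC (setIidPr H2_Bad) //.
have cB : #|Bad| = #|Bad :\: H2| + #|H2|.
  by rewrite addnC -(cardsID H2 Bad) (setIidPr H2_Bad).
have b1 : 12 * #|Bad :\: H2| <= \sum_(w in Bad :\: H2) dg e2 w.
  by apply: sum_card_mul => w; rewrite in_setD => /andP[_]; rewrite inE.
have b2 : \sum_(w in H2) beta w <= \sum_(w in H2) dg e2 w.
  by apply: leq_sum => w _; apply/subset_leq_card/subsetDl.
have b3 : \sum_(w in H2) beta w <= \sum_(w in ~: Bad) dg e2 w.
  rewrite /beta; under eq_bigr do rewrite setDE.
  rewrite double_count; apply: leq_sum => w _; rewrite /dg.
  by apply/subset_leq_card/subsetP => z; rewrite !inE /tr s2 => /andP[->].
move: E cB b1 b2 b3; move: (size_e e2) #|Bad| #|H2| #|Bad :\: H2| (\sum_(w in H2) beta w).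
clear; lia.
Qed.

Lemma nb_cf_sub P x : nb (cf P) x :|: Bad \subset nb e3 x :|: Bad :|: Rl P x.
Proof.
rewrite nb_conf // /Rl; apply/subsetP => w; rewrite !in_setU in_setD.
by case: (w \in Bad); rewrite ?orbT ?orbF //= orbF.
Qed.

Lemma Ov_bound P x y : x \in Ov P y ->
  n < dg e3 x + #|Bad| + #|Rl P x :\: nb e2 y| + beta y + T.
Proof.
rewrite inE => /andP[_ lt]; apply: leq_trans lt _; rewrite leq_add2r.
apply: leq_trans (_ : #|nb e3 x :|: Bad :|: (Rl P x :\: nb e2 y) :|: (nb e2 y :\: Bad)| <= _).
  apply/subset_leq_card/subsetP => w; rewrite in_setU => /orP[/(subsetP (nb_cf_sub P x))|yw].
    by rewrite !in_setU !in_setD; do !case: (w \in _).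
  by rewrite !in_setU !in_setD yw; case: (w \in Bad); rewrite ?orbT.
apply: leq_trans (leq_card_setU _ _) _; rewrite leq_add2r.
apply: leq_trans (leq_card_setU _ _) _; rewrite leq_add2r.
exact: leq_card_setU.
Qed.

Section Stuck.
Variables (C L : nat).
(** These sums are at most script D plus 4. The 16 in the next hypothesis collects this 4 and the at
    most 4 edges of G3 between [x, x'] and [y, y'] that are counted twice, all doubled. *)
Definition top_value t := exists x y, t = dg e2 y + dg e3 x \/ t = dg e1 x + dg (tr e3) y.
Hypothesis H5 : forall x x' y y' t, x != x' -> y != y' -> top_value t ->
  size_e e1 + size_e e2 + 2 * (dg e3 x + dg e3 x' + dg (tr e3) y + dg (tr e3) y') + 2 * t + 2 * C
    <= 6 * n + 16.

(** Two vertices [x] and [x'] are nearly saturated at once. Their [Ov_bound] inequalities with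
    [sum_loads] and [beta_edges] bound the degree sum of G2 from below, the host count does the same
    for G1, and [H5] leaves the stated margins. For [t = dg e2 y + dg e3 z] the degree of [y]
    cancels in the first fact, so that [dg e3 z] and [dg (tr e3) y'] are of order [k]. *)
Lemma stuck_facts P y x x' y' t : InvA P -> y \in H2 -> y \notin cod P ->
  n <= #|Hosts P y| + (dg (tr e3) y + L) ->
  x != x' -> x \in Ov P y -> x' \in Ov P y ->
  4 * #|Hosts P y| <= size_e e1 + 2 * #|[set u in Hosts P y | good u]| ->
  y != y' -> top_value t ->
  [/\ dg (tr e3) y' + t + 4 * #|Bad| + C < dg e2 y + 2 * T + L + 6 * #|H2| + 8,
      n + C + t + dg (tr e3) y' + 4 * #|Bad| <=
        #|[set u in Hosts P y | good u]| + dg e2 y + dg (tr e3) y + 2 * L + 6 + 6 * #|H2| + 2 * T,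
      2 * \sum_(w in H2) beta w + 2 * C + 2 * dg e3 x + 2 * dg e3 x' + 2 * t + 12 * #|Bad| <= 4 * n + 16 + 2 * L + 12 * #|H2|,
      Sl P x + dg e3 x + t + 5 * #|Bad| + C <= n + 7 + L + T + 6 * #|H2| &
      Sl P x' + dg e3 x' + t + 5 * #|Bad| + C <= n + 7 + L + T + 6 * #|H2|].
Proof.
move=> invP yH yP cZ xx' xO xO' cnt yy' tv.
have h5 := H5 xx' yy' tv; clear tv.
have sA : [set x; x'] \subset H1.
  apply/subsetP => z; rewrite !in_set2 => /orP[] /eqP ->.
    by move: xO; rewrite inE => /andP[].
  by move: xO'; rewrite inE => /andP[].
have := sum_loads invP sA yH yP; rewrite big_setU1 ?inE //= big_set1 => sl.
have be := beta_edges.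
have ox := Ov_bound xO; have ox' := Ov_bound xO'.
have bd : beta y <= dg e2 y by apply/subset_leq_card/subsetDl.
have r1 : #|Rl P x :\: nb e2 y| <= Sl P x.
  by apply: leq_trans (card_Rl P x); apply/subset_leq_card/subsetDl.
have r2 : #|Rl P x' :\: nb e2 y| <= Sl P x'.
  by apply: leq_trans (card_Rl P x'); apply/subset_leq_card/subsetDl.
have g : #|[set u in Hosts P y | good u]| <= #|Hosts P y|.
  by apply/subset_leq_card/subsetP => u; rewrite inE => /andP[].
move: h5 sl be ox ox' bd r1 r2 g cZ cnt.
move: (size_e e1) (size_e e2) (dg e3 x) (dg e3 x') (dg (tr e3) y) (dg (tr e3) y') t (Sl P x) (Sl P x').
move: (beta y) (\sum_(w in _) _) #|Bad| #|H2| #|_ :\: _| #|Rl P x' :\: _| (dg e2 y) #|Hosts P y| #|[set _ | _ & _]|.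
clear; move=> *; split; lia.
Qed.

End Stuck.

Definition hostn P y : nat := #|[set p in P :\: P0 | e2 y p.2]|.

Lemma dg_host P y : InvA P -> dg (tr (cf P)) y <= dg (tr e3) y + 3 * hostn P y.
Proof.
move=> [_ hP _ _]; rewrite -dg_conf_sw.
apply: leq_trans (dg_conf _ _ _ _ s1) _; rewrite leq_add2l.
have -> : \sum_(p in sw P | e2 y p.1) dg e1 p.2 = \sum_(p in P | e2 y p.2) dg e1 p.1.
  rewrite (reindex (fun p : V1 * V2 => (p.2, p.1))) /=; last first.
    by exists (fun p => (p.2, p.1)) => -[].
  by apply: eq_bigl => -[a b]; rewrite inE.
rewrite (bigID (mem P0)) /= big1 ?add0n; last first.
  by move=> p /andP[/andP[_ e]] pP0; move: (iso2 y pP0); rewrite e.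
rewrite mulnC -sum_nat_const; apply: leq_trans (_ : \sum_(p in [set p in P :\: P0 | e2 y p.2]) dg e1 p.1 <= _).
  by apply/eq_leq/eq_bigl => p; rewrite !inE andbC andbA.
apply: leq_sum => p; rewrite !inE => /andP[/andP[npP pP] _].
by have [_ /good_dg] := hP p pP npP.
Qed.

(** A light vertex with [8 * dg e3 x <= n] and no neighbour among the hosts has no conflicts besides
    G3 and cannot be overloaded; each host has at most 3 neighbours. *)
Lemma Ovt_light P y m : InvA P -> #|[set x | n < 8 * dg e3 x]| <= m ->
  8 * (dg e2 y + T) <= 7 * n -> #|Ovt P y| <= m + 3 * #|P :\: P0|.
Proof.
move=> [_ hP _ _] hm hy.
apply: leq_trans (_ : #|[set x | n < 8 * dg e3 x] :|: \bigcup_(p in P :\: P0) nb e1 p.1| <= _).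
  apply/subset_leq_card/subsetP => x; rewrite inE => /and3P[_ _ lt].
  rewrite in_setU inE; case: ltnP => //= le8; apply/bigcupP.
  have [/existsP[p /andP[pP e]]|no] := boolP [exists p in P :\: P0, e1 x p.1].
    by exists p => //; rewrite inE s1.
  suff : #|nb (cf P) x :|: nb e2 y| <= dg e3 x + dg e2 y by lia.
  apply: leq_trans (leq_card_setU _ _) _; rewrite leq_add2r.
  apply/subset_leq_card/subsetP => w; rewrite !inE => /confP[//|[p pP [e _]]].
  case/existsP: no; exists p; rewrite inE pP e !andbT.
  by apply/negP => pP0; move: (iso1 x pP0); rewrite e.
apply: leq_trans (leq_card_setU _ _) _; apply: leq_add => //.
apply: leq_trans (leq_card_bigcup _ _) _; rewrite mulnC -sum_nat_const.
apply: leq_sum => p; rewrite in_setD => /andP[npP pP].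
by have [_ /good_dg] := hP p pP npP.
Qed.

Lemma Hosts_count P y : InvA P ->
  n <= #|Hosts P y| + (dg (tr e3) y + (#|H1| + #|P| + 3 * hostn P y + k * #|Ovt P y|)).
Proof.
move=> invP; have := card_Hosts P y; have := dg_host y invP.
move: (dg (tr (cf P)) y) (dg (tr e3) y) #|H1| #|P| (hostn P y) (k * _) #|_|; clear; lia.
Qed.

Lemma P_card P : InvA P -> #|P| = #|P0| + #|P :\: P0|.
Proof. by move=> [[_ sP] _ _ _]; rewrite cardsD (setIidPr sP) subnKC // subset_leq_card. Qed.

Lemma hostn_le P y : hostn P y <= #|P :\: P0|.
Proof. by apply/subset_leq_card/subsetP => p; rewrite inE => /andP[]. Qed.

(** The freed vertex [p.1] has to regain room [T]. It is good and adjacent to the heavy [x'], so it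
    has at most one light neighbour; all hosts being light, its conflicts come from G3 and at most
    one hosted vertex. *)
Lemma InvA_del P x' p : InvA P -> p \in P -> p \notin P0 -> x' \in H1 -> e1 x' p.1 ->
  (forall y, dg e3 p.1 + dg e2 y + T <= n) -> InvA (P :\ p).
Proof.
move=> [[okP sP] hP b1 b2] pP npP xH e le_n.
have sPP : P :\ p \subset P by apply: subsetDl.
split.
- split; first exact: okp_sub okP.
  by rewrite subsetD1 sP.
- by move=> q; rewrite in_setD1 => /andP[_ qP]; apply: hP.
- move=> x /b1; apply: leq_trans; rewrite leq_add2r; apply/subset_leq_card/setSU.
  by apply/subsetP => w; rewrite !inE; apply: conf_sub.
move=> x xH1; case: (boolP (x \in dom P)) => [|xP _]; last first.
  apply: leq_trans (b2 x xH1 xP); rewrite leq_add2r.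
  by apply: leq_dg => w; apply: conf_sub.
case/imsetP => q qP ->; have [->|qp] := eqVneq q p; last first.
  by case/negP; apply: (@mem_dom _ _ _ q); rewrite !inE qp.
move=> _; have [_ gp] := hP p pP npP.
have n1' : #|nb e1 p.1 :\: H1| <= 1.
  have : 0 < #|nb e1 p.1 :&: H1|.
    by apply/card_gt0P; exists x'; rewrite in_setI xH inE s1 e.
  by case/andP: gp => _; rewrite /wt; nlia.
have okQ : ok (P :\ p) by apply: okp_sub okP.
apply: leq_trans (_ : dg e3 p.1 + \sum_(q in P :\ p | q.1 \in nb e1 p.1 :\: H1) dg e2 q.2 + T <= _).
  rewrite leq_add2r; apply: leq_trans (dg_conf _ _ _ _ s2) _; rewrite leq_add2l.
  apply/eq_leq/eq_bigl => r; case: (boolP (r \in P :\ p)) => //=.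
  rewrite !inE => /andP[_ rP]; case e': (e1 p.1 r.1); rewrite ?andbF //= andbT.
  have npr : r \notin P0 by apply/negP => /(iso1 p.1); rewrite e'.
  by have [_ /andP[]] := hP r rP npr; rewrite inE => ->.
apply: leq_trans (_ : dg e3 p.1 + (n - T - dg e3 p.1) * #|nb e1 p.1 :\: H1| + T <= _).
  rewrite leq_add2r leq_add2l; apply: sum_pairs_le okQ _ => r _ _.
  by have := le_n r.2; nlia.
have := le_n p.2; move: n1'; case: #|_ :\: _| => [|[|//]] _; nlia.
Qed.

End Hosting.

(* The tangent to q |-> 20 q^2 makes the constraint 20 k^2 <= n available to linear arithmetic. *)
Lemma tangent (q k n : nat) : 20 * (k * k) <= n -> 40 * (q * k) <= n + 20 * (q * q).
Proof. by have [h _] := nat_Cauchy q k; move: h; rewrite -!mulnn; lia. Qed.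

(** * Hosting all of H2 with room 390 k *)

Section PhaseA.
Variables (V1 V2 : finType) (e1 : rel V1) (e2 : rel V2) (e3 : V1 -> V2 -> bool).
Hypotheses (s1 : symmetric e1) (i1 : irreflexive e1) (s2 : symmetric e2) (i2 : irreflexive e2).
Variables (n k C : nat) (P0 : {set V1 * V2}).
Hypotheses (n1 : #|V1| = n) (n2 : #|V2| = n).
Hypothesis iso1 : forall p x, p \in P0 -> ~~ e1 x p.1.
Hypothesis iso2 : forall p y, p \in P0 -> ~~ e2 y p.2.
Implicit Types P : {set V1 * V2}.
Local Notation ok := (okp e1 e2 e3).
Local Notation cf := (conf e1 e2 e3).
Local Notation T := (390 * k).
Local Notation H1 := (H1 e1 k).
Local Notation H2 := (H2 e2 k).
Local Notation Bad := (Bad e2).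
Local Notation InvA := (InvA e1 e2 e3 n k T P0).
Local Notation Ov := (Ov e1 e2 e3 n k T).
Local Notation Ovt := (Ovt e1 e2 e3 n k T).
Local Notation Hosts := (Hosts e1 e2 e3 n k T).
Local Notation beta := (beta e2).
Local Notation good := (good e1 k).
Local Notation H5 := (forall x x' y y' t, x != x' -> y != y' -> top_value e1 e2 e3 t ->
  size_e e1 + size_e e2 + 2 * (dg e3 x + dg e3 x' + dg (tr e3) y + dg (tr e3) y') + 2 * t + 2 * C
    <= 6 * n + 16).

Hypothesis hk : 102 <= k.
Hypothesis kn : 20 * (k * k) <= n.
Hypothesis kn' : n < 20 * (k.+1 * k.+1).
Hypothesis Ceq : C = 11 * (195 * 195) + 4.
Hypothesis hDD : size_e e1 + size_e e2 + 2 * C <= 6 * n.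
Hypothesis hh : #|H1| + #|H2| <= 120 * k + 119.
Hypothesis hG : forall y, 7 * (dg e2 y + T) <= 6 * n.
Hypothesis hd3 : forall x, 12 * dg e3 x + size_e e2 + 12 * T <= 12 * n.
Hypothesis hf : #|[set x | n < 8 * dg e3 x]| <= 35.
Hypothesis hc : forall x y, size_e e1 + 2 * dg e1 x + 4 * dg (tr e3) y + 4 * (260 * k) < 4 * n.
Hypothesis okP0 : ok P0.
Hypothesis cP0 : #|P0| <= 100.

(** The threshold separates two ways of getting unstuck. Below it, being stuck would force
    [n <= 2 * dg e2 y] up to O(k), which is impossible. Above it there are at most 15 vertices, and
    an exchange works. *)
Definition Big : {set V2} := [set y | 2 * n <= 5 * dg e2 y].
Definition bigA P : Prop := InvA P /\ forall p, p \in P -> p \notin P0 -> p.2 \in Big.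

Let k12 : 12 <= k. Proof. by move: hk; clear; lia. Qed.
Let n0 : 2040 * k <= n.
Proof. by move: hk kn; clear; nia. Qed.

Let le205 : 205 * k <= 260 * k. Proof. by rewrite leq_mul2r orbT. Qed.

Lemma Big_card : #|Big| <= 15.
Proof.
have := sum_inT Big (dg e2).
have h : forall x, x \in Big -> 2 * n <= 5 * dg e2 x by move=> x; rewrite inE.
have := sum_card_mul h; rewrite -big_distrr /=; move: hDD; rewrite /size_e.
move: (\sum_x dg e2 x) (\sum_x dg e1 x) (\sum_(x in Big) _) #|_| n0 hk Ceq; clear.
by move=> a b c d *; nia.
Qed.

Lemma Big_H2 : Big \subset H2.
Proof. by apply/subsetP => y; rewrite !inE; move: n0 hk; clear; lia. Qed.

Lemma bigA_card P : bigA P -> #|P :\: P0| <= 15.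
Proof.
move=> [[[okP sP] _ _ _] hB]; apply: leq_trans Big_card.
have okD : ok (P :\: P0) by apply: okp_sub okP; apply: subsetDl.
rewrite -(card_cod okD); apply/subset_leq_card/subsetP => y /imsetP[p].
by rewrite inE => /andP[npP pP] ->; apply: hB.
Qed.

Lemma bigA_step P y u : bigA P -> y \in Big -> InvA ((u, y) |: P) -> bigA ((u, y) |: P).
Proof.
move=> [_ hB] yB inv; split=> // p; rewrite in_setU1 => /predU1P[->//|]; exact: hB.
Qed.

Lemma bigA_Ovt P y : bigA P -> #|Ovt P y| <= 80.
Proof.
move=> bP; have [invP _] := bP; have := bigA_card bP.
have := Ovt_light s1 n1 n2 k12 (y := y) iso1 invP hf _; have := hG y.
move: #|Ovt P y| (dg e2 y) #|P :\: P0| n0 hk; clear => a b c d e f g h.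
by have := g _; lia.
Qed.

Lemma bigA_Hosts P y : bigA P -> n <= #|Hosts P y| + (dg (tr e3) y + 205 * k).
Proof.
move=> bP; have [invP _] := bP; have := bigA_card bP; have := bigA_Ovt y bP.
have := Hosts_count s1 n1 iso2 y invP; have := hostn_le e2 P0 P y; have := P_card invP.
move: #|Ovt P y| (hostn _ _ _ _) #|P| #|P0| cP0 #|P :\: P0| #|Hosts P y| (dg (tr e3) y) hh hk.
move: #|H1| #|H2|; clear; move=> *; nia.
Qed.

Lemma InvA_P0 : InvA P0.
Proof.
have noP0 x y : cf P0 x y -> e3 x y.
  by case/confP=> // -[p pP [e _]]; case/negP: (iso1 x pP).
split=> //; first by move=> p pP; rewrite pP.
- move=> x _.
  have : #|nb (cf P0) x :|: Bad| <= dg e3 x + #|Bad|.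
    apply: leq_trans (leq_card_setU _ _) _; rewrite leq_add2r.
    by apply: leq_dg => y; apply: noP0.
  by have := size_e_count e2 12; rewrite -/Bad; have := hd3 x; nlia.
- move=> x _ _; have : dg (cf P0) x <= dg e3 x by apply: leq_dg => y; apply: noP0.
  by have := hd3 x; nlia.
Qed.

Lemma bigA_P0 : bigA P0.
Proof. by split; [apply: InvA_P0 | move=> p pP; rewrite pP]. Qed.

Lemma other_vertex (y : V2) : exists y', y != y'.
Proof.
have : 1 < #|[set: V2]| by rewrite cardsT n2; move: n0 hk; clear; lia.
rewrite (cardsD1 y) inE ltnS => /card_gt0P[z]; rewrite !inE andbT => zy.
by exists z; rewrite eq_sym.
Qed.

(** Three saturated vertices carry a total load of about [3 * (n - beta y)], while [sum_loads] and
    the third stuck fact allow only about [2 * n - dg e2 y - beta y]. Together they give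
    [n <= dg e2 y] up to O(k), against [hG]. *)
Lemma third_Ov L P y x x' : H5 -> L <= 260 * k -> InvA P -> y \in H2 -> y \notin cod P ->
  n <= #|Hosts P y| + (dg (tr e3) y + L) ->
  x != x' -> x \in Ov P y -> x' \in Ov P y ->
  4 * #|Hosts P y| <= size_e e1 + 2 * #|[set u in Hosts P y | good u]| ->
  forall z, z \in Ov P y -> z = x \/ z = x'.
Proof.
move=> h5 hL invP yH yP cZ xx' xO xO' cnt z zO.
have xH : x \in H1 by move: xO; rewrite inE => /andP[].
have xH' : x' \in H1 by move: xO'; rewrite inE => /andP[].
have facts := stuck_facts s1 s2 n1 n2 k12 iso1 h5 invP yH yP cZ xx' xO xO' cnt.
have t2 y1 x1 : top_value e1 e2 e3 (dg e2 y1 + dg e3 x1) by exists x1, y1; left.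
have Gy := hG y.
have cBH : #|H2| <= #|Bad| by apply/subset_leq_card/H2_Bad.
have [y'0 y'0n] := other_vertex y.
have bb := beta_le e2 y.
have [ox ox'] := (Ov_bound s2 xO, Ov_bound s2 xO').
case: (eqVneq z x) => [|zx]; first by left.
case: (eqVneq z x') => [|zx']; first by right.
have zH : z \in H1 by move: zO; rewrite inE => /andP[].
have sA : [set z; x; x'] \subset H1.
  by apply/subsetP => w; rewrite !in_setU !in_set1 => /orP[/orP[]|] /eqP ->.
have := sum_loads s1 n1 n2 k12 iso1 invP sA yH yP.
rewrite setUC big_setU1 ?in_set2 ?negb_or 1?eq_sym ?zx' 1?eq_sym ?xx' //=.
rewrite big_setU1 ?inE //= big_set1 => sl.
have [_ _ f3 _ _] := facts y'0 (dg e2 y + dg e3 z) y'0n (t2 _ _).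
have [f1 _ _ _ _] := facts y'0 (dg e2 y + dg e3 z) y'0n (t2 _ _).
have oz := Ov_bound s2 zO.
have c1 w : #|Rl e1 e2 P w :\: nb e2 y| <= Sl e1 e2 P w.
  by apply: leq_trans (card_Rl e1 e2 P w); apply/subset_leq_card/subsetDl.
have tg := tangent 400 kn.
have bd : beta y <= dg e2 y by apply/subset_leq_card/subsetDl.
by exfalso; have := c1 x; have := c1 x'; have := c1 z; nlia.
Qed.

(* Moves a vertex [y'] hosted at a neighbour of [x'] to a neighbour of [x], after
   which only [x] can be overloaded by [y]. *)
Lemma bigA_exchange P y x x' : H5 -> bigA P -> y \in Big -> y \notin cod P ->
  x != x' -> x \in Ov P y -> x' \in Ov P y ->
  4 * #|Hosts P y| <= size_e e1 + 2 * #|[set u in Hosts P y | good u]| ->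
  [set u in Hosts P y | good u] \subset \bigcup_(z in Ov P y) nb e1 z ->
  exists P1, [/\ bigA P1, #|P1| = #|P|, y \notin cod P1 & Ov P1 y \subset [set x]].
Proof.
move=> h5 bP yB yP xx' xO xO' cnt sub.
have [invP hB] := bP; have [[okP sP0] hP b1 b2] := invP.
have yH : y \in H2 := subsetP Big_H2 y yB.
have cZ := bigA_Hosts y bP.
have xH : x \in H1 by move: xO; rewrite inE => /andP[].
have xH' : x' \in H1 by move: xO'; rewrite inE => /andP[].
have facts := stuck_facts s1 s2 n1 n2 k12 iso1 h5 invP yH yP cZ xx' xO xO' cnt.
have t2 y1 x1 : top_value e1 e2 e3 (dg e2 y1 + dg e3 x1) by exists x1, y1; left.
have t1 x1 y1 : top_value e1 e2 e3 (dg e1 x1 + dg (tr e3) y1) by exists x1, y1; right.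
have Gy := hG y.
have cBH : #|H2| <= #|Bad| by apply/subset_leq_card/H2_Bad.
have [y'0 y'0n] := other_vertex y.
have bb := beta_le e2 y.
have [ox ox'] := (Ov_bound s2 xO, Ov_bound s2 xO').
have third := third_Ov h5 (le205) invP yH yP cZ xx' xO xO' cnt.
have {}facts1 y' : y != y' -> forall x1, 
   dg (tr e3) y' + dg e3 x1 + 4 * #|Bad| + C < 985 * k + 6 * #|H2| + 8.
  by move=> yy' x1; have [f1 _ _ _ _] := facts y' (dg e2 y + dg e3 x1) yy' (t2 _ _); nlia.
have tg := tangent 400 kn.
have bd : beta y <= dg e2 y by apply/subset_leq_card/subsetDl.
have f1y0 := facts1 y'0 y'0n x'.
(* Without a host among its neighbours [x'] would carry no load and could not be overloaded. *)
have [p pP ep] : exists2 p, p \in P & e1 x' p.1.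
  case: (boolP [exists p in P, e1 x' p.1]) => [/existsP[p /andP[pP ep]]|no]; first by exists p.
  have S0 : Sl e1 e2 P x' = 0.
    rewrite /Sl big_pred0 // => q; apply/negbTE; apply: contra no => qP.
    by apply/existsP; exists q.
  have c0 : #|Rl e1 e2 P x' :\: nb e2 y| <= Sl e1 e2 P x'.
    by apply: leq_trans (card_Rl e1 e2 P x'); apply/subset_leq_card/subsetDl.
  by exfalso; nlia.
have npP : p \notin P0 by apply/negP => /(iso1 x'); rewrite ep.
have pB := hB p pP npP; have [_ gp] := hP p pP npP.
have yp : y != p.2 by apply: contraNneq yP => ->; apply: mem_cod.
pose P' := P :\ p.
have sP' : P' \subset P by apply: subsetDl.
have inv' : InvA P'.
  apply: (InvA_del s1 s2 n1 n2 k12 iso1 invP pP npP xH' ep) => y1.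
  have [f1 _ _ _ _] := facts p.2 (dg e2 y1 + dg e3 p.1) yp (t2 _ _).
  by nlia.
have bP' : bigA P' by split=> // q; rewrite in_setD1 => /andP[_]; apply: hB.
have bbp := beta_le e2 p.2.
have bp5 : 2 * n <= 5 * dg e2 p.2 by move: pB; rewrite inE.
have by5 : 2 * n <= 5 * dg e2 y by move: yB; rewrite inE.
have [_ F2 _ F4 F5] := facts p.2 (dg e2 y + dg e3 x) yp (t2 _ _).
have Slx z : #|Rl e1 e2 P z :&: nb e2 y| + #|Rl e1 e2 P z :\: nb e2 y| <= Sl e1 e2 P z.
  by rewrite cardsID card_Rl.
(* Apart from G3, everything forbidden at [x] after the move lies outside [nb e2 y :\: Bad] or in
   the overlap of [nb e2 y] with [Rl] of [x] or of [x']. Both overlaps are small, since the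
   saturated vertices spend almost all of their load outside [nb e2 y]. *)
have bx : #|nb (cf P') x :|: Bad :|: nb e2 p.2| + T <= n.
  have : nb (cf P') x :|: Bad :|: nb e2 p.2 \subset nb e3 x :|: ~: (nb e2 y :\: Bad)
     :|: (Rl e1 e2 P x :&: nb e2 y) :|: (Rl e1 e2 P x' :&: nb e2 y).
    apply/subsetP => w; rewrite in_setU => /orP[wx|wp].
      have : w \in nb (cf P) x :|: Bad.
        by apply: subsetP wx; apply/setSU/subsetP => v; rewrite !inE; apply: conf_sub.
      move/(subsetP (nb_cf_sub e1 e3 s2 P x)); rewrite !in_setU in_setC !in_setI in_setD.
      by do !case: (w \in _).
    have : (w \in Bad) || (w \in Rl e1 e2 P x').
      case: (boolP (w \in Bad)) => //= wB; rewrite in_setD wB.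
      by apply/bigcupP; exists p; rewrite ?pP.
    by rewrite !in_setU in_setC !in_setI in_setD; do !case: (w \in _).
  move/subset_leq_card => le; have := Slx x; have := Slx x'.
  have : #|nb e3 x :|: ~: (nb e2 y :\: Bad) :|: (Rl e1 e2 P x :&: nb e2 y)
      :|: (Rl e1 e2 P x' :&: nb e2 y)| <=
    dg e3 x + (n - beta y) + #|Rl e1 e2 P x :&: nb e2 y| + #|Rl e1 e2 P x' :&: nb e2 y|.
    apply: leq_trans (leq_card_setU _ _) _; rewrite leq_add2r.
    apply: leq_trans (leq_card_setU _ _) _; rewrite leq_add2r.
    apply: leq_trans (leq_card_setU _ _) _; rewrite leq_add2l.
    by rewrite cardsCs setCK n2.
  have bn : beta y <= n by rewrite -n2 max_card.
  have f1 := facts1 p.2 yp x.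
  by nlia.
have [f1x' _ _ _ _] := facts p.2 (dg e1 x' + dg (tr e3) y) yp (t1 _ _).
have f1p := facts1 p.2 yp x.
have cO := bigA_Ovt p.2 bP'.
have h15 := bigA_card bP'.
have dh := dg_host s1 iso2 p.2 inv'; have dh' := hostn_le e2 P0 P' p.2.
(* A good host of [y] that also admits [p.2] and is not adjacent to [x']. Every good host has a
   neighbour in [Ov P y], so this one is adjacent to [x]. *)
have [u uZ uN] : exists2 u, u \in [set u in Hosts P y | good u] & 
    u \notin nb e1 x' :|: nb (tr (cf P')) p.2 :|: \bigcup_(z in Ovt P' p.2) nb e1 z.
  apply: set_exists_of_card.
  apply: leq_ltn_trans (leq_card_setU _ _) _.
  apply: leq_ltn_trans (leq_add (leq_card_setU _ _) (leq_card_bigcup _ _)) _.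
  have lO : \sum_(z in Ovt P' p.2) #|nb e1 z| <= k * 80.
    apply: leq_trans (_ : k * #|Ovt P' p.2| <= _); last by rewrite leq_mul2l cO orbT.
    rewrite [leqRHS]mulnC -sum_nat_const; apply: leq_sum => z; rewrite inE => /and3P[+ _ _].
    by rewrite inE -leqNgt.
  rewrite -/(dg e1 x') -/(dg (tr (cf P')) p.2).
  by have := tangent 500 kn; nlia.
move: uN; rewrite !in_setU !negb_or !inE -andbA => /and3P[ux' ucf uO].
have /bigcupP[z zO uz] := subsetP sub u uZ.
have exu : e1 x u.
  case: (third z zO) uz => ->; rewrite inE //.
  by rewrite (negbTE ux').
move: (uZ); rewrite inE => /andP[uHo gu].
have xo w : w \in H1 -> e1 w u -> w = x.
  by move=> wH ew; apply: (good_H1_eq s1 n1 n2 k12 gu wH xH ew exu).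
have uP : u \notin dom P by move: uHo; rewrite inE => /and4P[].
have uP' : u \notin dom P' by apply: contra uP => /(subsetP (imsetS _ sP')).
have pP' : p.2 \notin cod P'.
  apply/imsetP => -[q]; rewrite !inE => /andP[qp qP] E.
  have [inj _ _] := okP; have := inj _ _ pP qP; rewrite E eqxx => /eqP E1.
  by case/negP: qp; apply/eqP; rewrite (surjective_pairing p) E E1 -surjective_pairing.
pose P1 := (u, p.2) |: P'.
have inv1 : InvA P1.
  apply: InvA_step => //.
  - exact: (subsetP Big_H2).
  - by move=> w wH /(xo w wH) ->.
  - move=> w wH wP ew; rewrite leqNgt; apply/negP => lt.
    case/negP: uO; apply/bigcupP; exists w; last by rewrite inE.
    by rewrite inE wH wP.
have bP1 : bigA P1 by apply: bigA_step.
exists P1; split=> //.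
- have [[ok1 _] _ _ _] := inv1.
  rewrite /P1 cardsU1 (contra (@mem_dom _ _ _ (u, p.2)) uP') /P'.
  by rewrite [in RHS](cardsD1 p) pP.
- rewrite /P1 /cod imsetU1 in_setU1 /= negb_or yp.
  by apply: contra yP => /(subsetP (imsetS _ sP')).
apply/subsetP => w; rewrite [w \in Ov _ _]inE => /andP[wH lt]; rewrite in_set1; apply: contraTT lt => wx.
rewrite -leqNgt.
have nwu : ~~ e1 w u by apply: contra wx => /(xo w wH) ->.
have -> : nb (cf P1) w = nb (cf P') w by rewrite nb_conf_ext // (negbTE nwu) setU0.
rewrite leqNgt; apply/negP => lt.
have wO : w \in Ov P y.
  rewrite inE wH; apply: leq_trans lt _; rewrite leq_add2r.
  apply/subset_leq_card/setSU/setSU/subsetP => v; rewrite !inE; exact: conf_sub.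
(* What remains is [x'], and it has lost the load [beta p.2], too much to stay overloaded. *)
case: (third w wO) => wE; first by rewrite wE eqxx in wx.
have wO' : w \in Ov P' y by rewrite inE wH.
move: (Ov_bound s2 wO'); rewrite wE.
have : Sl e1 e2 P x' = beta p.2 + Sl e1 e2 P' x'.
  rewrite /Sl (bigD1 p) /=; last by rewrite pP.
  by congr (_ + _); apply: eq_bigl => q; rewrite !inE; case: (q == p); rewrite ?andbF ?andbT.
have : #|Rl e1 e2 P' x' :\: nb e2 y| <= Sl e1 e2 P' x'.
  by apply: leq_trans (card_Rl e1 e2 P' x'); apply/subset_leq_card/subsetDl.
by nlia.
Qed.

Definition load P x : nat := \sum_(p in P :\: P0 | e1 x p.1) dg e2 p.2.

Lemma dg_load P x : dg (cf P) x <= dg e3 x + load P x.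
Proof.
apply: leq_trans (dg_conf _ _ _ _ s2) _; rewrite leq_add2l /load.
rewrite (bigID (mem P0)) /= big1 ?add0n; last first.
  by move=> p /andP[/andP[_ e]] pP0; move: (iso1 x pP0); rewrite e.
by apply/eq_leq/eq_bigl => p; rewrite !inE; case: (p \in P0); rewrite ?andbT ?andbF.
Qed.

(** Each hosted vertex is charged to the at most 3 neighbours of its host. *)
Lemma sum_load P : InvA P -> \sum_x load P x <= 3 * size_e e2.
Proof.
move=> [[okP _] hP _ _]; rewrite /load.
have okD : ok (P :\: P0) by apply: okp_sub okP; apply: subsetDl.
under eq_bigr do rewrite big_mkcondr /=.
rewrite exchange_big /=.
apply: leq_trans (_ : \sum_(p in P :\: P0) 3 * dg e2 p.2 <= _).
  apply: leq_sum => p; rewrite inE => /andP[npP pP].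
  have [_ /good_dg gd] := hP p pP npP.
  rewrite -big_mkcond /= sum_nat_const leq_mul2r; apply/orP; right.
  apply: leq_trans gd; apply/subset_leq_card/subsetP => x; rewrite !inE s1 => e.
  by [].
rewrite -big_distrr leq_mul2l /=; apply: leq_trans (sum_inT (cod (P :\: P0)) _).
rewrite /cod big_imset //= => p q pP qP E.
have [inj _ _] := okD; have := inj _ _ pP qP; rewrite E eqxx => /eqP E1.
by rewrite (surjective_pairing p) E1 E -surjective_pairing.
Qed.

(** After deducting n/8 for G3, 2n/5 for [y] and the room [T], an overloaded light vertex still
    carries load 28n/100. The total load is at most [3 * size_e e2], below 18n, so there are at most
    64 of these; 35 + 64 = 99. *)
Lemma Ovt_dust P y : InvA P -> 5 * dg e2 y < 2 * n -> #|Ovt P y| <= 99.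
Proof.
move=> invP hy.
have : #|Ovt P y| <= #|[set x | n < 8 * dg e3 x]| + #|[set x | 28 * n <= 100 * load P x]|.
  apply: leq_trans (leq_card_setU _ _); apply/subset_leq_card/subsetP => x.
  rewrite inE => /and3P[_ _ lt]; rewrite in_setU !inE; case: ltnP => //= le8.
  have := dg_load P x; have : #|nb (cf P) x :|: nb e2 y| <= dg (cf P) x + dg e2 y.
    by apply: leq_card_setU.
  by move: lt n0 hk hy le8; clear; nlia.
have : 28 * n * #|[set x | 28 * n <= 100 * load P x]| <= 100 * (3 * size_e e2).
  apply: leq_trans (_ : \sum_(x in [set x | 28 * n <= 100 * load P x]) 100 * load P x <= _).
    by apply: sum_card_mul => x; rewrite inE.
  rewrite -big_distrr leq_mul2l /=; apply: leq_trans (sum_load invP).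
  exact: sum_inT.
move: hf hDD n0 hk; move: #|Ovt P y| #|_| #|_| (size_e e1) (size_e e2) Ceq; clear => a b c d e.
by move=> *; nia.
Qed.

(** Either alternative excludes the stuck situation in the order (V1, V2). The first, a sparse G1,
    is the one verified for residual triples; the second comes directly from the bound on F. *)
Definition oneway := (forall y, size_e e1 + 2 * dg (tr e3) y + 2 * (260 * k) < 2 * n) \/ H5.

Lemma oneway_not_stuck L P y : (forall y, size_e e1 + 2 * dg (tr e3) y + 2 * (260 * k) < 2 * n) ->
  L <= 260 * k -> n <= #|Hosts P y| + (dg (tr e3) y + L) ->
  4 * #|Hosts P y| <= size_e e1 + 2 * #|[set u in Hosts P y | good u]| -> False.
Proof.
move=> e0 hL cZ cnt; have := e0 y.
have g : #|[set u in Hosts P y | good u]| <= #|Hosts P y|.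
  by apply/subset_leq_card/subsetP => u; rewrite inE => /andP[].
by nlia.
Qed.

Lemma hc_le L : L <= 260 * k -> forall y x, size_e e1 + 2 * dg e1 x + 4 * dg (tr e3) y + 4 * L < 4 * n.
Proof. by move=> hL y x; have := hc x y; nlia. Qed.

(** A maximal placement of [Big] vertices is complete: a stuck [y] is released by one exchange,
    after which at most one vertex is overloaded, whereas being stuck requires two. *)
Lemma phaseA1 : oneway -> exists2 P, bigA P & Big \subset cod P.
Proof.
move=> ow; have [P bP maxP] := @ex_max_card _ bigA P0 bigA_P0.
exists P => //; apply/subsetP => y yB; apply/negPn/negP => yP.
have extend Q u : bigA Q -> y \notin cod Q -> #|Q| = #|P| -> InvA ((u, y) |: Q) -> False.
  move=> bQ yQ cQ inv; have := maxP _ (bigA_step bQ yB inv).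
  by rewrite cardsU1 (contra (@mem_cod _ _ _ (u, y)) yQ) cQ ltnn.
have yH : y \in H2 := subsetP Big_H2 y yB.
have [invP _] := bP; have cZ := bigA_Hosts y bP.
have [[u _ inv]|[x [x' [xx' xO xO' cnt sub]]]] :=
    host_or_stuck s1 i1 s2 n1 n2 k12 invP yH yP cZ (hc_le le205 y).
  exact: extend inv.
case: ow => [e0|h5]; first exact: oneway_not_stuck e0 le205 cZ cnt.
have [P1 [bP1 cP1 yP1 sO]] := bigA_exchange h5 bP yB yP xx' xO xO' cnt sub.
have [invP1 _] := bP1.
have [[u _ inv]|[z [z' [zz' zO zO' _ _]]]] :=
    host_or_stuck s1 i1 s2 n1 n2 k12 invP1 yH yP1 (bigA_Hosts y bP1) (hc_le le205 y).
  exact: extend inv.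
move: zz'; have := subsetP sO _ zO; have := subsetP sO _ zO'.
by rewrite !inE => /eqP -> /eqP ->; rewrite eqxx.
Qed.

(** The vertex hosted last has the fewest neighbours inside [S]. In this order only O(k) neighbours
    of a vertex precede it, so its conflicts from good hosts stay of order [k]. *)
Lemma phaseA2 m (S : {set V2}) : oneway -> #|S| <= m -> S \subset H2 ->
  exists P, [/\ InvA P, Big :|: S \subset cod P & forall p, p \in P -> p \notin P0 -> p.2 \in Big :|: S].
Proof.
move=> ow; elim: m S => [|m IHm] S.
  rewrite leqn0 cards_eq0 => /eqP -> _; have [P [invP hB] sB] := phaseA1 ow.
  by exists P; rewrite setU0.
have [->|[y0 y0S]] := set_0Vmem S; first by move=> _; apply: IHm; rewrite cards0.
move=> leS sS; pose f y := #|nb e2 y :&: S|.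
case: (arg_minnP f y0S) => y yS miny; rewrite /f in miny.
have {}yS : y \in S := yS.
have cS : #|S| = #|S :\ y|.+1 by rewrite (cardsD1 y) yS.
have sS' : S :\ y \subset H2 by apply: subset_trans sS; apply: subsetDl.
have [|P [invP sP hP]] := IHm (S :\ y) _ sS'; first by rewrite -ltnS -cS.
have SE : S = y |: (S :\ y) by rewrite setD1K.
have sU : Big :|: (S :\ y) \subset Big :|: S by apply/setUS/subsetDl.
have [yP|yP] := boolP (y \in cod P).
  exists P; split=> //.
    by rewrite SE setUCA subUset sub1set yP.
  by move=> p pP npP; apply: (subsetP sU); apply: hP.
have yH : y \in H2 := subsetP sS y yS.
have yB : y \notin Big by apply: contra yP => yB; apply: (subsetP sP); rewrite inE yB.
have ylt : 5 * dg e2 y < 2 * n by move: yB; rewrite inE -ltnNge.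
(* A minimum inner degree of [11 * k + 11] would give a degree sum of at least
   [121 * (k.+1 * k.+1)], more than [6 * n]. *)
have mu : #|nb e2 y :&: S| <= 11 * k + 10.
  have : #|nb e2 y :&: S| * #|S| <= size_e e2.
    apply: leq_trans (sum_inT S _); apply: sum_card_mul => z zS.
    by apply: leq_trans (miny z zS) _; apply/subset_leq_card/subsetIl.
  have : #|nb e2 y :&: S| < #|S|.
    rewrite cS ltnS; apply/subset_leq_card/subsetP => z; rewrite !inE => /andP[e ->].
    by rewrite andbT; apply: contraTneq e => ->; rewrite i2.
  move: kn' hDD hk; move: #|_ :&: _| #|S| (size_e e1) (size_e e2) => a b c d; clear => h1 h2 h3 h4 h5.
  rewrite leqNgt; apply/negP => h6.
  have : (11 * k + 11) * (11 * k + 11) <= a * b by apply: leq_mul; lia.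
  by nia.
have hn : hostn e2 P0 P y <= 11 * k + 25.
  have [[okP _] _ _ _] := invP.
  have okQ : ok [set p in P :\: P0 | e2 y p.2].
    by apply: okp_sub okP; apply/subsetP => p; rewrite !inE => /andP[/andP[_ ->]].
  rewrite /hostn -(card_cod okQ).
  apply: leq_trans (_ : #|Big :|: (nb e2 y :&: S)| <= _).
    apply/subset_leq_card/subsetP => w /imsetP[p]; rewrite inE => /andP[+ e] ->.
    rewrite in_setD => /andP[npP pP]; have := hP p pP npP.
    by rewrite !in_setU in_setI in_setD1 => /orP[->//|/andP[_ ->]]; rewrite [p.2 \in nb _ _]inE e orbT.
  by apply: leq_trans (leq_card_setU _ _) _; have := Big_card; nlia.
have cPD : #|P :\: P0| <= #|H2|.
  have [[okP _] hPP _ _] := invP.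
  have okQ : ok (P :\: P0) by apply: okp_sub okP; apply: subsetDl.
  rewrite -(card_cod okQ); apply/subset_leq_card/subsetP => w /imsetP[p].
  by rewrite inE => /andP[npP pP] ->; have [] := hPP p pP npP.
have cZ : n <= #|Hosts P y| + (dg (tr e3) y + 260 * k).
  have := Hosts_count s1 n1 iso2 y invP; have := P_card invP; have := Ovt_dust invP ylt.
  move: hn cPD; move: #|Ovt P y| (hostn _ _ _ _) #|P| #|P0| cP0 #|P :\: P0| #|Hosts P y| (dg (tr e3) y) hh hk.
  by move: #|H1| #|H2|; clear; move=> *; nia.
have done u : InvA ((u, y) |: P) ->
  exists P, [/\ InvA P, Big :|: S \subset cod P & forall p, p \in P -> p \notin P0 -> p.2 \in Big :|: S].
  move=> inv; exists ((u, y) |: P); split=> //.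
    by rewrite SE setUCA /cod imsetU1 setUS.
  move=> p; rewrite in_setU1 => /predU1P[-> _|pP npP]; first by rewrite inE yS orbT.
  by apply: (subsetP sU); apply: hP.
have [[u _ inv]|[x [x' [xx' xO xO' cnt sub]]]] :=
    host_or_stuck s1 i1 s2 n1 n2 k12 invP yH yP cZ (hc_le (leqnn _) y).
  exact: done inv.
exfalso; case: ow => [e0|h5]; first exact: oneway_not_stuck e0 (leqnn _) cZ cnt.
have third := third_Ov h5 (leqnn _) invP yH yP cZ xx' xO xO' cnt.
have facts := stuck_facts s1 s2 n1 n2 k12 iso1 h5 invP yH yP cZ xx' xO xO' cnt.
have [y'0 y'0n] := other_vertex y.
have [_ F2 _ _ _] := facts y'0 (dg e2 y + dg e3 x) y'0n (ex_intro _ x (ex_intro _ y (or_introl erefl))).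
have [F1 _ _ _ _] := facts y'0 (dg e1 x + dg (tr e3) y) y'0n (ex_intro _ x (ex_intro _ y (or_intror erefl))).
have [F1' _ _ _ _] := facts y'0 (dg e1 x' + dg (tr e3) y) y'0n (ex_intro _ x' (ex_intro _ y (or_intror erefl))).
have cBH : #|H2| <= #|Bad| by apply/subset_leq_card/H2_Bad.
(* The facts now give [n <= dg e1 x + dg e1 x' + dg (tr e3) y <= 2 * dg e2 y] up to O(k), but [y] is
   below the threshold of [Big]. *)
have : #|[set u in Hosts P y | good u]| <= dg e1 x + dg e1 x'.
  apply: leq_trans (leq_card_setU (nb e1 x) (nb e1 x')); apply/subset_leq_card/subsetP => u uZ.
  have /bigcupP[z zO uz] := subsetP sub u uZ; rewrite in_setU.
  by case: (third z zO) uz => -> ->; rewrite ?orbT.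
by have := tangent 530 kn; nlia.
Qed.

Lemma phaseA : oneway -> exists2 P, InvA P & H2 \subset cod P.
Proof.
move=> ow; have [P [invP sP _]] := phaseA2 ow (leqnn #|H2|) (subxx _).
by exists P => //; apply: subset_trans sP; apply: subsetUr.
Qed.

End PhaseA.

(** Here [m] is the number of vertices of large conflict degree. The bound [m <= 365], which ignores
    C, suffices for [k >= 390]. For smaller [k] the constant C lowers the degree sums noticeably,
    and the range is cut into intervals with a separate bound on [m] in each. *)
Lemma heavy_numeric (n k m D1 D2 : nat) : 102 <= k -> 20 * (k * k) <= n -> n < 20 * (k.+1 * k.+1) ->
  D1 + D2 + 2 * (11 * (195 * 195) + 4) <= 6 * n -> D1 <= 4 * n ->
  169 * (n * m) <= 169 * (n * 70) + 1000 * (3 * D2 + 11 * D1) ->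
  10 * ((121 + 2 * m) * k + 219 + m) < 3 * n.
Proof.
move=> hk kn nk hD hD1 hm.
have split a M : a <= k -> m <= M -> (121 + 2 * M) * a + 219 + M < 6 * (a * a) ->
    10 * ((121 + 2 * m) * k + 219 + m) < 3 * n.
  move=> ak mM aM.
  suff: (121 + 2 * M) * k + 219 + M < 6 * (k * k).
    have : (121 + 2 * m) * k <= (121 + 2 * M) * k by rewrite leq_mul2r; lia.
    by nlia.
  rewrite -(subnK ak); move: (k - a) aM; clear => d aM.
  have e : 121 + 2 * M <= 6 * a.
    rewrite leqNgt; apply/negP => lt.
    have : a * (6 * a) <= a * (121 + 2 * M) by rewrite leq_mul2l (ltnW lt) orbT.
    by nlia.
  have : (121 + 2 * M) * d <= 6 * a * d by rewrite leq_mul2r e orbT.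
  by nlia.
have bound M : 1000 * (3 * D2 + 11 * D1) < 169 * (n * (M - 69)) -> 70 <= M -> m <= M.
  move=> h M70; rewrite leqNgt; apply/negP => lt.
  have : n * M.+1 <= n * m by rewrite leq_mul2l lt orbT.
  have : n * (M - 69) + n * 69 = n * M by rewrite -mulnDr subnK // (leq_trans _ M70).
  by rewrite mulnS; nlia.
have iv a b M : a <= k -> k < b -> 70 <= M ->
    (11 * (6 * (20 * (b * b)) - 2 * (11 * (195 * 195) + 4))) * 1000 < 169 * ((20 * (b * b)) * (M - 69)) ->
    (121 + 2 * M) * a + 219 + M < 6 * (a * a) -> 10 * ((121 + 2 * m) * k + 219 + m) < 3 * n.
  move=> ak kb M70 hM; apply: split ak _; apply: bound M70.
  have nb : n <= 20 * (b * b).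
    apply: leq_trans (ltnW nk) _; rewrite leq_mul2l /=; exact: leq_mul.
  move: (20 * (b * b)) hM nb => B hM nb; move: (M - 69) hM => M' hM.
  have [h|h] := leqP (66 * 1000) (169 * M').
    have : (66 * 1000) * n <= 169 * M' * n by rewrite leq_mul2r h orbT.
    by nlia.
  have : ((66 * 1000) - 169 * M') * n <= ((66 * 1000) - 169 * M') * B by rewrite leq_mul2l nb orbT.
  by rewrite !mulnBl; nlia.
have [h|h1] := ltnP k 112; first by apply: (iv 102 112 243); nlia.
have [h|h2] := ltnP k 120; first by apply: (iv 112 120 271); nlia.
have [h|h3] := ltnP k 129; first by apply: (iv 120 129 296); nlia.
have [h|h4] := ltnP k 141; first by apply: (iv 129 141 323); nlia.
have [h|h5] := ltnP k 390.
  apply: (split 141 360); [nlia | apply: bound | nlia]; last by nlia.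
  have : k.+1 * k.+1 <= 390 * 390 by apply: leq_mul.
  by have -> : 360 - 69 = 291 by []; nlia.
apply: (split 390 365); [nlia | apply: bound | nlia]; last by nlia.
by have -> : 365 - 69 = 296 by []; nlia.
Qed.

Lemma stage_numeric n k m c1 c2 p p1 f f1 :
  10 * ((121 + 2 * m) * k + 219 + m) < 3 * n -> c1 + c2 <= m -> p <= 120 * k + 219 ->
  p1 <= p + c1 -> 10 * f <= 7 * n -> f1 <= f + c1 * k -> f1 + p1 + c2 * k.+1 <= n.
Proof.
move=> hm hc; have : c1 * k + c2 * k <= m * k by rewrite -mulnDl leq_mul2r hc orbT.
by move: hm; rewrite mulnDl -[2 * m * k]mulnA mulnS; nlia.
Qed.

Lemma final_numeric n k m c1 c2 f f1 f2 :
  c1 + c2 <= m -> 10 * f <= 3 * n -> f1 <= f + c1 * k -> f2 <= f1 + c2 * k ->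
  f2 <= (3 * n) %/ 10 + m * k.
Proof.
move=> hc; have : c1 * k + c2 * k <= m * k by rewrite -mulnDl leq_mul2r hc orbT.
move=> mk h h1 h2; have : f <= (3 * n) %/ 10 by rewrite leq_divRL // mulnC.
by nlia.
Qed.

(** * Hosting the heavy vertices of G1 *)

Section PhaseB.
Variables (V1 V2 : finType) (e1 : rel V1) (e2 : rel V2) (e3 : V1 -> V2 -> bool).
Hypotheses (s1 : symmetric e1) (i1 : irreflexive e1) (s2 : symmetric e2) (i2 : irreflexive e2).
Variables (n k : nat) (P0 : {set V1 * V2}).
Hypotheses (n1 : #|V1| = n) (n2 : #|V2| = n).
Hypothesis iso1 : forall p x, p \in P0 -> ~~ e1 x p.1.
Hypothesis iso2 : forall p y, p \in P0 -> ~~ e2 y p.2.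
Implicit Types P : {set V1 * V2}.
Local Notation ok := (okp e1 e2 e3).
Local Notation cf := (conf e1 e2 e3).
Local Notation T := (390 * k).
Local Notation H1 := (H1 e1 k).
Local Notation H2 := (H2 e2 k).
Local Notation Bad := (Bad e2).
Local Notation InvA := (InvA e1 e2 e3 n k T P0).

Hypothesis hk : 102 <= k.
Hypothesis kn : 20 * (k * k) <= n.
Hypothesis kn' : n < 20 * (k.+1 * k.+1).
Hypothesis hDD : size_e e1 + size_e e2 + 2 * (11 * (195 * 195) + 4) <= 6 * n.
Hypothesis hD1 : size_e e1 < 4 * n.
Hypothesis hh : #|H1| + #|H2| <= 120 * k + 119.
Hypothesis hG : forall x, 7 * (dg e1 x + T) <= 6 * n.
Hypothesis hd3 : forall y, dg (tr e3) y + 3 * k + T <= n.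
Hypothesis hf1 : #|[set x | n < 8 * dg e3 x]| <= 35.
Hypothesis hf2 : #|[set y | n < 8 * dg (tr e3) y]| <= 35.
Hypothesis cP0 : #|P0| <= 100.
Variable PA : {set V1 * V2}.
Hypothesis invA : InvA PA.
Hypothesis covA : H2 \subset cod PA.

Let n0 : 2040 * k <= n.
Proof. by move: hk kn; clear; nia. Qed.
Let okA : ok PA. Proof. by case: invA => -[]. Qed.

Definition InvB P : Prop :=
  [/\ ok P /\ PA \subset P,
      forall p, p \in P -> p \notin PA -> p.1 \in H1 /\ p.2 \notin Bad &
      forall y, y \notin cod P -> dg (tr (cf P)) y + T <= n].

Lemma small_outside P y : PA \subset P -> y \notin cod P -> dg e2 y <= k.
Proof.
move=> sP yP; rewrite leqNgt; apply/negP => lt; case/negP: yP.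
by apply: (subsetP (imsetS _ sP)); apply: (subsetP covA); rewrite inE.
Qed.

Lemma dg_A y : dg e2 y <= k -> dg (tr (cf PA)) y <= dg (tr e3) y + 3 * k.
Proof.
move=> yk; apply: leq_trans (dg_host s1 iso2 y invA) _; rewrite leq_add2l leq_mul2l /=.
apply: leq_trans yk.
rewrite /hostn -(card_sw [set p in _ | _]).
have okD : ok (PA :\: P0) by apply: okp_sub okA; apply: subsetDl.
apply: leq_trans (card_pairs_nb (nb e2 y) (okp_sw okD)).
by apply/subset_leq_card/subsetP => p; rewrite !inE.
Qed.

Lemma InvB_PA : InvB PA.
Proof.
split=> //; first by move=> p pP; rewrite pP.
by move=> y /(small_outside (subxx _))/dg_A; have := hd3 y; nlia.
Qed.

(** The unplaced vertices that would be overloaded if [x] were hosted at one of their neighbours. *)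
Definition Yt P x : {set V2} := [set y | (y \notin cod P) && (n < dg (tr (cf P)) y + dg e1 x + T)].

Lemma cardPB P : InvB P -> #|P| <= 120 * k + 219.
Proof.
move=> [[okP sP] hP _].
have okD : ok (P :\: PA) by apply: okp_sub okP; apply: subsetDl.
have c1 : #|P :\: PA| <= #|H1|.
  rewrite -(card_dom okD); apply/subset_leq_card/subsetP => x /imsetP[p].
  by rewrite inE => /andP[npP pP] ->; have [] := hP p pP npP.
have [[_ sA] hA _ _] := invA.
have okE : ok (PA :\: P0) by apply: okp_sub okA; apply: subsetDl.
have c2 : #|PA :\: P0| <= #|H2|.
  rewrite -(card_cod okE); apply/subset_leq_card/subsetP => y /imsetP[p].
  by rewrite inE => /andP[npP pP] ->; have [] := hA p pP npP.
have := P_card invA; have : #|P| = #|PA| + #|P :\: PA|.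
  by rewrite cardsD (setIidPr sP) subnKC // subset_leq_card.
by move: c1 c2; nlia.
Qed.

(** A host outside [Bad] has degree at most 11, so each neighbour of [x] placed in this phase costs
    [x] only 11 conflicts. The neighbourhoods of the vertices of [Yt P x] are avoided as well, at
    most [k] vertices for each. *)
Lemma InvB_step P x a b : InvB P -> x \in H1 -> x \notin dom P ->
  #|[set p in P :\: PA | e1 x p.1]| <= a -> #|Yt P x| <= b ->
  11 * a + 120 * k + 219 + k * b < T -> exists w, InvB ((x, w) |: P).
Proof.
move=> invB xH xP ca cb lt; have [[okP sP] hP hy] := invB.
have [_ _ bA _] := invA.
have lF : #|nb (cf P) x :|: Bad| <= #|nb (cf PA) x :|: Bad| + 11 * a.
  have -> : nb (cf P) x :|: Bad = nb (cf PA) x :|: Bad :|: \bigcup_(p in P :\: PA | e1 x p.1) nb e2 p.2.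
    rewrite !nb_conf //; apply/setP => y; rewrite !in_setU.
    case: (y \in nb e3 x); rewrite ?orbT //=.
    case: (y \in Bad); rewrite ?orbT ?orbF //=.
    apply/bigcupP/orP => [[p /andP[pP e] yp]|[]/bigcupP[p /andP[pP e] yp]].
    - have [pA|pA] := boolP (p \in PA); [left|right]; apply/bigcupP; exists p => //.
        by rewrite pA.
      by rewrite inE pA pP.
    - by exists p => //; rewrite (subsetP sP) .
    - by exists p => //; rewrite e andbT; move: pP; rewrite inE => /andP[].
  apply: leq_trans (leq_card_setU _ _) _; rewrite leq_add2l.
  apply: leq_trans (leq_card_bigcup _ _) _.
  apply: leq_trans (_ : \sum_(p in [set p in P :\: PA | e1 x p.1]) 11 <= _).
    rewrite big_mkcond [leqRHS]big_mkcond /=; apply: leq_sum => p _.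
    have -> : (p \in [set p0 in P :\: PA | e1 x p0.1]) = (p \in P :\: PA) && e1 x p.1 by rewrite inE.
    case: (boolP (p \in P :\: PA)) => //=; case: (e1 x p.1) => //=.
    rewrite in_setD => /andP[npA pP].
    by have [_] := hP p pP npA; rewrite inE -ltnNge.
  by rewrite sum_nat_const mulnC leq_mul2l.
have lY : \sum_(y in Yt P x) #|nb e2 y| <= k * b.
  apply: leq_trans (_ : k * #|Yt P x| <= _); last by rewrite leq_mul2l cb orbT.
  rewrite [leqRHS]mulnC -sum_nat_const; apply: leq_sum => z; rewrite inE => /andP[zP _].
  exact: small_outside sP zP.
have [w _ wN] : exists2 w, w \in [set: V2] &
    w \notin nb (cf P) x :|: Bad :|: cod P :|: \bigcup_(y in Yt P x) nb e2 y.
  apply: set_exists_of_card; rewrite cardsT n2.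
  apply: leq_ltn_trans (leq_card_setU _ _) _.
  apply: leq_ltn_trans (leq_add (leq_card_setU _ _) (leq_card_bigcup _ _)) _.
  rewrite (card_cod okP).
  by have := bA x xH; have := cardPB invB; nlia.
move: wN; rewrite !in_setU !negb_or -!andbA => /and4P[wF wB wP wY].
exists w; split.
- split; last by apply: subset_trans sP (subsetUr _ _).
  by apply: okp_ext => //; move: wF; rewrite inE.
- by move=> p; rewrite in_setU1 => /predU1P[->|pP] //; apply: hP.
move=> y; rewrite /cod imsetU1 in_setU1 negb_or => /andP[_ yP].
apply: leq_trans (_ : dg (tr (cf P)) y + (if e2 y w then dg e1 x else 0) + T <= _).
  rewrite leq_add2r -!dg_conf_sw sw_setU1; exact: dg_conf_ext.
case: (boolP (e2 y w)) => e; last by rewrite addn0; apply: hy.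
rewrite leqNgt; apply/negP => lty; case/negP: wY; apply/bigcupP; exists y.
  by rewrite inE yP.
by rewrite inE.
Qed.

Definition loadB P y : nat := \sum_(p in P :\: PA | e2 y p.2) dg e1 p.1.

Lemma dg_loadB P y : InvB P -> y \notin cod P -> dg (tr (cf P)) y <= dg (tr e3) y + 3 * k + loadB P y.
Proof.
move=> [[okP sP] hP _] yP; rewrite -dg_conf_sw.
apply: leq_trans (dg_conf_grow _ _ s1 _ (sub_sw sP)) _.
rewrite dg_conf_sw; apply: leq_add; first by apply/dg_A/(small_outside sP).
rewrite (reindex (fun p : V1 * V2 => (p.2, p.1))) /=; last first.
  by exists (fun p => (p.2, p.1)) => -[].
by apply/eq_leq/eq_bigl => -[a b]; rewrite !inE.
Qed.

Lemma sum_loadB P : InvB P -> \sum_y loadB P y <= 11 * size_e e1.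
Proof.
move=> [[okP _] hP _]; rewrite /loadB.
have okD : ok (P :\: PA) by apply: okp_sub okP; apply: subsetDl.
under eq_bigr do rewrite big_mkcondr /=.
rewrite exchange_big /=.
apply: leq_trans (_ : \sum_(p in P :\: PA) 11 * dg e1 p.1 <= _).
  apply: leq_sum => p; rewrite inE => /andP[npP pP].
  have [_] := hP p pP npP; rewrite inE -ltnNge ltnS => gd.
  rewrite -big_mkcond /= sum_nat_const leq_mul2r; apply/orP; right.
  by apply: leq_trans gd; apply/subset_leq_card/subsetP => x; rewrite !inE s2.
rewrite -big_distrr leq_mul2l /=; apply: leq_trans (sum_inT (dom (P :\: PA)) _).
rewrite /dom big_imset //= => p q pP qP E.
have [inj _ _] := okD; have := inj _ _ pP qP; rewrite E eqxx => /esym/eqP E1.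
by rewrite (surjective_pairing p) E1 E -surjective_pairing.
Qed.

(** The counterpart of [Big] for G1, at most 13 vertices since [size_e e1 < 4 * n]. *)
Definition S1 : {set V1} := [set x in H1 | 3 * n <= 10 * dg e1 x].

Lemma card_S1 : #|S1| <= 13.
Proof.
have h : forall x, x \in S1 -> 3 * n <= 10 * dg e1 x by move=> x; rewrite inE => /andP[].
have := sum_card_mul h; rewrite -big_distrr /=; have := sum_inT S1 (dg e1); rewrite -/(size_e e1).
move: hD1 n0 hk; move: (\sum_(x in S1) _) (size_e e1) #|S1|; clear => a b c *.
by rewrite leqNgt; apply/negP => lt; nia.
Qed.

Lemma phaseB1 m (S : {set V1}) : #|S| <= m -> S \subset S1 ->
  exists P, [/\ InvB P, S \subset dom P & forall p, p \in P -> p \notin PA -> p.1 \in S].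
Proof.
elim: m S => [|m IHm] S.
  rewrite leqn0 cards_eq0 => /eqP -> _; exists PA; split; [exact: InvB_PA|exact: sub0set|].
  by move=> p pP; rewrite pP.
have [->|[x xS]] := set_0Vmem S; first by move=> _; apply: IHm; rewrite cards0.
move=> leS sS; have cS : #|S| = #|S :\ x|.+1 by rewrite (cardsD1 x) xS.
have sS' : S :\ x \subset S1 by apply: subset_trans sS; apply: subsetDl.
have [|P [invB sP hP]] := IHm (S :\ x) _ sS'; first by rewrite -ltnS -cS.
have SE : S = x |: (S :\ x) by rewrite setD1K.
have [xP|xP] := boolP (x \in dom P).
  exists P; split=> //; first by rewrite SE subUset sub1set xP.
  by move=> p pP npP; have := hP p pP npP; rewrite in_setD1 => /andP[].
have xH : x \in H1 by have := subsetP sS x xS; rewrite inE => /andP[].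
have [[okP sPA] hPP _] := invB.
have okD : ok (P :\: PA) by apply: okp_sub okP; apply: subsetDl.
have cD : #|P :\: PA| <= 13.
  rewrite -(card_dom okD); apply: leq_trans card_S1; apply/subset_leq_card/subsetP => z /imsetP[p].
  by rewrite inE => /andP[npP pP] ->; apply: (subsetP sS'); apply: hP.
(* 178 = 35 + 13 * 11: a vertex of small G3-degree must be adjacent to one of the at most 13 hosts,
   each of degree at most 11. *)
have cY : #|Yt P x| <= 178.
  apply: leq_trans (_ : #|[set y | n < 8 * dg (tr e3) y] :|: \bigcup_(p in P :\: PA) nb e2 p.2| <= _).
    apply/subset_leq_card/subsetP => y; rewrite inE => /andP[yP lt]; rewrite in_setU inE.
    case: ltnP => //= le8; apply/bigcupP.
    have [/existsP[p /andP[pP e]]|no] := boolP [exists p in P :\: PA, e2 y p.2].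
      by exists p => //; rewrite inE s2.
    have l0 : loadB P y = 0.
      rewrite /loadB big_pred0 // => p; apply/negbTE; apply: contra no => h.
      by apply/existsP; exists p.
    by exfalso; have := dg_loadB invB yP; have := hG x; move: lt le8 l0 n0 hk; clear; nlia.
  apply: leq_trans (leq_card_setU _ _) _.
  apply: leq_trans (leq_add hf2 (leq_card_bigcup _ _)) _.
  apply: leq_trans (_ : 35 + \sum_(p in P :\: PA) 11 <= _).
    rewrite leq_add2l; apply: leq_sum => p; rewrite in_setD => /andP[npP pP].
    by have [_] := hPP p pP npP; rewrite inE -ltnNge.
  by rewrite sum_nat_const; nlia.
have [||w inv] := InvB_step (a := 13) invB xH xP _ cY.
- by apply: leq_trans cD; apply/subset_leq_card/subsetP => p; rewrite inE => /andP[].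
- by move: hk; clear; nlia.
exists ((x, w) |: P); split=> //.
  by rewrite SE /dom imsetU1 setUS.
move=> p; rewrite in_setU1 => /predU1P[-> _|pP npP] //.
by have := hP p pP npP; rewrite in_setD1 => /andP[].
Qed.

Lemma phaseB2 m (S : {set V1}) : #|S| <= m -> S \subset H1 -> [disjoint S & S1] ->
  exists P, [/\ InvB P, S1 :|: S \subset dom P & forall p, p \in P -> p \notin PA -> p.1 \in S1 :|: S].
Proof.
elim: m S => [|m IHm] S.
  rewrite leqn0 cards_eq0 => /eqP -> _ _; rewrite setU0; exact: phaseB1 (leqnn #|S1|) (subxx _).
have [->|[x0 x0S]] := set_0Vmem S; first by move=> _; apply: IHm; rewrite cards0.
move=> leS sS dS; pose f x := #|nb e1 x :&: S|.
case: (arg_minnP f x0S) => x xS minx; rewrite /f in minx.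
have {}xS : x \in S := xS.
have cS : #|S| = #|S :\ x|.+1 by rewrite (cardsD1 x) xS.
have sS' : S :\ x \subset H1 by apply: subset_trans sS; apply: subsetDl.
have dS' : [disjoint S :\ x & S1] by apply: disjointWl dS; apply: subsetDl.
have [|P [invB sP hP]] := IHm (S :\ x) _ sS' dS'; first by rewrite -ltnS -cS.
have SE : S = x |: (S :\ x) by rewrite setD1K.
have sU : S1 :|: (S :\ x) \subset S1 :|: S by apply/setUS/subsetDl.
have [xP|xP] := boolP (x \in dom P).
  exists P; split=> //; first by rewrite SE setUCA subUset sub1set xP.
  by move=> p pP npP; apply: (subsetP sU); apply: hP.
have xH : x \in H1 := subsetP sS x xS.
have xlt : 10 * dg e1 x < 3 * n.
  rewrite ltnNge; apply/negP => le; move/disjoint_setI0: dS => /setP/(_ x).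
  by rewrite in_set0 in_setI xS inE xH le.
have [[okP sPA] hPP _] := invB.
(* As for [H2], now with [size_e e1 < 4 * n < 80 * (k.+1 * k.+1)]. *)
have mu : #|nb e1 x :&: S| <= 9 * k + 8.
  have : #|nb e1 x :&: S| * #|S| <= size_e e1.
    apply: leq_trans (sum_inT S _); apply: sum_card_mul => z zS.
    by apply: leq_trans (minx z zS) _; apply/subset_leq_card/subsetIl.
  have : #|nb e1 x :&: S| < #|S|.
    rewrite cS ltnS; apply/subset_leq_card/subsetP => z; rewrite !inE => /andP[e ->].
    by rewrite andbT; apply: contraTneq e => ->; rewrite i1.
  move: kn' hD1 hk; move: #|_ :&: _| #|S| (size_e e1) => a b c; clear => h1 h2 h3 h4 h5.
  rewrite leqNgt; apply/negP => h6.
  have : (9 * k + 9) * (9 * k + 9) <= a * b by apply: leq_mul; lia.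
  by nia.
have ca : #|[set p in P :\: PA | e1 x p.1]| <= 9 * k + 21.
  have okQ : ok [set p in P :\: PA | e1 x p.1].
    by apply: okp_sub okP; apply/subsetP => p; rewrite !inE => /andP[/andP[_ ->]].
  rewrite -(card_dom okQ).
  apply: leq_trans (_ : #|S1 :|: (nb e1 x :&: S)| <= _).
    apply/subset_leq_card/subsetP => w /imsetP[p]; rewrite inE => /andP[+ e] ->.
    rewrite in_setD => /andP[npP pP]; have := hP p pP npP.
    by rewrite !in_setU in_setI in_setD1 => /orP[->//|/andP[_ ->]]; rewrite [p.1 \in nb _ _]inE e orbT.
  by apply: leq_trans (leq_card_setU _ _) _; have := card_S1; nlia.
(* Vertices of small G3-degree need [loadB] at least 37n/100. The total is at most [11 * size_e e1],
   below 44n, which allows 118 of them; 118 + 35 = 153. *)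
have cY : #|Yt P x| <= 153.
  have : #|Yt P x| <= #|[set y | n < 8 * dg (tr e3) y]| + #|[set y | 37 * n <= 100 * loadB P y]|.
    apply: leq_trans (leq_card_setU _ _); apply/subset_leq_card/subsetP => y.
    rewrite inE => /andP[yP lt]; rewrite in_setU !inE; case: ltnP => //= le8.
    by have := dg_loadB invB yP; move: lt n0 hk xlt le8 kn; clear; move=> *; nia.
  have : 37 * n * #|[set y | 37 * n <= 100 * loadB P y]| <= 100 * (11 * size_e e1).
    apply: leq_trans (_ : \sum_(y in [set y | 37 * n <= 100 * loadB P y]) 100 * loadB P y <= _).
      by apply: sum_card_mul => z; rewrite inE.
    rewrite -big_distrr leq_mul2l /=; apply: leq_trans (sum_loadB invB).
    exact: sum_inT.
  move: hf2 hD1 n0 hk; move: #|Yt P x| #|_| #|_| (size_e e1); clear => a b c d *.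
  by nia.
(* The budget [372 * k + 450] needed here is what the room [390 * k] has to exceed. *)
have [|w inv] := InvB_step invB xH xP ca cY.
  by move: hk; clear; nlia.
exists ((x, w) |: P); split=> //.
  by rewrite SE setUCA /dom imsetU1 setUS.
move=> p; rewrite in_setU1 => /predU1P[-> _|pP npP]; first by rewrite inE xS orbT.
by apply: (subsetP sU); apply: hP.
Qed.

Lemma phaseB : exists2 P, InvB P & H1 \subset dom P.
Proof.
have d : [disjoint H1 :\: S1 & S1] by rewrite -setI_eq0 setIDAC setDIl setDv setI0.
have [P [invB sP _]] := phaseB2 (leqnn #|H1 :\: S1|) (subsetDl _ _) d.
exists P => //; apply: subset_trans sP; apply/subsetP => x xH.
by rewrite in_setU in_setD xH andbT orbN.
Qed.

(** * Placing the vertices of large conflict degree and completing the packing *)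

Lemma count_loads (V : finType) (A : {set V}) (f d : V -> nat) c S :
  (forall x, x \in A -> n < 8 * d x \/ c * n <= 1000 * f x) ->
  #|[set x | n < 8 * d x]| <= 35 -> \sum_x f x <= S -> c * n * #|A| <= c * n * 35 + 1000 * S.
Proof.
move=> hA h35 hS.
have : #|A| <= #|[set x | n < 8 * d x]| + #|[set x | c * n <= 1000 * f x]|.
  apply: leq_trans (leq_card_setU _ _); apply/subset_leq_card/subsetP => x /hA[h|h].
    by rewrite !inE h.
  by rewrite !inE h orbT.
have : c * n * #|[set x | c * n <= 1000 * f x]| <= 1000 * S.
  apply: leq_trans (_ : \sum_(x in [set x | c * n <= 1000 * f x]) 1000 * f x <= _).
    by apply: sum_card_mul => x; rewrite inE.
  by rewrite -big_distrr leq_mul2l /=; apply: leq_trans hS; apply: sum_inT.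
move: h35 => h35 h1 h2.
have : c * n * #|A| <= c * n * (35 + #|[set x | c * n <= 1000 * f x]|).
  by rewrite leq_mul2l; apply/orP; right; apply: leq_trans h2 _; rewrite leq_add2r.
by rewrite mulnDr; nlia.
Qed.

Lemma dg_B P x : InvB P -> dg e1 x <= k -> dg (cf P) x <= dg (cf PA) x + 11 * k.
Proof.
move=> [[okP sP] hP _] xk; apply: leq_trans (dg_conf_grow _ _ s2 x sP) _; rewrite leq_add2l.
have okD : ok (P :\: PA) by apply: okp_sub okP; apply: subsetDl.
apply: leq_trans (_ : 11 * #|nb e1 x| <= _); last by rewrite leq_mul2l.
apply: leq_trans (sum_pairs_le (A := nb e1 x) (k := 11) okD _).
  by apply/eq_leq/eq_bigl => p; rewrite [p.1 \in _]inE.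
move=> p; rewrite inE => /andP[npA pP] _; have [_] := hP p pP npA.
by rewrite inE -ltnNge.
Qed.

(** Two thresholds are used. The vertices with conflict degree above 7n/10 number at most 157 and
    fit into the room that was kept. The possibly more numerous ones above 3n/10 then still have
    almost 3n/10 free vertices. The rest satisfies [finish0] with [l] about 3n/10 plus [m * k]. *)
Lemma phaseC : exists P, [/\ ok P, PA \subset P & #|P| = n].
Proof.
have [P invB H1P] := phaseB; have [[okP sP] hP bP] := invB.
have [_ _ _ bA] := invA.
have ndA x : x \notin dom P -> x \notin dom PA by apply: contra => /(subsetP (imsetS _ sP)).
have u1' x : x \notin dom P -> x \notin H1 by apply: contra => /(subsetP H1P).
have u1 x : x \notin dom P -> dg e1 x <= k by move/u1'; rewrite inE -leqNgt.
have u2 y : y \notin cod P -> dg e2 y <= k by apply: small_outside.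
have b1 x : x \notin dom P -> dg (cf P) x + 379 * k <= n.
  by move=> xP; have := dg_B invB (u1 x xP); have := bA x (u1' x xP) (ndA x xP); nlia.
have cP := cardPB invB.
pose Hv1 c := [set x | (x \notin dom P) && (c * n < 10 * dg (cf P) x)].
pose Hv2 c := [set y | (y \notin cod P) && (c * n < 10 * dg (tr (cf P)) y)].
have l1 x : x \notin dom P -> dg (cf P) x <= dg e3 x + load e1 e2 P0 PA x + 11 * k.
  move=> xP; apply: leq_trans (dg_B invB (u1 x xP)) _; rewrite leq_add2r.
  exact: dg_load.
have S1 := sum_load s1 invA; have S2 := sum_loadB invB.
have k1 : 1000 * k <= n by move: n0; clear; nlia.
(* 169 and 569 are thousandths: 3/10 and 7/10, less 1/8 for G3 and less [11 * k], at most
   11n/2040. *)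
have cnt1 c d : (c = 3 /\ d = 169) \/ (c = 7 /\ d = 569) ->
    d * n * #|Hv1 c| <= d * n * 35 + 1000 * (3 * size_e e2).
  move=> cd; apply: count_loads hf1 S1 => x; rewrite inE => /andP[xP lt].
  have [h|h] := ltnP n (8 * dg e3 x); [by left|right].
  have := l1 x xP; move: lt h n0 hk; move: (load _ _ _ _ _) (dg (cf P) x) (dg e3 x).
  by case: cd => -[-> ->]; clear; nlia.
have cnt2 c d : (c = 3 /\ d = 169) \/ (c = 7 /\ d = 569) ->
    d * n * #|Hv2 c| <= d * n * 35 + 1000 * (11 * size_e e1).
  move=> cd; apply: count_loads hf2 S2 => y; rewrite inE => /andP[yP lt].
  have [h|h] := ltnP n (8 * dg (tr e3) y); [by left|right].
  have := dg_loadB invB yP; move: lt h n0 hk; move: (loadB _ _) (dg (tr _) y) (dg (tr e3) y).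
  by case: cd => -[-> ->]; clear; nlia.
pose m := #|Hv1 3| + #|Hv2 3|.
have hm : 10 * ((121 + 2 * m) * k + 219 + m) < 3 * n.
  apply: heavy_numeric hk kn kn' hDD (ltnW hD1) _.
  have := cnt1 3 169 (or_introl (conj erefl erefl)); have := cnt2 3 169 (or_introl (conj erefl erefl)).
  rewrite /m mulnDr -!mulnA; move: (n * #|_|) (n * #|_|); nlia.
pose c1 := #|Hv1 7| + #|Hv2 7|.
have hc1 : c1 <= 157.
  have := cnt1 7 569 (or_intror (conj erefl erefl)); have := cnt2 7 569 (or_intror (conj erefl erefl)).
  move: hDD hD1; rewrite /c1; move: #|Hv1 _| #|Hv2 _| (size_e e1) (size_e e2) n0 hk; clear.
  by move=> a b c d *; rewrite leqNgt; apply/negP => lt; nia.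
have s71 : Hv1 7 \subset Hv1 3.
  by apply/subsetP => x; rewrite !inE => /andP[->]; nlia.
have s72 : Hv2 7 \subset Hv2 3.
  by apply/subsetP => x; rewrite !inE => /andP[->]; nlia.
have [x xH _|y yH _|P1 [ok1 sP1 cP1 [d1 c1']  [g1 g2]]] :=
    @place_set _ _ e1 e2 e3 s1 i1 s2 i2 n k n1 n2 c1 P (Hv1 7) (Hv2 7) okP u1 u2 (leqnn _).
- have := b1 x; move: xH; rewrite inE => /andP[-> _] /(_ isT).
  by move: hc1 cP hk; clear; nia.
- have := bP y; move: yH; rewrite inE => /andP[-> _] /(_ isT).
  by move: hc1 cP hk; clear; nia.
pose W1 := Hv1 3 :\: dom P1; pose W2 := Hv2 3 :\: cod P1.
pose c2 := #|W1| + #|W2|.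
have hc2 : c1 + c2 <= m.
  have a1 : #|W1| + #|Hv1 7| <= #|Hv1 3|.
    rewrite addnC -(cardsID (dom P1) (Hv1 3)) leq_add2r; apply/subset_leq_card.
    by rewrite subsetI s71.
  have a2 : #|W2| + #|Hv2 7| <= #|Hv2 3|.
    rewrite addnC -(cardsID (cod P1) (Hv2 3)) leq_add2r; apply/subset_leq_card.
    by rewrite subsetI s72.
  by rewrite /c1 /c2 /m; nlia.
have d01 x : x \notin dom P1 -> x \notin dom P by apply: contra => /(subsetP (imsetS _ sP1)).
have c01 x : x \notin cod P1 -> x \notin cod P by apply: contra => /(subsetP (imsetS _ sP1)).
have mk : c1 * k + c2 * k <= m * k by rewrite -mulnDl leq_mul2r hc2 orbT.
have [x /d01|y /c01||x xW xP1|y yW yP1|P2 [ok2 sP2 cP2 [d2 c2'] [g1' g2']]] :=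
    @place_set _ _ e1 e2 e3 s1 i1 s2 i2 n k n1 n2 c2 P1 W1 W2 ok1 _ _ _ _ _.
- exact: u1.
- exact: u2.
- exact: leqnn.
- have : x \notin Hv1 7 by apply: contra xP1 => /(subsetP d1).
  rewrite inE (d01 x xP1) /= -leqNgt => le7.
  exact: stage_numeric hm hc2 cP cP1 le7 (g1 x).
- have : y \notin Hv2 7 by apply: contra yP1 => /(subsetP c1').
  rewrite inE (c01 y yP1) /= -leqNgt => le7.
  exact: stage_numeric hm hc2 cP cP1 le7 (g2 y).
have d12 x : x \notin dom P2 -> x \notin dom P1 by apply: contra => /(subsetP (imsetS _ sP2)).
have c12 x : x \notin cod P2 -> x \notin cod P1 by apply: contra => /(subsetP (imsetS _ sP2)).
have [x xP2|y yP2||P3 [ok3 sP3 cP3]] :=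
    @finish0 _ _ e1 e2 e3 s1 i1 s2 n k n1 n2 ((3 * n) %/ 10 + m * k) P2 ok2.
- split; first by apply/u1/d01/d12.
  have : x \notin Hv1 3.
    apply: contra xP2 => xH; case: (boolP (x \in dom P1)) => [|xP1].
      by apply: (subsetP (imsetS _ sP2)).
    by apply: (subsetP d2); rewrite in_setD xP1.
  rewrite inE (d01 x (d12 x xP2)) /= -leqNgt => le3.
  exact: final_numeric hc2 le3 (g1 x) (g1' x).
- split; first by apply/u2/c01/c12.
  have : y \notin Hv2 3.
    apply: contra yP2 => yH; case: (boolP (y \in cod P1)) => [|yP1].
      by apply: (subsetP (imsetS _ sP2)).
    by apply: (subsetP c2'); rewrite in_setD yP1.
  rewrite inE (c01 y (c12 y yP2)) /= -leqNgt => le3.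
  exact: final_numeric hc2 le3 (g2 y) (g2' y).
- have dv : 10 * ((3 * n) %/ 10) <= 3 * n by rewrite mulnC leq_trunc_div.
  by move: dv hm hc2 cP cP1 cP2 kn; rewrite !mulnDl; clear; nlia.
exists P3; split=> //.
by apply: subset_trans sP (subset_trans sP1 (subset_trans sP2 sP3)).
Qed.

End PhaseB.

(** * The packing theorem for one order of the two graphs *)

Lemma sqrt_scale n : 20 * (102 * 102) <= n -> exists k, [/\ 102 <= k, 20 * (k * k) <= n & n < 20 * (k.+1 * k.+1)].
Proof.
move=> hn.
have ex : exists k, 20 * (k * k) <= n by exists 0.
have bd k : 20 * (k * k) <= n -> k <= n by nia.
case: (ex_maxnP ex bd) => k kn mx; exists k; split; first exact: mx.
  exact: kn.
by rewrite ltnNge; apply/negP => /mx; rewrite ltnn.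
Qed.

Section Oneway.
Variables (V1 V2 : finType) (e1 : rel V1) (e2 : rel V2) (e3 : V1 -> V2 -> bool).
Hypotheses (s1 : symmetric e1) (i1 : irreflexive e1) (s2 : symmetric e2) (i2 : irreflexive e2).
Variables (n k : nat) (P0 : {set V1 * V2}).
Hypotheses (n1 : #|V1| = n) (n2 : #|V2| = n).

(** [P0] consists of pairs fixed in advance whose vertices are isolated in both graphs; residual
    triples have this form. *)
Theorem pack_oneway :
  102 <= k -> 20 * (k * k) <= n -> n < 20 * (k.+1 * k.+1) ->
  okp e1 e2 e3 P0 -> #|P0| <= 100 ->
  (forall p x, p \in P0 -> ~~ e1 x p.1) -> (forall p y, p \in P0 -> ~~ e2 y p.2) ->
  size_e e1 + size_e e2 + 2 * (11 * (195 * 195) + 4) <= 6 * n ->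
  (forall x, 7 * (dg e1 x + 390 * k) <= 6 * n) ->
  (forall y, 7 * (dg e2 y + 390 * k) <= 6 * n) ->
  (forall x, 12 * dg e3 x + size_e e2 + 12 * (390 * k) <= 12 * n) ->
  (forall y, dg (tr e3) y + 3 * k + 390 * k <= n) ->
  #|[set x | n < 8 * dg e3 x]| <= 35 -> #|[set y | n < 8 * dg (tr e3) y]| <= 35 ->
  (forall x y, size_e e1 + 2 * dg e1 x + 4 * dg (tr e3) y + 4 * (260 * k) < 4 * n) ->
  oneway e1 e2 e3 n k (11 * (195 * 195) + 4) ->
  exists P, [/\ okp e1 e2 e3 P, P0 \subset P & #|P| = n].
Proof.
move=> hk kn kn' okP0 cP0 iso1 iso2 hDD hG1 hG2 hd31 hd32 hf1 hf2 hc ow.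
have hh : #|H1 e1 k| + #|H2 e2 k| <= 120 * k + 119.
  have := size_e_count e1 k.+1; have := size_e_count e2 k.+1.
  rewrite -/(H1 e1 k) -/(H2 e2 k) => h2 h1.
  suff : (#|H1 e1 k| + #|H2 e2 k|) * k.+1 < 120 * k.+1 * k.+1.
    by rewrite ltn_mul2r /=; lia.
  by move: h1 h2 kn' hDD; clear; nia.
have [PA invA covA] := phaseA s1 i1 s2 i2 n1 n2 iso1 iso2 hk kn kn' erefl hDD hh hG2 hd31 hf1 hc okP0 cP0 ow.
have hD1 : size_e e1 < 4 * n.
  have [x _] : exists x : V1, true.
    have : 0 < #|[set: V1]| by rewrite cardsT n1; move: hk kn; clear; nia.
    by case/card_gt0P => x _; exists x.
  have [y _] : exists y : V2, true.
    have : 0 < #|[set: V2]| by rewrite cardsT n2; move: hk kn; clear; nia.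
    by case/card_gt0P => y _; exists y.
  by have := hc x y; nlia.
have [[_ sA] _ _ _] := invA.
have [P [okP sP cP]] := phaseC s1 i1 s2 i2 n1 n2 iso1 iso2 hk kn kn' hDD hD1 hh hG1 hd32 hf1 hf2 cP0 invA covA.
exists P; split=> //; exact: subset_trans sP.
Qed.

End Oneway.

(** * Residual triples *)

Section Residual.
Variables (V1 V2 : finType) (e1 : rel V1) (e2 : rel V2) (e3 : V1 -> V2 -> bool).
Hypotheses (s1 : symmetric e1) (i1 : irreflexive e1) (s2 : symmetric e2) (i2 : irreflexive e2).
Variable P0 : {set V1 * V2}.

(** Edges at [A] are deleted but its vertices are kept, so that the vertex types and [n] stay the
    same. *)
Definition res (V : finType) (A : {set V}) (e : rel V) : rel V :=
  fun x y => [&& e x y, x \notin A & y \notin A].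
(** Conflicts with [P0] become edges of the new G3. A packing of the residual triple that contains
    [P0] is therefore a packing of the original one. *)
Definition res3 x y := [&& x \notin dom P0, y \notin cod P0 & conf e1 e2 e3 P0 x y].

Lemma res_sym (V : finType) (A : {set V}) (e : rel V) : symmetric e -> symmetric (res A e).
Proof. by move=> se x y; rewrite /res se [in LHS]andbCA andbC -andbA andbCA; do !case: (_ \notin _); rewrite ?andbT ?andbF. Qed.

Lemma res_irr (V : finType) (A : {set V}) (e : rel V) : irreflexive e -> irreflexive (res A e).
Proof. by move=> ie x; rewrite /res ie. Qed.

Lemma dg_res (V : finType) (A : {set V}) (e : rel V) x : dg (res A e) x <= dg e x.
Proof. by apply: leq_dg => y /and3P[]. Qed.

Lemma size_res (V : finType) (A : {set V}) (e : rel V) : symmetric e ->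
  size_e (res A e) + 2 * \sum_(x in A) dg e x <= size_e e + \sum_(x in A) #|nb e x :&: A|.
Proof.
move=> se.
have E : size_e e = \sum_(x in ~: A) #|nb e x :\: A| + \sum_(x in ~: A) #|nb e x :&: A| + \sum_(x in A) dg e x.
  rewrite -big_split /= /size_e (bigID (mem A)) /= addnC; congr (_ + _).
  apply: eq_big => [x|x _]; first by rewrite in_setC.
  by rewrite addnC /dg -(cardsID A (nb e x)).
have E2 : \sum_(x in ~: A) #|nb e x :&: A| = \sum_(x in A) #|nb e x :\: A|.
  rewrite double_count; apply: eq_bigr => x _; rewrite setDE; congr #|pred_of_set (_ :&: _)|.
  by apply/setP => y; rewrite !inE /tr se.
have E3 : \sum_(x in A) dg e x = \sum_(x in A) #|nb e x :&: A| + \sum_(x in A) #|nb e x :\: A|.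
  by rewrite -big_split /=; apply: eq_bigr => x _; rewrite cardsID.
have L : size_e (res A e) <= \sum_(x in ~: A) #|nb e x :\: A|.
  rewrite /size_e (bigID (mem A)) /= big1 ?add0n => [|x xA]; last first.
    by apply/eqP; rewrite cards_eq0; apply/eqP/setP => y; rewrite !inE /res xA andbF.
  rewrite [leqRHS](eq_bigl (fun x => x \notin A)) => [|x]; last by rewrite in_setC.
  apply: leq_sum => x xA; apply/subset_leq_card/subsetP => y; rewrite !inE => /and3P[-> _ ->].
  by [].
by move: E E2 E3 L; nlia.
Qed.

Lemma dg_res3 x : dg res3 x <= dg e3 x + \sum_(p in P0 | e1 x p.1) dg e2 p.2.
Proof.
apply: leq_trans (dg_conf _ _ _ _ s2); apply: leq_dg => y; by case/and3P.
Qed.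

Lemma dg_res3' y : dg (tr res3) y <= dg (tr e3) y + \sum_(p in P0 | e2 y p.2) dg e1 p.1.
Proof.
apply: leq_trans (_ : dg (tr (conf e1 e2 e3 P0)) y <= _).
  by apply: leq_dg => x; case/and3P.
rewrite -dg_conf_sw; apply: leq_trans (dg_conf _ _ _ _ s1) _; rewrite leq_add2l.
rewrite (reindex (fun p : V1 * V2 => (p.2, p.1))) /=; last first.
  by exists (fun p => (p.2, p.1)) => -[].
by apply/eq_leq/eq_bigl => -[a b]; rewrite !inE.
Qed.

Lemma dg_res3_0 x : x \in dom P0 -> dg res3 x = 0.
Proof. by move=> h; apply/eqP; rewrite cards_eq0; apply/eqP/setP => y; rewrite !inE /res3 h. Qed.

Lemma res_okp : okp e1 e2 e3 P0 -> okp (res (dom P0) e1) (res (cod P0) e2) res3 P0.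
Proof.
case=> inj _ _; split=> // [p pP|p q pP qP]; first by rewrite /res3 mem_dom.
by rewrite /res mem_dom // andbF.
Qed.

Lemma res_lift P : okp e1 e2 e3 P0 -> okp (res (dom P0) e1) (res (cod P0) e2) res3 P ->
  P0 \subset P -> okp e1 e2 e3 P.
Proof.
move=> [inj0 ne0 nc0] [inj ne nc] /subsetP sP.
have out p : p \in P -> p \notin P0 -> p.1 \notin dom P0 /\ p.2 \notin cod P0.
  move=> pP npP; split; apply: contra npP => /imsetP[q qP E].
    have := inj _ _ pP (sP _ qP); rewrite E eqxx => /esym/eqP E2.
    by rewrite (surjective_pairing p) E E2 -surjective_pairing.
  have := inj _ _ pP (sP _ qP); rewrite E eqxx => /eqP E2.
  by rewrite (surjective_pairing p) E E2 -surjective_pairing.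
have ncf p : p \in P -> p \notin P0 -> ~~ conf e1 e2 e3 P0 p.1 p.2.
  move=> pP npP; have [o1 o2] := out p pP npP.
  by have := ne p pP; rewrite /res3 o1 o2.
split=> // [p pP|p q pP qP e].
  have [pP0|npP0] := boolP (p \in P0); first exact: ne0.
  by have := ncf p pP npP0; rewrite negb_or => /andP[].
have [pP0|npP0] := boolP (p \in P0); have [qP0|nqP0] := boolP (q \in P0).
- exact: nc0.
- apply: contra (ncf q qP nqP0) => e'; apply/confP; right; exists p => //.
  by rewrite s1 s2.
- by apply: contra (ncf p pP npP0) => e'; apply/confP; right; exists q.
have [o1 o2] := out p pP npP0; have [o3 o4] := out q qP nqP0.
by have := nc p q pP qP; rewrite /res e o1 o2 o3 o4 /= !andbT; apply.
Qed.

End Residual.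

(** * Inequalities between degrees and degree sums *)

Lemma e3_sets (V W : finType) (r : V -> W -> bool) (A : {set V}) (B : {set W}) :
  \sum_(x in A) dg r x + \sum_(y in B) dg (tr r) y <= size_e r + #|A| * #|B|.
Proof.
have -> : size_e r = \sum_(x in A) dg r x + \sum_(x in ~: A) dg r x.
  rewrite /size_e (bigID (mem A)) /=; congr (_ + _).
  by apply: eq_bigl => x; rewrite in_setC.
rewrite -addnA leq_add2l.
apply: leq_trans (_ : \sum_(x in ~: A) #|nb r x :&: B| + #|A| * #|B| <= _).
  rewrite double_count mulnC -sum_nat_const -big_split /=; apply: leq_sum => y _.
  rewrite /dg -(cardsID (~: A) (nb (tr r) y)) leq_add2l.
  by apply/subset_leq_card/subsetP => x; rewrite in_setD in_setC negbK => /andP[].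
by rewrite leq_add2r; apply: leq_sum => x _; apply/subset_leq_card/subsetIl.
Qed.

Lemma size_pos (V : finType) (e : rel V) (A : {set V}) : (forall x, 0 < dg e x) ->
  \sum_(x in A) dg e x + #|V| <= size_e e + #|A|.
Proof.
move=> pos.
have -> : size_e e = \sum_(x in A) dg e x + \sum_(x in ~: A) dg e x.
  rewrite /size_e (bigID (mem A)) /=; congr (_ + _).
  by apply: eq_bigl => x; rewrite in_setC.
have : #|~: A| <= \sum_(x in ~: A) dg e x.
  by rewrite -sum1_card; apply: leq_sum => x _; apply: pos.
by have := cardsC A; nlia.
Qed.

Lemma size_pair (V : finType) (e : rel V) x x' : symmetric e -> irreflexive e -> x != x' ->
  2 * (dg e x + dg e x') <= size_e e + 2.
Proof.
move=> se ie xx'; have := e3_sets e [set x; x'] [set x; x'].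
rewrite cards2 xx' !big_setU1 ?inE //= !big_set1.
have trE z : dg (tr e) z = dg e z by apply: eq_card => w; rewrite !inE /tr se.
rewrite !trE => h.
have h2 : \sum_(z in [set x; x']) #|nb e z :&: [set x; x']| <= 2.
  rewrite big_setU1 ?inE //= big_set1.
  have l1 : nb e x :&: [set x; x'] \subset [set x'].
    apply/subsetP => w; rewrite !inE => /andP[e1 /orP[/eqP E|//]]; by rewrite E ie in e1.
  have l2 : nb e x' :&: [set x; x'] \subset [set x].
    apply/subsetP => w; rewrite !inE => /andP[e1 /orP[//|/eqP E]]; by rewrite E ie in e1.
  by have := subset_leq_card l1; have := subset_leq_card l2; rewrite !cards1; nlia.
have E : size_e e = \sum_(z in [set x; x']) dg e z + \sum_(z in ~: [set x; x']) dg e z.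
  rewrite /size_e (bigID (mem [set x; x'])) /=; congr (_ + _).
  by apply: eq_bigl => z; rewrite in_setC.
have E2 : \sum_(z in ~: [set x; x']) #|nb e z :&: [set x; x']| <= \sum_(z in ~: [set x; x']) dg e z.
  by apply: leq_sum => z _; apply/subset_leq_card/subsetIl.
move: E2; rewrite double_count.
have -> : \sum_(y in [set x; x']) #|nb (tr e) y :&: ~: [set x; x']| = \sum_(y in [set x; x']) #|nb e y :\: [set x; x']|.
  apply: eq_bigr => y _; apply: eq_card => w; by rewrite !inE /tr se andbC.
have : \sum_(z in [set x; x']) dg e z = \sum_(z in [set x; x']) #|nb e z :&: [set x; x']| + \sum_(z in [set x; x']) #|nb e z :\: [set x; x']|.
  by rewrite -big_split /=; apply: eq_bigr => z _; rewrite cardsID.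
have : \sum_(z in [set x; x']) dg e z = dg e x + dg e x'.
  by rewrite big_setU1 ?inE //= big_set1.
by move: h2 E; nlia.
Qed.

(** * Triples without isolated vertices *)

Definition fullpack (V1 V2 : finType) (e1 : rel V1) (e2 : rel V2) (e3 : V1 -> V2 -> bool) : Prop :=
  exists P, okp e1 e2 e3 P /\ #|P| = #|V1|.

Lemma fullpack_sw (V1 V2 : finType) (e1 : rel V1) (e2 : rel V2) (e3 : V1 -> V2 -> bool) :
  #|V1| = #|V2| -> fullpack e2 e1 (tr e3) -> fullpack e1 e2 e3.
Proof.
move=> E [P [okP cP]]; exists (sw P); split; last by rewrite card_sw cP E.
exact: (okp_sw okP).
Qed.

Local Notation C := (11 * (195 * 195) + 4).

(* The fields t_f1 and t_f2 are the bound F(G) <= 3n - C, doubled because size_e counts degrees. *)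
Record triple (n : nat) (V1 V2 : finType) (e1 : rel V1) (e2 : rel V2) (e3 : V1 -> V2 -> bool) : Prop := Triple {
  t_n1 : #|V1| = n; t_n2 : #|V2| = n;
  t_s1 : symmetric e1; t_i1 : irreflexive e1; t_s2 : symmetric e2; t_i2 : irreflexive e2;
  t_l1 : forall x, 0 < dg e1 x; t_l2 : forall y, 0 < dg e2 y;
  t_u1 : forall x, dg e1 x + 2 <= n; t_u2 : forall y, dg e2 y + 2 <= n;
  t_u31 : forall x, dg e3 x < n; t_u32 : forall y, dg (tr e3) y < n;
  t_f1 : forall x y, size_e e1 + size_e e2 + 2 * size_e e3 + 2 * (dg e1 x + (dg (tr e3) y - 4)) + 2 * C <= 6 * n;
  t_f2 : forall x y, size_e e1 + size_e e2 + 2 * size_e e3 + 2 * (dg e2 y + (dg e3 x - 4)) + 2 * C <= 6 * n }.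

Lemma triple_sw n (V1 V2 : finType) (e1 : rel V1) (e2 : rel V2) (e3 : V1 -> V2 -> bool) :
  triple n e1 e2 e3 -> triple n e2 e1 (tr e3).
Proof.
case=> *; split=> // x y; rewrite size_e_tr; first by rewrite [size_e e2 + _]addnC; auto.
by rewrite [size_e e2 + _]addnC; auto.
Qed.

Lemma fullpack_res (V1 V2 : finType) (e1 : rel V1) (e2 : rel V2) (e3 : V1 -> V2 -> bool) (P0 : {set V1 * V2}) n :
  symmetric e1 -> symmetric e2 -> #|V1| = n -> okp e1 e2 e3 P0 ->
  (exists P, [/\ okp (res (dom P0) e1) (res (cod P0) e2) (res3 e1 e2 e3 P0) P, P0 \subset P & #|P| = n]) ->
  fullpack e1 e2 e3.
Proof.
move=> s1 s2 n1 ok0 [Q [okQ sQ cQ]]; exists Q; split; last by rewrite cQ n1.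
exact: res_lift okQ sQ.
Qed.

(** Outside the exceptional set [B], a large [f] forces [g] to be at least [t], and the sum of [g]
    allows at most [s] such vertices. *)
Lemma count_heavy (V : finType) (f g : V -> nat) (B : {set V}) n b S t s :
  (forall x, x \notin B -> n < 8 * f x -> t <= g x) -> #|B| <= b -> \sum_x g x <= S ->
  S < t * s.+1 -> #|[set x | n < 8 * f x]| <= b + s.
Proof.
move=> h hb hS lt.
apply: leq_trans (_ : #|B :|: [set x | t <= g x]| <= _).
  apply/subset_leq_card/subsetP => x; rewrite !inE => hx.
  by case: (boolP (x \in B)) => //= xB; apply: h.
apply: leq_trans (leq_card_setU _ _) _; rewrite leq_add //.
have : t * #|[set x | t <= g x]| <= \sum_(x in [set x | t <= g x]) g x.
  by apply: sum_card_mul => x; rewrite inE.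
move=> h1; have := leq_ltn_trans (leq_trans h1 (leq_trans (sum_inT _ _) hS)) lt.
rewrite ltn_mul2l => /andP[_]; by rewrite ltnS.
Qed.

(** * No vertex of degree near n *)

Section CaseN.
Variables (n k : nat) (V1 V2 : finType) (e1 : rel V1) (e2 : rel V2) (e3 : V1 -> V2 -> bool).
Hypothesis tp : triple n e1 e2 e3.
Hypotheses (hk : 102 <= k) (kn : 20 * (k * k) <= n) (kn' : n < 20 * (k.+1 * k.+1)).

Lemma size_ge1 x : dg e1 x + n <= size_e e1 + 1.
Proof.
have := size_pos [set x] (t_l1 tp); by rewrite big_set1 cards1 (t_n1 tp).
Qed.

Lemma size_ge2 y : dg e2 y + n <= size_e e2 + 1.
Proof.
have := size_pos [set y] (t_l2 tp); by rewrite big_set1 cards1 (t_n2 tp).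
Qed.

Lemma size_ge_cross x y : dg e3 x + dg (tr e3) y <= size_e e3 + 1.
Proof. by have := e3_sets e3 [set x] [set y]; rewrite !big_set1 !cards1. Qed.

Lemma e3_two y y' : y != y' -> dg (tr e3) y + dg (tr e3) y' <= size_e e3.
Proof.
move=> yy'; have := e3_sets e3 set0 [set y; y'].
by rewrite big_set0 cards0 mul0n addn0 big_setU1 ?inE //= big_set1.
Qed.

Lemma exV1 : exists x : V1, True.
Proof.
have : 0 < #|[set: V1]| by rewrite cardsT (t_n1 tp); move: hk kn; clear; nia.
by case/card_gt0P => x _; exists x.
Qed.

Lemma exV2 : exists x : V2, True.
Proof.
have : 0 < #|[set: V2]| by rewrite cardsT (t_n2 tp); move: hk kn; clear; nia.
by case/card_gt0P => x _; exists x.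
Qed.

Lemma n2040 : 2040 * k <= n. Proof. by move: hk kn; clear; nia. Qed.

Lemma e3_le x : size_e e3 + dg e1 x <= 2 * n.
Proof.
have [y _] := exV2; have := size_ge1 x; have := size_ge2 y; have := t_f1 tp x y.
by have := t_l2 tp y; nlia.
Qed.

Hypothesis ng1 : forall x, 7 * (dg e1 x + 390 * k) <= 6 * n.
Hypothesis ng2 : forall y, 7 * (dg e2 y + 390 * k) <= 6 * n.
Hypothesis nq1 : forall x, 10 * dg e3 x <= 8 * n.
Hypothesis nq2 : forall y, 10 * dg (tr e3) y <= 8 * n.

Lemma no_giant_oneway :
  (forall x y, size_e e1 + 2 * dg e1 x + 4 * dg (tr e3) y + 4 * (260 * k) < 4 * n) ->
  fullpack e1 e2 e3.
Proof.
move=> hc; have n20 := n2040; have [x0 _] := exV1; have [y0 _] := exV2.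
have t200 := tangent 200 kn.
have [P [okP _ cP]] : exists P, [/\ okp e1 e2 e3 P, set0 \subset P & #|P| = n]; last first.
  by exists P; split=> //; rewrite (t_n1 tp).
apply: (pack_oneway (t_s1 tp) (t_i1 tp) (t_s2 tp) (t_i2 tp) (t_n1 tp) (t_n2 tp) hk kn kn') => //.
- by split=> [p q|p|p q]; rewrite inE.
- by rewrite cards0.
- by move=> p x; rewrite inE.
- by move=> p x; rewrite inE.
- by have := t_f1 tp x0 y0; nlia.
- move=> x; have := t_f2 tp x y0; have := size_ge1 x0; have := t_l1 tp x0; have := t_l2 tp y0.
  have := size_ge_cross x y0; have := nq1 x; have := size_ge2 y0; nlia.
- by move=> y; have := nq2 y; nlia.
- rewrite -[35]add0n; apply: (@count_heavy _ _ (dg e3) set0 n 0 (2 * n) (n %/ 8)) => //.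
  + by move=> x _ h; rewrite -ltnS ltn_divLR // mulnC; nlia.
  + by rewrite cards0.
  + by apply: leq_trans (e3_le x0); exact: leq_addr.
  + by have := n20; have := divn_eq n 8; have := ltn_mod n 8; nlia.
- rewrite -[35]add0n; apply: (@count_heavy _ _ (dg (tr e3)) set0 n 0 (2 * n) (n %/ 8)) => //.
  + by move=> x _ h; rewrite -ltnS ltn_divLR // mulnC; nlia.
  + by rewrite cards0.
  + by rewrite -/(size_e (tr e3)) size_e_tr; apply: leq_trans (e3_le x0); exact: leq_addr.
  + by have := n20; have := divn_eq n 8; have := ltn_mod n 8; nlia.
right=> x x' y y' t xx' yy' [x1 [y1 ht]].
have := e3_sets e3 [set x; x'] [set y; y'].
rewrite !big_setU1 ?inE //= !big_set1 !cards2 xx' yy' => h.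
by case: ht => ->; have := t_f1 tp x1 y1; have := t_f2 tp x1 y1; nlia.
Qed.

End CaseN.

(** If the sparsity condition fails in both orders, the degree sums, degrees and G3-degrees at the
    two witnesses add up to more than the two bounds on F at these witnesses permit. *)
Lemma no_giant n k (V1 V2 : finType) (e1 : rel V1) (e2 : rel V2) (e3 : V1 -> V2 -> bool) :
  triple n e1 e2 e3 -> 102 <= k -> 20 * (k * k) <= n -> n < 20 * (k.+1 * k.+1) ->
  (forall x, 7 * (dg e1 x + 390 * k) <= 6 * n) -> (forall y, 7 * (dg e2 y + 390 * k) <= 6 * n) ->
  (forall x, 10 * dg e3 x <= 8 * n) -> (forall y, 10 * dg (tr e3) y <= 8 * n) ->
  fullpack e1 e2 e3.
Proof.
move=> tp hk kn kn' ng1 ng2 nq1 nq2.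
have [hc|] := classic (forall x y, size_e e1 + 2 * dg e1 x + 4 * dg (tr e3) y + 4 * (260 * k) < 4 * n).
  exact: no_giant_oneway hc.
have [hc _|] := classic (forall y x, size_e e2 + 2 * dg e2 y + 4 * dg e3 x + 4 * (260 * k) < 4 * n).
  apply: fullpack_sw; first by rewrite (t_n1 tp) (t_n2 tp).
  exact: (no_giant_oneway (triple_sw tp) hk kn kn').
move=> /not_all_ex_not[y' /not_all_ex_not[x' /negP]]; rewrite -leqNgt => h2.
move=> /not_all_ex_not[x /not_all_ex_not[y /negP]]; rewrite -leqNgt => h1.
exfalso; have := t_f1 tp x y; have := t_f2 tp x' y'; have := size_ge_cross e3 x' y.
have := size_ge1 tp x; have := size_ge2 tp y'; have := ng1 x; have := ng2 y'.
by have := tangent 700 kn; nlia.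
Qed.

Lemma size_res_le (V : finType) (A : {set V}) (e : rel V) : size_e (res A e) <= size_e e.
Proof. by apply: leq_sum => x _; apply: dg_res. Qed.

Lemma okp_singleton (V1 V2 : finType) (e1 : rel V1) (e2 : rel V2) (e3 : V1 -> V2 -> bool) x y :
  irreflexive e1 -> ~~ e3 x y -> okp e1 e2 e3 [set (x, y)].
Proof.
move=> i1 h; split=> [p q|p|p q]; rewrite !inE.
- by move=> /eqP -> /eqP ->; rewrite !eqxx.
- by move=> /eqP ->.
- by move=> /eqP -> /eqP -> /=; rewrite i1.
Qed.

(** The entry point for residual triples. New edges of G3 spoil the bound on F, so the sparse
    alternative of [oneway] is used. *)
Lemma pack_res_e0 n k (V1 V2 : finType) (e1 : rel V1) (e2 : rel V2) (e3 : V1 -> V2 -> bool)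
    (P0 : {set V1 * V2}) :
  let r1 := res (dom P0) e1 in let r2 := res (cod P0) e2 in let r3 := res3 e1 e2 e3 P0 in
  triple n e1 e2 e3 -> 102 <= k -> 20 * (k * k) <= n -> n < 20 * (k.+1 * k.+1) ->
  okp e1 e2 e3 P0 -> #|P0| <= 100 ->
  (forall x, 7 * (dg r1 x + 390 * k) <= 6 * n) ->
  (forall y, 7 * (dg r2 y + 390 * k) <= 6 * n) ->
  (forall x, 12 * dg r3 x + size_e r2 + 12 * (390 * k) <= 12 * n) ->
  (forall y, dg (tr r3) y + 393 * k <= n) ->
  #|[set x | n < 8 * dg r3 x]| <= 35 -> #|[set y | n < 8 * dg (tr r3) y]| <= 35 ->
  (forall x y, size_e r1 + 2 * dg r1 x + 4 * dg (tr r3) y + 1040 * k < 4 * n) ->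
  (forall y, size_e r1 + 2 * dg (tr r3) y + 520 * k < 2 * n) ->
  fullpack e1 e2 e3.
Proof.
move=> r1 r2 r3 tp hk kn kn' ok0 c0 g1 g2 hd1 hd2 hf1 hf2 hc he0.
have [x0 _] := exV1 tp hk kn; have [y0 _] := exV2 tp hk kn.
apply: (fullpack_res (t_s1 tp) (t_s2 tp) (t_n1 tp) ok0).
apply: (@pack_oneway _ _ r1 r2 r3 (res_sym _ (t_s1 tp)) (res_irr _ (t_i1 tp)) (res_sym _ (t_s2 tp))
  (res_irr _ (t_i2 tp)) n k P0 (t_n1 tp) (t_n2 tp) hk kn kn') => //.
- exact: res_okp ok0.
- by move=> p x pP; rewrite /r1 /res mem_dom // !andbF.
- by move=> p x pP; rewrite /r2 /res mem_cod // !andbF.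
- have h1 : size_e r1 <= size_e e1 by apply: size_res_le.
  have h2 : size_e r2 <= size_e e2 by apply: size_res_le.
  by have := t_f1 tp x0 y0; nlia.
- by move=> y; have := hd2 y; nlia.
- by move=> x y; have := hc x y; nlia.
by left=> y; have := he0 y; nlia.
Qed.

Section Singleton.
Variables (V1 V2 : finType) (u : V1) (y0 : V2).
Lemma dom_singleton : dom [set (u, y0)] = [set u]. Proof. exact: imset_set1. Qed.
Lemma cod_singleton : cod [set (u, y0)] = [set y0]. Proof. exact: imset_set1. Qed.
Lemma sum_singleton (Q : pred (V1 * V2)) (f : V1 * V2 -> nat) :
  \sum_(p in [set (u, y0)] | Q p) f p = if Q (u, y0) then f (u, y0) else 0.
Proof. by rewrite big_mkcondr big_set1. Qed.
End Singleton.

(** * A vertex of nearly full degree in G3 *)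

(** The edges at [y0] use up so much of F that G1 is sparse and no other vertex of V2 has large
    G3-degree. After [y0] is fixed at a vertex [u] of degree at most 4, only the neighbours of [u]
    gain many conflicts, and the sparse alternative applies. *)
Lemma near_full_G3_vertex n k (V1 V2 : finType) (e1 : rel V1) (e2 : rel V2) (e3 : V1 -> V2 -> bool) y0 :
  triple n e1 e2 e3 -> 102 <= k -> 20 * (k * k) <= n -> n < 20 * (k.+1 * k.+1) ->
  (forall x, 7 * (dg e1 x + 390 * k) <= 6 * n) -> (forall y, 7 * (dg e2 y + 390 * k) <= 6 * n) ->
  8 * n < 10 * dg (tr e3) y0 -> fullpack e1 e2 e3.
Proof.
move=> tp hk kn kn' ng1 ng2 hQ; have n20 := n2040 hk kn.
have [x0 _] := exV1 tp hk kn.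
have g1 := size_ge1 tp; have g2 := size_ge2 tp.
have Q1 := t_u32 tp y0.
(* If all vertices not joined to [y0] had degree at least 5, G1 would have more edges than F leaves
   beside those at [y0]. *)
have [u uN u4] : exists2 u, ~~ e3 u y0 & dg e1 u <= 4.
  pose A := ~: nb (tr e3) y0.
  have cA : #|A| + dg (tr e3) y0 = n by rewrite -(t_n1 tp) -(cardsC (nb (tr e3) y0)) addnC.
  case: (pickP [pred u in A | dg e1 u <= 4]) => [u /andP[]|no].
    by rewrite /= !inE => uN u4; exists u.
  have h : forall x, x \in A -> 5 <= dg e1 x.
    by move=> x xA; have := no x; rewrite /= xA /= ltnNge => ->.
  exfalso; have := sum_card_mul h; have := size_pos A (t_l1 tp); have := t_f1 tp x0 y0.
  by have := g2 y0; have := t_l2 tp y0; have := size_ge_cross e3 x0 y0; rewrite (t_n1 tp); nlia.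
pose P0 := [set (u, y0)].
have ok0 : okp e1 e2 e3 P0 by apply: okp_singleton (t_i1 tp) uN.
have r3a x : dg (res3 e1 e2 e3 P0) x <= dg e3 x + (if e1 x u then dg e2 y0 else 0).
  by have := dg_res3 e1 e3 (t_s2 tp) P0 x; rewrite sum_singleton.
have r3b y : dg (tr (res3 e1 e2 e3 P0)) y <= (if y == y0 then 0 else dg (tr e3) y + 4).
  case: eqP => [->|_]; last first.
    apply: leq_trans (dg_res3' e2 e3 (t_s1 tp) P0 y) _; rewrite sum_singleton leq_add2l.
    by case: (e2 y y0).
  by rewrite leqn0 cards_eq0; apply/eqP/setP => x; rewrite !inE /tr /res3 cod_singleton inE eqxx andbF.
have d1 := dg_res (dom P0) e1; have d2 := dg_res (cod P0) e2.
have z1 := size_res_le (dom P0) e1; have z2 := size_res_le (cod P0) e2.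
have t200 := tangent 200 kn.
apply: (pack_res_e0 tp hk kn kn' ok0).
- by rewrite cards1.
- by move=> x; have := ng1 x; have := d1 x; nlia.
- by move=> x; have := ng2 x; have := d2 x; nlia.
- move=> x; have := r3a x; have := size_ge_cross e3 x y0; have := g2 y0; have := g1 x0; have := t_l1 tp x0.
  have := t_f1 tp x0 y0; case: (e1 x u); nlia.
- move=> y; have := r3b y; case: eqP => [_|/eqP yy0]; first by nlia.
  have := e3_two e3 yy0; have := t_f1 tp x0 y0; have := g1 x0; have := g2 y0.
  by have := t_l1 tp x0; have := t_l2 tp y0; nlia.
- apply: (@leq_trans (4 + 16)) => //.
  apply: (@count_heavy _ _ (dg e3) (nb e1 u) n 4 (2 * n) (n %/ 8)) => //.
  + move=> x; rewrite inE (t_s1 tp) => ux h; have := r3a x; rewrite (negbTE ux) => h3.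
    by rewrite -ltnS ltn_divLR // mulnC; nlia.
  + by have := e3_le tp hk kn kn' x0; rewrite -/(size_e e3); nlia.
  + by have := divn_eq n 8; have := ltn_mod n 8; nlia.
- apply: (@leq_trans (1 + 16)) => //.
  apply: (@count_heavy _ _ (dg (tr e3)) [set y0] n 1 (2 * n) (n %/ 8 - 4)) => //.
  + move=> x; rewrite inE => ux h; have := r3b x; rewrite (negbTE ux) => h3.
    have : n %/ 8 < (dg (tr e3) x + 4).+1 by rewrite ltn_divLR // mulnC; nlia.
    by nlia.
  + by rewrite cards1.
  + by rewrite -/(size_e (tr e3)) size_e_tr; have := e3_le tp hk kn kn' x0; nlia.
  + by have := divn_eq n 8; have := ltn_mod n 8; nlia.
- move=> x y; have := r3b y; have := d1 x; case: eqP => [_|/eqP yy0].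
    by have := t_f1 tp x y0; have := g1 x; have := g2 y0; have := t_l2 tp y0; have := size_ge_cross e3 x y0; nlia.
  have := e3_two e3 yy0; have := t_f1 tp x y0; have := g1 x; have := g2 y0.
  by have := t_l1 tp x; have := t_l2 tp y0; nlia.
move=> y; have := r3b y; case: eqP => [_|/eqP yy0].
  by have := t_f1 tp x0 y0; have := g1 x0; have := g2 y0; have := t_l2 tp y0; have := size_ge_cross e3 x0 y0; nlia.
have := e3_two e3 yy0; have := t_f1 tp x0 y0; have := g1 x0; have := g2 y0.
by have := t_l1 tp x0; have := t_l2 tp y0; nlia.
Qed.

(** * Tools for placing a giant vertex *)

(** Discharging: a leaf of [W] with [f = 0] and its neighbour in [W] passes its shortfall from
    degree 2 to that neighbour. A vertex with [f = 0] outside [G] receives nothing and satisfies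
    [2 <= dg e s + (dg e s == 1)], while each member of [G] can hide a shortfall of 2. The shortfall
    assumed in the hypothesis therefore needs at least [m] members of [G]. *)
Lemma leaf_star (V : finType) (e : rel V) (W : {set V}) (f : V -> nat) m :
  symmetric e -> (forall x, 0 < dg e x) ->
  \sum_(x in W) dg e x + \sum_(x in W) #|nb e x :\: W| + 2 * \sum_(x in W) f x + 2 * m <= 2 * #|W| ->
  m <= #|[set s in W | (f s == 0) && [exists t in W, [&& e s t, dg e t == 1 & f t == 0]]]|.
Proof.
move=> se pos hW; set G := [set s in W | _].
pose U := [set t in W | (dg e t == 1) && (f t == 0)].
have c1 : \sum_(t in W) (dg e t == 1) <= \sum_(t in W) (#|nb e t :\: W| + (dg e t == 1) * f t + (t \in U) * #|nb e t :&: W|).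
  apply: leq_sum => t tW; case: eqP => //= d1; rewrite inE tW d1 eqxx mul1n /=.
  have := cardsID W (nb e t); rewrite -/(dg e t) d1.
  by case: (f t) => [|m'] /=; rewrite ?mul1n ?mul0n; nlia.
have c2 : \sum_(t in W) (t \in U) * #|nb e t :&: W| = \sum_(s in W) #|nb e s :&: U|.
  transitivity (\sum_(t in U) #|nb e t :&: W|).
    rewrite [LHS]big_mkcond [RHS]big_mkcond /=; apply: eq_bigr => t _.
    by case: (boolP (t \in U)) => tU; case: (boolP (t \in W)) => tW; rewrite ?mul1n ?mul0n //;
      move: tU; rewrite inE (negbTE tW).
  rewrite double_count; apply: eq_bigr => s _; congr #|pred_of_set (_ :&: _)|.
  by apply/setP => t; rewrite !inE /tr se.
have c3 : \sum_(s in W) (#|nb e s :&: U| + 2) <=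
   \sum_(s in W) (dg e s + (dg e s == 1) + 2 * (s \in G) + (2 - (dg e s == 1)) * f s).
  apply: leq_sum => s sW.
  have le : #|nb e s :&: U| <= dg e s by apply/subset_leq_card/subsetIl.
  have p := pos s.
  case: (boolP (s \in G)) => sG /=; first by case: eqP; nlia.
  have [f0|fp] := posnP (f s); last first.
    by case: eqP => [d1|_]; nlia.
  have -> : #|nb e s :&: U| = 0.
    apply/eqP; rewrite cards_eq0; apply/eqP/setP => t; rewrite [in RHS]inE.
    apply/negbTE; apply: contra sG; rewrite !inE sW f0 eqxx /= => /and4P[est tW d1 ft].
    by apply/existsP; exists t; rewrite tW est d1 ft.
  by rewrite f0 muln0; move: p; case: (dg e s) => [|[|d]] //= _; nlia.
have c4 : \sum_(s in W) (s \in G) = #|G|.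
  rewrite -sum1_card big_mkcond [RHS]big_mkcond /=; apply: eq_bigr => s _.
  by case: (boolP (s \in W)) => sW; case: (boolP (s \in G)) => // ; rewrite inE (negbTE sW).
have c5 : \sum_(s in W) (dg e s == 1) * f s + \sum_(s in W) (2 - (dg e s == 1)) * f s = 2 * \sum_(s in W) f s.
  rewrite -big_split big_distrr /=; apply: eq_bigr => s _; case: eqP; rewrite /=; nlia.
move: c1 c3; rewrite !big_split /= c2 sum_nat_const !c4 big1_eq => c1 c3.
by move: c5 hW; nlia.
Qed.

(** Greedy: an earlier host forbids itself and its at most [d] neighbours. *)
Lemma choose_hosts (V1 V2 : finType) (e1 : rel V1) (e3 : V1 -> V2 -> bool) (S : {set V1}) (d : nat)
    (ws : seq V2) (t0 : V1) :
  symmetric e1 -> (forall t, t \in S -> dg e1 t <= d) -> uniq ws ->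
  (forall w, w \in ws -> dg (tr e3) w + size ws * d.+1 < #|S|) ->
  exists t : V2 -> V1, (forall w, w \in ws -> t w \in S /\ ~~ e3 (t w) w) /\
    (forall w w', w \in ws -> w' \in ws -> w != w' -> t w != t w' /\ ~~ e1 (t w) (t w')).
Proof.
move=> se dS; elim: ws => [|w ws IH] /=; first by exists (fun=> t0).
move=> /andP[wN uw] hS.
have [|t [t1 t2]] := IH uw.
  move=> w' w'ws; apply: leq_ltn_trans (hS w' _); last by rewrite inE w'ws orbT.
  by rewrite leq_add2l leq_mul2r leqnSn orbT.
have [x xS xN] : exists2 x, x \in S & x \notin nb (tr e3) w :|: \bigcup_(w' in ws) (t w' |: nb e1 (t w')).
  apply: set_exists_of_card; apply: leq_ltn_trans (leq_card_setU _ _) _.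
  apply: leq_ltn_trans (hS w (mem_head _ _)); rewrite leq_add2l.
  apply: leq_trans (leq_card_bigcup _ _) _.
  apply: leq_trans (_ : \sum_(w' in ws) d.+1 <= _).
    apply: leq_sum => w' w'ws; have [tS _] := t1 w' w'ws.
    by apply: leq_trans (leq_card_setU _ _) _; rewrite cards1 add1n ltnS; apply: dS.
  rewrite sum_nat_const leq_mul2r; apply/orP; right.
  by apply: leq_trans (card_size _) _.
move: xN; rewrite in_setU negb_or inE => /andP[xw xU].
have xU' w' : w' \in ws -> x != t w' /\ ~~ e1 x (t w').
  move=> w'ws; split; apply: contra xU => h; apply/bigcupP; exists w' => //; rewrite !inE.
    by rewrite h.
  by rewrite se h orbT.
have neq w' : w' \in ws -> (w' == w) = false.
  by move=> w'ws; apply: contraNF wN => /eqP <-.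
exists (fun z => if z == w then x else t z); split=> [z|z z'].
  by rewrite inE => /predU1P[->|zw]; [rewrite eqxx | rewrite neq //; apply: t1].
rewrite !inE => /predU1P[->|zw] /predU1P[->|zw']; rewrite ?eqxx // ?neq // => zz'.
- exact: xU'.
- by rewrite eq_sym se; apply: xU'.
exact: t2.
Qed.

Section Attach.
Variables (V1 V2 : finType) (e1 : rel V1) (e2 : rel V2) (e3 : V1 -> V2 -> bool).
Hypotheses (s1 : symmetric e1) (i1 : irreflexive e1) (s2 : symmetric e2) (i2 : irreflexive e2).
Variables (x1 : V1) (u : V2) (t : V2 -> V1) (A : {set V2}).
Hypothesis nxu : ~~ e3 x1 u.
Hypothesis uA : u \notin A.
Hypothesis tA : forall w, w \in A -> [/\ t w != x1, ~~ e1 x1 (t w) & ~~ e3 (t w) w].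
Hypothesis tAA : forall w w', w \in A -> w' \in A -> w != w' -> t w != t w' /\ ~~ e1 (t w) (t w').

(** The giant [x1] goes to [u], and a set [A] containing the neighbours of [u] goes to independent
    nonneighbours of [x1]. Nothing left unplaced is adjacent to [u], so the many neighbours of [x1]
    gain no conflict from it, and all edges at [x1] disappear. *)
Definition attach : {set V1 * V2} := (x1, u) |: [set (t w, w) | w in A].
Local Notation P0 := attach.

Lemma attachP p : reflect (p = (x1, u) \/ exists2 w, w \in A & p = (t w, w)) (p \in P0).
Proof.
rewrite in_setU1; apply: (iffP predU1P) => -[->|]; try by left.
  by move/imsetP => [w wA ->]; right; exists w.
by case=> w wA ->; right; apply: imset_f.
Qed.

Lemma attach_okp : okp e1 e2 e3 P0.
Proof.
have ne w w' : w \in A -> w' \in A -> (t w == t w') = (w == w').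
  move=> wA wA'; case: (eqVneq w w') => [->|/(tAA wA wA')[/negbTE -> //]]; by rewrite eqxx.
split.
- move=> p q /attachP[->|[w wA ->]] /attachP[->|[w' wA' ->]] /=; rewrite ?eqxx //.
  + have [h _ _] := tA wA'; rewrite eq_sym (negbTE h); apply/esym/negbTE.
    by apply: contra uA => /eqP ->.
  + have [h _ _] := tA wA; rewrite (negbTE h); apply/esym/negbTE.
    by apply: contra uA => /eqP <-.
  + exact: ne.
- by move=> p /attachP[->|[w wA ->]] //=; have [] := tA wA.
- move=> p q /attachP[->|[w wA ->]] /attachP[->|[w' wA' ->]] /=; rewrite ?i1 //.
  + by have [_ /negbTE -> _] := tA wA'.
  + by rewrite s1; have [_ /negbTE -> _] := tA wA.
  + case: (eqVneq w w') => [->|/(tAA wA wA')[_ /negbTE -> //]]; by rewrite i1.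
Qed.

Lemma attach_sum (Q : pred (V1 * V2)) (f : V1 * V2 -> nat) :
  \sum_(p in P0 | Q p) f p = (if Q (x1, u) then f (x1, u) else 0) + \sum_(w in A | Q (t w, w)) f (t w, w).
Proof.
rewrite big_mkcondr big_setU1 /=; last first.
  by apply/imsetP => -[w wA [_ E]]; case/negP: uA; rewrite E.
congr (_ + _); rewrite big_imset /=; last by move=> w w' _ _ [].
by rewrite -big_mkcondr.
Qed.

Lemma attach_card : #|P0| = #|A|.+1.
Proof.
rewrite cardsU1 card_imset; last by move=> w w' [].
by case: imsetP => // -[w wA [_ E]]; case/negP: uA; rewrite E.
Qed.

Lemma attach_cod : cod P0 = u |: A.
Proof. by rewrite /cod imsetU1 /= -imset_comp imset_id. Qed.

Lemma attach_dom : dom P0 = x1 |: [set t w | w in A].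
Proof. by rewrite /dom imsetU1 /= -imset_comp. Qed.

Lemma attach_size1 :
  size_e (res (dom P0) e1) + 2 * dg e1 x1 + 2 * \sum_(w in A) dg e1 (t w) <= size_e e1.
Proof.
have := size_res (dom P0) s1; rewrite [X in _ <= _ + X]big1 ?addn0 => [|x]; last first.
  move=> xd; apply/eqP; rewrite cards_eq0; apply/eqP/setP => z; rewrite in_set0 in_setI inE.
  apply/negP => /andP[e /imsetP[q qP zE]]; move: xd => /imsetP[p pP xE].
  move: e; rewrite xE zE => e.
  case/attachP: pP e => [->|[w wA ->]]; case/attachP: qP => [->|[w' wA' ->]] /=.
  - by rewrite i1.
  - by have [_ /negbTE -> _] := tA wA'.
  - by rewrite s1; have [_ /negbTE -> _] := tA wA.
  - case: (eqVneq w w') => [->|/(tAA wA wA')[_ /negbTE -> //]]; by rewrite i1.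
rewrite attach_dom big_setU1 /=; last first.
  by apply/imsetP => -[w wA E]; have [] := tA wA; rewrite E eqxx.
rewrite big_imset /=; last first.
  move=> w w' wA wA' E; apply/eqP; case: (eqVneq w w') => // /(tAA wA wA')[].
  by rewrite E eqxx.
by rewrite mulnDr addnA.
Qed.

Lemma attach_r3 x : dg (res3 e1 e2 e3 P0) x <=
  dg e3 x + (if e1 x x1 then dg e2 u else 0) + \sum_(w in A | e1 x (t w)) dg e2 w.
Proof.
by have := dg_res3 e1 e3 s2 P0 x; rewrite (attach_sum (fun p => e1 x p.1) (fun p => dg e2 p.2)) /= addnA.
Qed.

Hypothesis nuA : nb e2 u \subset A.

Lemma attach_r3' y : dg (tr (res3 e1 e2 e3 P0)) y <=
  dg (tr e3) y + \sum_(w in A | e2 y w) dg e1 (t w).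
Proof.
case: (boolP (y \in cod P0)) => yP.
  suff -> : dg (tr (res3 e1 e2 e3 P0)) y = 0 by [].
  by apply/eqP; rewrite cards_eq0; apply/eqP/setP => x; rewrite !inE /tr /res3 yP andbF.
have := dg_res3' e2 e3 s1 P0 y; rewrite (attach_sum (fun p => e2 y p.2) (fun p => dg e1 p.1)) /=.
case: (boolP (e2 y u)) => [e|_]; last by rewrite add0n.
case/negP: yP; rewrite attach_cod in_setU1; apply/orP; right; apply: (subsetP nuA).
by rewrite inE s2.
Qed.

End Attach.

(** Pointwise: a vertex outside [F] has degree at least 2 unless it is a leaf, and the degree of a
    vertex in [F] pays for its leaf neighbours. *)
Lemma leaf_avoid (V : finType) (e : rel V) (F L : {set V}) : (forall x, 0 < dg e x) ->
  (forall x, (x \in L) = (dg e x == 1)) ->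
  2 * #|V| + \sum_(z in F) #|nb e z :&: L| <= size_e e + #|L| + 2 * #|F|.
Proof.
move=> pos hL.
have -> : 2 * #|V| = \sum_(z : V) 2 by rewrite sum_nat_const mulnC.
have -> : 2 * #|F| = \sum_z 2 * (z \in F).
  rewrite -sum1_card big_distrr big_mkcond /=; apply: eq_bigr => z _; by case: (z \in F).
have -> : #|L| = \sum_z (z \in L).
  by rewrite -sum1_card big_mkcond /=; apply: eq_bigr => z _; case: (z \in L).
rewrite [X in _ + X <= _]big_mkcond -!big_split /=; apply: leq_sum => z _.
have le : #|nb e z :&: L| <= dg e z by apply/subset_leq_card/subsetIl.
rewrite hL; have := pos z; move: le.
by case: (z \in F); case: (dg e z) => [|[|d]] //=; nlia.
Qed.

Definition far (V : finType) (e : rel V) (x : V) : {set V} := ~: (x |: nb e x).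
Definition low (V : finType) (e : rel V) (x : V) : {set V} := [set z in far e x | dg e z <= 8].

(** * A giant vertex *)

Section Far.
Variables (n : nat) (V1 V2 : finType) (e1 : rel V1) (e2 : rel V2) (e3 : V1 -> V2 -> bool).
Hypothesis tp : triple n e1 e2 e3.
Variable x1 : V1.
Local Notation R := (n - (dg e1 x1).+1).
Local Notation E := (size_e e1 - 2 * dg e1 x1).

Lemma far_codeg : dg e1 x1 + R + 1 = n.
Proof. by have := t_u1 tp x1; nlia. Qed.

Lemma far_codeg_pos : 0 < R.
Proof. by have := t_u1 tp x1; nlia. Qed.

Lemma far_excess : size_e e1 = 2 * dg e1 x1 + E /\ R <= E.
Proof. by have := far_codeg; have := size_ge1 tp x1; nlia. Qed.

Lemma card_far : #|far e1 x1| = R.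
Proof.
have := cardsC (x1 |: nb e1 x1); rewrite (t_n1 tp) cardsU1 inE (t_i1 tp) /= -/(far e1 x1) -/(dg e1 x1).
by have := far_codeg; nlia.
Qed.

(** [E] is the degree sum without the edges at [x1]. An edge leaving [far e1 x1] ends at a neighbour
    of [x1], so its other end is counted in [E] as well. *)
Lemma far_sum : \sum_(x in far e1 x1) dg e1 x + \sum_(x in far e1 x1) #|nb e1 x :\: far e1 x1| <= E.
Proof.
have [EE _] := far_excess.
have D : size_e e1 = \sum_(x in far e1 x1) dg e1 x + (dg e1 x1 + \sum_(x in nb e1 x1) dg e1 x).
  rewrite /size_e (bigID (mem (far e1 x1))) /=; congr (_ + _).
  rewrite (eq_bigl (mem (x1 |: nb e1 x1))) => [|x]; last by rewrite /= inE negbK.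
  by rewrite big_setU1 ?inE ?(t_i1 tp).
have h1 : \sum_(x in far e1 x1) #|nb e1 x :\: far e1 x1| = \sum_(x in nb e1 x1) #|nb e1 x :&: far e1 x1|.
  transitivity (\sum_(x in far e1 x1) #|nb e1 x :&: nb e1 x1|).
    apply: eq_bigr => x; rewrite !inE negb_or => /andP[xx nx]; apply: eq_card => z.
    rewrite !inE negbK; case e: (e1 x z); rewrite ?andbF ?andbT //=.
    by case: eqP => // zx; move: e nx; rewrite zx (t_s1 tp) => ->.
  rewrite double_count; apply: eq_bigr => x _; congr #|pred_of_set (_ :&: _)|.
  by apply/setP => z; rewrite !inE /tr (t_s1 tp).
have h2 : \sum_(x in nb e1 x1) #|nb e1 x :&: far e1 x1| + dg e1 x1 <= \sum_(x in nb e1 x1) dg e1 x.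
  rewrite /dg -[#|nb e1 x1|]sum1_card -big_split /=; apply: leq_sum => x; rewrite inE => xx.
  rewrite -[leqRHS](cardsID (far e1 x1)) leq_add2l card_gt0; apply/set0Pn; exists x1.
  by rewrite !inE eqxx (t_s1 tp).
by rewrite h1; nlia.
Qed.

Lemma sum_far : \sum_(x in far e1 x1) dg e1 x <= E.
Proof. exact: leq_trans (leq_addr _ _) far_sum. Qed.

Lemma other_deg x : x != x1 -> 2 * dg e1 x <= E + 2.
Proof.
by move=> xx; have := size_pair (t_s1 tp) (t_i1 tp) xx; have [] := far_excess; nlia.
Qed.

Lemma low_card : 9 * R <= E + 8 * #|low e1 x1|.
Proof.
have := sum_far; have := card_far.
have : 9 * #|far e1 x1| <= \sum_(x in far e1 x1) dg e1 x + 8 * #|low e1 x1|.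
  rewrite mulnC -sum_nat_const mulnC -sum_nat_const big_mkcond.
  rewrite [X in _ <= X + _]big_mkcond [X in _ <= _ + X]big_mkcond -big_split /=.
  apply: leq_sum => x _; rewrite [x \in low e1 x1]inE; case: (x \in far e1 x1) => //=.
  by have := t_l1 tp x; case: (leqP (dg e1 x) 8); nlia.
by nlia.
Qed.

End Far.

Lemma dg_res_in (V : finType) (A : {set V}) (e : rel V) x : x \in A -> dg (res A e) x = 0.
Proof.
by move=> xA; apply/eqP; rewrite cards_eq0; apply/eqP/setP => y; rewrite !inE /res xA andbF.
Qed.

(** * A giant in one graph only *)

Section Single.
Variables (n k : nat) (V1 V2 : finType) (e1 : rel V1) (e2 : rel V2) (e3 : V1 -> V2 -> bool).
Hypothesis tp : triple n e1 e2 e3.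
Hypotheses (hk : 102 <= k) (kn : 20 * (k * k) <= n) (kn' : n < 20 * (k.+1 * k.+1)).
Variable x1 : V1.
Hypothesis giant : 6 * n < 7 * (dg e1 x1 + 390 * k).
Hypothesis cogiant : forall y, 4 * dg e2 y <= 3 * n.

Let R := n - (dg e1 x1).+1.
Let E := size_e e1 - 2 * dg e1 x1.
Local Notation far := (far e1 x1).
Local Notation low := (low e1 x1).
Let R_eq : dg e1 x1 + R + 1 = n := far_codeg tp x1.
Let R_pos : 0 < R := far_codeg_pos tp x1.
Let E_eq : size_e e1 = 2 * dg e1 x1 + E /\ R <= E := far_excess tp x1.
Let card_far : #|far| = R := card_far tp x1.
Let sum_far : \sum_(x in far) dg e1 x <= E := sum_far tp x1.
Let other_deg x : x != x1 -> 2 * dg e1 x <= E + 2 := @other_deg _ _ _ _ _ _ tp x1 x.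
Let low_card : 9 * R <= E + 8 * #|low| := low_card tp x1.

Lemma R7 : 7 * R < n + 2730 * k.
Proof. by have := R_eq; move: giant; nlia. Qed.

Lemma F1 y : size_e e2 + E + 2 * size_e e3 + 2 * (dg (tr e3) y - 4) + 2 * C <= 2 * n + 4 + 4 * R.
Proof. by have := R_eq; have [] := E_eq; have := t_f1 tp x1 y; nlia. Qed.

Lemma F2 x y : size_e e2 + E + 2 * size_e e3 + 2 * (dg e2 y + (dg e3 x - 4)) + 2 * C <= 4 * n + 2 + 2 * R.
Proof. by have := R_eq; have [] := E_eq; have := t_f2 tp x y; nlia. Qed.

Lemma E4 y : E + 4 * dg (tr e3) y + 2 * C <= n + 14 + 4 * R.
Proof.
have [x0 _] := exV1 tp hk kn; have [y0 _] := exV2 tp hk kn.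
by have := F1 y; have := size_ge2 tp y0; have := t_l2 tp y0; have := size_ge_cross e3 x0 y; nlia.
Qed.

Section Core.
Variables (u : V2) (t : V2 -> V1) (A : {set V2}).
Hypothesis nxu : ~~ e3 x1 u.
Hypothesis uA : u \notin A.
Hypothesis tA : forall w, w \in A -> t w \in far /\ ~~ e3 (t w) w.
Hypothesis tAA : forall w w', w \in A -> w' \in A -> w != w' -> t w != t w' /\ ~~ e1 (t w) (t w').
Hypothesis nuA : nb e2 u \subset A.
Hypothesis cA : #|A| <= 3.
Local Notation P0 := (attach x1 u t A).
Local Notation r1 := (res (dom P0) e1).
Local Notation r2 := (res (cod P0) e2).
Local Notation r3 := (res3 e1 e2 e3 P0).
Let s := \sum_(w in A) dg e1 (t w).

Let tA' : forall w, w \in A -> [/\ t w != x1, ~~ e1 x1 (t w) & ~~ e3 (t w) w].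
Proof. by move=> w /tA[]; rewrite !inE negb_or => /andP[]. Qed.

(** [s] bounds the growth of a G3-degree on the V2 side. The two alternatives correspond to two
    choices of hosts: at most three of degree at most 8, or a single one of least degree in
    [far]. *)
Lemma single_core :
  s <= 24 \/ R * s <= E /\ 2 * s <= E + 2 ->
  (forall x, 12 * dg r3 x + size_e r2 + 12 * (390 * k) <= 12 * n) ->
  #|[set x | n < 8 * dg r3 x]| <= 35 -> #|[set y | n < 8 * dg (tr r3) y]| <= 35 ->
  fullpack e1 e2 e3.
Proof.
move=> K1 K2 K3 K4.
have t130 := tangent 130 kn; have t150 := tangent 150 kn; have t420 := tangent 420 kn.
have [RE RP] := (R_eq, R_pos); have [EE RlE] := E_eq; have r7 := R7.
have [y0 _] := exV2 tp hk kn.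
have r1x x : 2 * dg r1 x <= E + 2.
  have [->|xx] := eqVneq x x1.
    by rewrite dg_res_in //; apply/imsetP; exists (x1, u) => //; rewrite setU11.
  by have := dg_res (dom P0) e1 x; have := other_deg xx; nlia.
have r3y y : dg (tr r3) y <= dg (tr e3) y + s.
  have := attach_r3' e3 (t_s1 tp) (t_s2 tp) x1 t uA nuA y.
  by move/leq_trans; apply; rewrite leq_add2l big_mkcondr; apply: leq_sum => w _; case: ifP.
have sz : size_e r1 + 2 * s <= E.
  have := attach_size1 (t_s1 tp) (t_i1 tp) u tA' tAA.
  by rewrite -/s EE; nlia.
have s2 : 2 * s <= E + 48.
  by case: K1 => [h|[_ h]]; nlia.
apply: (pack_res_e0 tp hk kn kn' (P0 := P0)) => //.
- by apply: attach_okp => //; [exact: (t_s1 tp) | exact: (t_i1 tp)].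
- by rewrite attach_card //; nlia.
- by move=> x; have := r1x x; have := E4 y0; nlia.
- move=> y; have := dg_res (cod P0) e2 y; have := cogiant y; have := F2 x1 y; have := size_ge2 tp y.
  case: (leqP 182 k) => [h|h].
    by have : 3640 * k <= n; [move: h kn; clear; nia | nlia].
  have : n < 20 * (182 * 182) by apply: leq_trans kn' _; rewrite leq_mul2l /=; apply: leq_mul.
  by nlia.
- by move=> y; have := r3y y; have := E4 y; nlia.
- move=> x y; have := r3y y; have := r1x x; have := E4 y.
  case: K1 => [h|[h1 h2]]; first by nlia.
  case: (ltnP (28 * R) n) => h; first by nlia.
  have s36 : s <= 36.
    rewrite leqNgt; apply/negP => lt; have : R * 37 <= R * s by rewrite leq_mul2l lt orbT.
    by have := E4 y0; nlia.
  by nlia.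
by move=> y; have := r3y y; have := E4 y; nlia.
Qed.

End Core.

(** Hosts are taken from [low]; the margin 50 covers three of them together with their at most 8
    neighbours each. Only [v] may be heavy, so only the at most 8 neighbours of its host gain many
    conflicts. *)
Lemma single_attach u v :
  ~~ e3 x1 u -> dg e2 u <= 3 -> e2 u v -> (forall w, e2 u w -> w != v -> dg e2 w <= k) ->
  (forall w, e2 u w -> dg (tr e3) w + 50 <= #|low|) ->
  (forall x, x != x1 -> 12 * (dg e3 x + 3 + 2 * k + dg e2 v) + size_e e2 + 3 + 12 * (390 * k) <= 12 * n + 2 * dg e2 v) ->
  fullpack e1 e2 e3.
Proof.
move=> nxu u3 uv small hlow K2.
have [x0 _] := exV1 tp hk kn; have [y0 _] := exV2 tp hk kn; have n20 := n2040 hk kn.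
pose A := nb e2 u.
have uA : u \notin A by rewrite inE (t_i2 tp).
have [||t [t1 t2]] := @choose_hosts _ _ e1 e3 low 8 (enum A) x0 (t_s1 tp) _ (enum_uniq _).
- by move=> z; rewrite inE => /andP[].
- move=> w; rewrite mem_enum inE => uw; have := hlow w uw.
  by rewrite -cardE -/(dg e2 u); move: u3; rewrite /A; nlia.
have tA w : w \in A -> t w \in far /\ ~~ e3 (t w) w.
  by rewrite -mem_enum => /t1[]; rewrite inE => /andP[].
have tA' w : w \in A -> [/\ t w != x1, ~~ e1 x1 (t w) & ~~ e3 (t w) w].
  by move=> /tA[]; rewrite !inE negb_or => /andP[].
have t8 w : w \in A -> dg e1 (t w) <= 8.
  by rewrite -mem_enum => /t1[]; rewrite inE => /andP[].
have tAA w w' : w \in A -> w' \in A -> w != w' -> t w != t w' /\ ~~ e1 (t w) (t w').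
  by move=> wA wA'; apply: t2; rewrite mem_enum.
have cA : #|A| <= 3 := u3.
have vA : v \in A by rewrite inE.
pose P0 := attach x1 u t A.
have s24 (Q : pred V2) : \sum_(w in A | Q w) dg e1 (t w) <= 24.
  apply: leq_trans (_ : \sum_(w in A) 8 <= _); last by rewrite sum_nat_const; nlia.
  by rewrite big_mkcondr; apply: leq_sum => w wA; case: ifP => // _; apply: t8.
have sk (Q : pred V2) : \sum_(w in A | Q w) dg e2 w <= 2 * k + (if Q v then dg e2 v else 0).
  rewrite big_mkcondr (big_setD1 v) //= addnC; apply: leq_add => //.
  apply: leq_trans (_ : \sum_(w in A :\ v) k <= _).
    apply: leq_sum => w; rewrite in_setD1 => /andP[wv wA]; case: ifP => // _.
    by apply: small => //; move: wA; rewrite inE.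
  rewrite sum_nat_const leq_mul2r; apply/orP; right.
  by have := cardsD1 v A; rewrite vA; nlia.
have r3x x : dg (res3 e1 e2 e3 P0) x <= dg e3 x + 3 + 2 * k + (if e1 x (t v) then dg e2 v else 0).
  have h := attach_r3 e1 e3 (t_s2 tp) x1 t uA x.
  have := sk (fun w => e1 x (t w)); rewrite /= => h2.
  by move: h h2 u3; rewrite -/P0; do 2 case: ifP => _; nlia.
have r3y y : dg (tr (res3 e1 e2 e3 P0)) y <= dg (tr e3) y + 24.
  have := attach_r3' e3 (t_s1 tp) (t_s2 tp) x1 t uA (subxx _) y.
  by have := s24 (fun w => e2 y w); rewrite -/P0; nlia.
have sz2 : size_e (res (cod P0) e2) + 2 * dg e2 v <= size_e e2 + 3.
  have := size_res (cod P0) (t_s2 tp).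
  have vc : v \in cod P0 by rewrite attach_cod in_setU1 vA orbT.
  rewrite (big_setD1 v) //= [X in _ <= _ + X](big_setD1 v) //=.
  have h1 : \sum_(y in cod P0 :\ v) #|nb e2 y :&: cod P0| <= \sum_(y in cod P0 :\ v) dg e2 y.
    by apply: leq_sum => y _; apply/subset_leq_card/subsetIl.
  have h2 : #|nb e2 v :&: cod P0| <= 3.
    apply: leq_trans (_ : #|cod P0 :\ v| <= _).
      apply/subset_leq_card/subsetP => y; rewrite in_setI in_setD1 inE => /andP[e ->].
      by rewrite andbT; apply: contraTneq e => ->; rewrite (t_i2 tp).
    by have := cardsD1 v (cod P0); rewrite vc attach_cod cardsU1 uA; move: cA; nlia.
  by rewrite mulnDr; nlia.
have s24' : \sum_(w in A) dg e1 (t w) <= 24.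
  by apply: leq_trans (s24 xpredT); apply/eq_leq/eq_bigl => w; rewrite andbT.
apply: (single_core nxu uA tA tAA (subxx _) cA) => //; first by left.
- move=> x; rewrite -/P0; have [->|xx] := eqVneq x x1.
    have -> : dg (res3 e1 e2 e3 P0) x1 = 0.
      by apply: dg_res3_0; apply/imsetP; exists (x1, u) => //; rewrite setU11.
    by have := F1 y0; have [] := E_eq; have := R_eq; have := R7; nlia.
  by have := r3x x; have := K2 x xx; case: ifP => _; nlia.
- apply: (@leq_trans (8 + 17)) => //.
  apply: (@count_heavy _ _ (dg e3) (nb e1 (t v)) n 8 (2 * n) (n %/ 8 - (3 + 2 * k))) => //.
  + move=> x; rewrite inE (t_s1 tp) => ux h; have := r3x x; rewrite (negbTE ux) => h3; rewrite -/P0 in h.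
    have : n %/ 8 < (dg e3 x + 3 + 2 * k).+1 by rewrite ltn_divLR // mulnC; nlia.
    by nlia.
  + exact: t8.
  + by have := e3_le tp hk kn kn' x0; rewrite -/(size_e e3); nlia.
  + by have := divn_eq n 8; have := ltn_mod n 8; nlia.
- apply: (@leq_trans (0 + 17)) => //.
  apply: (@count_heavy _ _ (dg (tr e3)) set0 n 0 (2 * n) (n %/ 8 - 24)) => //.
  + move=> x _ h; have h3 := r3y x; rewrite -/P0 in h.
    have : n %/ 8 < (dg (tr e3) x + 24).+1 by rewrite ltn_divLR // mulnC; nlia.
    by nlia.
  + by rewrite cards0.
  + by rewrite -/(size_e (tr e3)) size_e_tr; have := e3_le tp hk kn kn' x0; nlia.
  + by have := divn_eq n 8; have := ltn_mod n 8; nlia.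
Qed.

(** A large excess [E] leaves [size_e e2 + 2 * size_e e3] so far below [2 * n] that [leaf_star]
    finds many vertices [v] carrying a leaf [u], both without edges in G3. The giant goes to [u],
    and [v] to a vertex [t] of least degree in [far]. *)
Lemma single_giant_dense : 4 * R <= E + C -> fullpack e1 e2 e3.
Proof.
move=> hA.
have [x0 _] := exV1 tp hk kn; have [y0 _] := exV2 tp hk kn; have n20 := n2040 hk kn.
have [RE RP] := (R_eq, R_pos); have [EE RlE] := E_eq; have r7 := R7.
pose m := (E + 2 * C - 4 - 4 * R) %/ 2.
have hm : 2 * m + 4 + 4 * R <= E + 2 * C.
  by have := leq_trunc_div (E + 2 * C - 4 - 4 * R) 2; rewrite -/m mulnC; nlia.
have hm2 : E + 2 * C <= 2 * m + 5 + 4 * R.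
  by have := divn_eq (E + 2 * C - 4 - 4 * R) 2; have := ltn_mod (E + 2 * C - 4 - 4 * R) 2; rewrite -/m mulnC; nlia.
have hF y := F1 y.
have hle : size_e e2 + 2 * size_e e3 + C <= 2 * n + 4 by have := hF y0; nlia.
pose G := [set s in [set: V2] | (dg (tr e3) s == 0) &&
   [exists t in [set: V2], [&& e2 s t, dg e2 t == 1 & dg (tr e3) t == 0]]].
have cG : m <= #|G|.
  apply: leaf_star (t_s2 tp) (t_l2 tp) _.
  rewrite [X in _ + X + _ + _]big1 => [|x _]; last first.
    by apply/eqP; rewrite cards_eq0 setDT.
  have -> : \sum_(x in [set: V2]) dg e2 x = size_e e2 by apply: eq_bigl => x; rewrite inE.
  have -> : \sum_(x in [set: V2]) dg (tr e3) x = size_e e3.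
    by rewrite -size_e_tr; apply: eq_bigl => x; rewrite inE.
  by rewrite cardsT (t_n2 tp); have := hF y0; nlia.
have G0 : 0 < #|G| by nlia.
case/card_gt0P: G0 => v0 v0G.
(* By minimality [(dg e2 v - 1) * #|G|] is at most the surplus of [size_e e2] over [n], so [v] is
   small because [G] is large. *)
case: (arg_minnP (dg e2) v0G) => v vG minv.
have {}vG : v \in G := vG.
have gv : dg e2 v * #|G| + n <= size_e e2 + #|G|.
  have := size_pos G (t_l2 tp); have := @sum_card_mul _ G (dg e2) (dg e2 v) minv.
  by rewrite (t_n2 tp); nlia.
move: (vG); rewrite !inE /= => /andP[/eqP v3 /existsP[u /and4P[_ vu /eqP u1 /eqP u3]]].
have nuA : nb e2 u \subset [set v].
  have /cards1P[z zE] : #|nb e2 u| == 1 by rewrite -/(dg e2 u) u1.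
  have : v \in nb e2 u by rewrite inE (t_s2 tp).
  by rewrite zE inE => /eqP ->.
have uA : u \notin [set v] by rewrite inE; apply: contraTneq vu => ->; rewrite (t_i2 tp).
have no3 w z : dg (tr e3) w = 0 -> ~~ e3 z w.
  move/eqP; rewrite cards_eq0 => /eqP/setP/(_ z); by rewrite !inE /tr => ->.
have : 0 < #|far| by rewrite card_far.
case/card_gt0P => t0 t0f.
case: (arg_minnP (dg e1) t0f) => t tf mint.
have {}tf : t \in far := tf.
have Rt : R * dg e1 t <= E.
  by rewrite mulnC; have := @sum_card_mul _ far (dg e1) (dg e1 t) mint; have := sum_far; rewrite card_far; nlia.
have tx1 : t != x1 by move: tf; rewrite !inE negb_or => /andP[].
have ot := other_deg tx1.
pose A := [set v]; pose P0 := attach x1 u (fun=> t) A.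
have d2v : 9 * 999 * (dg e2 v - 1) <= n.
  have : (dg e2 v - 1) * (9 * 999) <= (dg e2 v - 1) * #|G|.
    by rewrite leq_mul2l; apply/orP; right; apply: leq_trans cG; nlia.
  by rewrite mulnBl mul1n; nlia.
have sA (Q : pred V2) (f : V2 -> nat) : \sum_(w in A | Q w) f w = if Q v then f v else 0.
  by rewrite big_mkcondr big_set1.
have r3x x : dg (res3 e1 e2 e3 P0) x <= dg e3 x + 1 + dg e2 v.
  have := attach_r3 e1 e3 (t_s2 tp) x1 (fun=> t) uA x.
  by rewrite (sA (fun w => e1 x t) (dg e2)) u1 -/P0; do 2 case: ifP => _; nlia.
have r3y y : dg (tr (res3 e1 e2 e3 P0)) y <= dg (tr e3) y + (if e2 y v then dg e1 t else 0).
  have := attach_r3' e3 (t_s1 tp) (t_s2 tp) x1 (fun=> t) uA nuA y.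
  by rewrite (sA (fun w => e2 y w) (fun=> dg e1 t)).
have gy := size_ge2 tp y0; have ly := t_l2 tp y0.
apply: (single_core (u := u) (t := fun=> t) (A := A)) => //.
- exact: no3.
- by move=> w; rewrite inE => /eqP ->; split=> //; apply: no3.
- by move=> w w'; rewrite !inE => /eqP -> /eqP ->; rewrite eqxx.
- by rewrite cards1.
- by right; rewrite big_set1.
- move=> x; have := r3x x; have := size_res_le (cod P0) e2; have := size_ge_cross e3 x y0.
  by rewrite -/P0; have := tangent 130 kn; nlia.
- apply: (@leq_trans (0 + 17)) => //.
  apply: (@count_heavy _ _ (dg e3) set0 n 0 (2 * n) (n %/ 8 - (1 + dg e2 v))) => //.
  + move=> x _ h; have h3 := r3x x; rewrite -/P0 in h.
    have : n %/ 8 < (dg e3 x + 1 + dg e2 v).+1 by rewrite ltn_divLR // mulnC; nlia.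
    by nlia.
  + by rewrite cards0.
  + by have := e3_le tp hk kn kn' x0; rewrite -/(size_e e3); nlia.
  + by have := divn_eq n 8; have := ltn_mod n 8; nlia.
(* If even the minimum [dg e1 t] is large, then [R <= 11] and [E] is large, hence so is [G]. Then
   [v] has at most 10 neighbours, and only these can gain G3-degree. *)
case: (leqP (10 * dg e1 t) n) => ht.
  apply: (@leq_trans (0 + 21)) => //.
  apply: (@count_heavy _ _ (dg (tr e3)) set0 n 0 (n %/ 2) (n %/ 40)) => //.
  + move=> y _ h; have := r3y y; rewrite -/P0 in h => h3.
    have : n %/ 40 < (dg (tr e3) y).+1.
      by rewrite ltn_divLR // mulnC; move: h3; case: ifP => _; nlia.
    by nlia.
  + by rewrite cards0.
  + by rewrite -/(size_e (tr e3)) size_e_tr leq_divRL // mulnC; nlia.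
  + by have := divn_eq n 40; have := ltn_mod n 40; have := divn_eq n 2; nlia.
have R11 : R <= 11.
  rewrite leqNgt; apply/negP => lt; have e4 := E4 y0.
  have a1 : R * n <= R * (10 * dg e1 t) by rewrite leq_mul2l (ltnW ht) orbT.
  have a2 : R * n = R * (n - 40) + R * 40 by rewrite -mulnDr subnK //; nlia.
  have a3 : 12 * (n - 40) <= R * (n - 40) by rewrite leq_mul2r lt orbT.
  by rewrite mulnCA in a1; nlia.
have dG : dg e1 t <= #|G| by apply: leq_trans cG; nlia.
have v10 : dg e2 v <= 10.
  rewrite leqNgt; apply/negP => lt.
  have : 11 * #|G| <= dg e2 v * #|G| by rewrite leq_mul2r lt orbT.
  by nlia.
apply: (@leq_trans (10 + 4)) => //.
apply: (@count_heavy _ _ (dg (tr e3)) (nb e2 v) n 10 (n %/ 2) (n %/ 8)) => //.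
+ move=> y; rewrite inE (t_s2 tp) => yv h; have := r3y y; rewrite (negbTE yv) -/P0 in h * => h3.
  have : n %/ 8 < (dg (tr e3) y).+1 by rewrite ltn_divLR // mulnC; nlia.
  by nlia.
+ by rewrite -/(size_e (tr e3)) size_e_tr leq_divRL // mulnC; nlia.
+ by have := divn_eq n 8; have := ltn_mod n 8; have := divn_eq n 2; nlia.
Qed.

Lemma F1e y (A : {set V2}) : size_e e2 + E + 2 * (dg (tr e3) y - 4) + 2 * C +
   2 * (dg e3 x1 + \sum_(w in A) dg (tr e3) w) <= 2 * n + 4 + 4 * R + 2 * #|A|.
Proof.
by have := F1 y; have := e3_sets e3 [set x1] A; rewrite big_set1 cards1 mul1n; nlia.
Qed.

(** A small excess makes [low] large. [Full] collects the vertices with too many G3-neighbours to be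
    hosted there. If one exists, its edges use up so much of F that some leaf of G2 is compatible
    with [x1] and hangs on a vertex outside [Full]. If none exists, the weights of the hosting
    argument, taken in G2, supply a vertex of degree at most 3 with at most one heavy neighbour. *)
Lemma single_giant_sparse : E + C < 4 * R -> fullpack e1 e2 e3.
Proof.
move=> hB.
have [x0 _] := exV1 tp hk kn; have [y0 _] := exV2 tp hk kn; have n20 := n2040 hk kn.
have [RE RP] := (R_eq, R_pos); have [EE RlE] := E_eq; have r7 := R7.
have lowc := low_card.
pose Full := [set w | #|low| < dg (tr e3) w + 50].
have [Full0|[z zF]] := set_0Vmem Full; last first.
  pose L := [set y | dg e2 y == 1].
  have hL x : (x \in L) = (dg e2 x == 1) by rewrite inE.
  have zlow : #|low| < dg (tr e3) z + 50 by move: zF; rewrite inE.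
  have cF : 0 < #|Full| by apply/card_gt0P; exists z.
  have [[u [v [u1 nxu uv vF]]]|no] := classic (exists u v, [/\ dg e2 u = 1, ~~ e3 x1 u, e2 u v & v \notin Full]).
    have uniqv w : e2 u w -> w = v.
      have /cards1P[q qE] : #|nb e2 u| == 1 by rewrite -/(dg e2 u) u1.
      move=> uw; have : w \in nb e2 u by rewrite inE.
      have : v \in nb e2 u by rewrite inE.
      by rewrite qE !inE => /eqP -> /eqP ->.
    apply: (single_attach nxu _ uv) => [|w /uniqv ->|w /uniqv ->|x xx].
    - by rewrite u1.
    - by rewrite eqxx.
    - by move: vF; rewrite inE -leqNgt.
    have := F2 x v; have := size_ge_cross e3 x z; have := size_ge2 tp v; have := cogiant v.
    by have := tangent 240 kn; nlia.
  exfalso.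
  have la := leaf_avoid Full (t_l2 tp) hL.
  (* Otherwise every leaf is joined to [x1] in G3 or hangs on [Full]. *)
  have cL : #|L| <= dg e3 x1 + \sum_(w in Full) #|nb e2 w :&: L|.
    apply: leq_trans (leq_add (leqnn _) (leq_card_bigcup _ _)).
    apply: leq_trans (leq_card_setU _ _); apply/subset_leq_card/subsetP => u uL.
    rewrite in_setU inE; case: (boolP (e3 x1 u)) => //= nxu.
    have u1 : dg e2 u = 1 by move: uL; rewrite hL => /eqP.
    have /card_gt0P[v] : 0 < #|nb e2 u| by rewrite -/(dg e2 u) u1.
    rewrite inE => uv; apply/bigcupP; exists v; last by rewrite in_setI uL inE (t_s2 tp) uv.
    by apply/negPn/negP => vF; apply: no; exists u, v.
  have f1 := F1e z Full.
  have sF : (#|low| - 49) * #|Full| <= \sum_(w in Full) dg (tr e3) w.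
    by apply: sum_card_mul => w; rewrite inE; nlia.
  have l51 : 151 <= #|low| by nlia.
  have := size_ge_cross e3 x1 z; rewrite (t_n2 tp) in la.
  move: sF cF l51; case: #|Full| f1 la => [|f] // f1 la; rewrite mulnS => sF _ l51 _.
  have : 102 * f <= (#|low| - 49) * f by rewrite leq_mul2r; apply/orP; right; nlia.
  by nlia.
have hlow w : dg (tr e3) w + 50 <= #|low|.
  have : w \notin Full by rewrite Full0 inE.
  by rewrite inE -leqNgt.
have D2h : size_e e2 + 2 * size_e e3 + 2 * C <= 2 * n + 4 + 3 * R by have := F1 y0; nlia.
have hH : #|H1 e2 k| <= 120 * k + 119.
  have := size_e_count e2 k.+1; rewrite -/(H1 e2 k) => h1.
  suff : #|H1 e2 k| * k.+1 < 120 * k.+1 * k.+1 by rewrite ltn_mul2r /=; nlia.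
  by have := F1 y0; move: h1 kn' RE; clear; nlia.
have t130 := tangent 130 kn.
have gy := size_ge2 tp y0; have ly := t_l2 tp y0.
have [[u [uH nxu u3 uN]]|no] := classic (exists u, [/\ u \notin H1 e2 k, ~~ e3 x1 u, dg e2 u <= 3 & nb e2 u :&: H1 e2 k = set0]).
  have /card_gt0P[v] : 0 < #|nb e2 u| by exact: t_l2 tp u.
  rewrite inE => uv.
  have small w : e2 u w -> dg e2 w <= k.
    move=> uw; rewrite leqNgt; apply/negP => lt; move/setP: uN => /(_ w).
    by rewrite !inE uw lt.
  apply: (single_attach nxu u3 uv) => [w /small //|w _|x xx]; first exact: hlow.
  by have := size_ge_cross e3 x y0; have := small v uv; nlia.
pose N3 := nb e3 x1.
have wtsum := sum_wt (t_s2 tp) k.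
pose Z := ~: H1 e2 k :\: N3.
have split2 : \sum_(u in ~: H1 e2 k) wt e2 k u = \sum_(u in ~: H1 e2 k :&: N3) wt e2 k u + \sum_(u in Z) wt e2 k u.
  by rewrite (big_setID N3).
have cZ : #|~: H1 e2 k :&: N3| + #|Z| = #|~: H1 e2 k| by rewrite cardsID.
have cH : #|~: H1 e2 k| + #|H1 e2 k| = n by rewrite addnC cardsC (t_n2 tp).
have cN : #|~: H1 e2 k :&: N3| <= dg e3 x1 by apply/subset_leq_card/subsetIr.
have w1 : #|~: H1 e2 k :&: N3| <= \sum_(u in ~: H1 e2 k :&: N3) wt e2 k u.
  rewrite -sum1_card; apply: leq_sum => u _; apply: leq_trans (wt_ge e2 k u); exact: t_l2 tp u.
(* A vertex of [Z] has a heavy neighbour or degree at least 4. This pushes [size_e e2] up to almost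
   [2 * n], a lower bound that the final estimate relies on. *)
have w2 : 2 * #|Z| <= \sum_(u in Z) wt e2 k u.
  apply: sum_card_mul => u; rewrite in_setD in_setC => /andP[uN uH].
  have [e|ne] := eqVneq (nb e2 u :&: H1 e2 k) set0; last first.
    by move: ne; rewrite -card_gt0 /wt; nlia.
  have d4 : 3 < dg e2 u.
    by rewrite ltnNge; apply/negP => le; apply: no; exists u; split=> //; move: uN; rewrite inE.
  by have := wt_ge e2 k u; nlia.
have D2low : 2 * n <= size_e e2 + 2 * #|H1 e2 k| + dg e3 x1 by nlia.
have [u uZ uw] : exists2 u, u \in Z & wt e2 k u <= 3.
  case: (pickP [pred u in Z | wt e2 k u <= 3]) => [u /andP[]|none]; first by exists u.
  have w4 : 4 * #|Z| <= \sum_(u in Z) wt e2 k u.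
    by apply: sum_card_mul => u uZ; have := none u; rewrite /= uZ /= ltnNge => ->.
  by exfalso; have := size_ge_cross e3 x1 y0; have := t_u31 tp x1; nlia.
move: uZ; rewrite in_setD in_setC => /andP[uN uH].
have nxu : ~~ e3 x1 u by move: uN; rewrite inE.
have u3 : dg e2 u <= 3 by apply: leq_trans (wt_ge e2 k u) uw.
have gu : good e2 k u by rewrite /good uH.
have [v vI] : exists v, v \in nb e2 u :&: H1 e2 k.
  by apply/set0Pn/negP => /eqP e; apply: no; exists u.
have uv : e2 u v by move: vI; rewrite in_setI inE => /andP[].
have small w : e2 u w -> w != v -> dg e2 w <= k.
  move=> e wv; rewrite leqNgt; apply/negP => lt; case/negP: wv; apply/eqP.
  have : #|nb e2 u :&: H1 e2 k| <= 1 by move: uw; rewrite /wt; nlia.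
  move/card_le1_eqP => h; apply: h => //.
  by rewrite in_setI !inE e.
apply: (single_attach nxu u3 uv small) => [w _|x xx]; first exact: hlow.
have x1x := e3_two (tr e3) xx; rewrite size_e_tr in x1x.
have := F2 x v; have := cogiant v; have := tangent 280 kn.
by rewrite -[dg (tr (tr e3)) x]/(dg e3 x) -[dg (tr (tr e3)) x1]/(dg e3 x1) in x1x; nlia.
Qed.

Theorem single_giant : fullpack e1 e2 e3.
Proof. by case: (leqP (4 * R) (E + C)) => h; [apply: single_giant_dense | apply: single_giant_sparse]. Qed.

End Single.

(** * Giant vertices in both graphs *)

Section Both.
Variables (n k : nat) (V1 V2 : finType) (e1 : rel V1) (e2 : rel V2) (e3 : V1 -> V2 -> bool).
Hypothesis tp : triple n e1 e2 e3.
Hypotheses (hk : 102 <= k) (kn : 20 * (k * k) <= n) (kn' : n < 20 * (k.+1 * k.+1)).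
Variables (x1 : V1) (y1 : V2).
Local Notation R1 := (n - (dg e1 x1).+1).
Local Notation E1 := (size_e e1 - 2 * dg e1 x1).
Local Notation R2 := (n - (dg e2 y1).+1).
Local Notation E2 := (size_e e2 - 2 * dg e2 y1).
Hypothesis hR1 : 20 * R1 <= 5 * n + C.
Hypothesis hR2 : 20 * R2 <= 5 * n + C.

Lemma both_q1 : E1 + E2 + 2 * size_e e3 + 2 * dg (tr e3) y1 + 2 * C <= 4 * R1 + 2 * R2 + 14.
Proof.
have := t_f1 tp x1 y1; have := far_codeg tp x1; have := far_codeg (triple_sw tp) y1.
by have [] := far_excess tp x1; have [] := far_excess (triple_sw tp) y1; nlia.
Qed.

Lemma both_q2 : E1 + E2 + 2 * size_e e3 + 2 * dg e3 x1 + 2 * C <= 2 * R1 + 4 * R2 + 14.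
Proof.
have := t_f2 tp x1 y1; have := far_codeg tp x1; have := far_codeg (triple_sw tp) y1.
by have [] := far_excess tp x1; have [] := far_excess (triple_sw tp) y1; nlia.
Qed.

Variable z : V1.
Hypotheses (z1 : dg e1 z = 1) (zx1 : e1 x1 z) (zy1 : ~~ e3 z y1).

Section Core.
Variables (u : V2) (t : V2 -> V1) (A : {set V2}).
Hypothesis nxu : ~~ e3 x1 u.
Hypothesis uA : u \notin A.
Hypothesis uy : u \in far e2 y1.
Hypothesis tA : forall w, w \in A -> t w \in far e1 x1 /\ ~~ e3 (t w) w.
Hypothesis tAA : forall w w', w \in A -> w' \in A -> w != w' -> t w != t w' /\ ~~ e1 (t w) (t w').
Hypothesis nuA : nb e2 u = A.
Hypothesis cA : #|A| <= 3.
Let s := \sum_(w in A) dg e1 (t w).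
(** The giant [y1] goes to a leaf [z] of [x1]. The only neighbour of [z] is itself placed, so this
    pair adds no conflict for unplaced vertices of V1, and it tolerates [(x1, u)] since [u] is not
    adjacent to [y1]. *)
Definition both_pl : {set V1 * V2} := (z, y1) |: attach x1 u t A.
Local Notation P0 := both_pl.
Local Notation r1 := (res (dom P0) e1).
Local Notation r2 := (res (cod P0) e2).
Local Notation r3 := (res3 e1 e2 e3 P0).

Let tA' : forall w, w \in A -> [/\ t w != x1, ~~ e1 x1 (t w) & ~~ e3 (t w) w].
Proof. by move=> w /tA[]; rewrite !inE negb_or => /andP[]. Qed.

Let znb w : e1 w z -> w = x1.
Proof.
have /cards1P[q qE] : #|nb e1 z| == 1 by rewrite -/(dg e1 z) z1.
move=> wz; have : w \in nb e1 z by rewrite inE (t_s1 tp).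
have : x1 \in nb e1 z by rewrite inE (t_s1 tp).
by rewrite qE !inE => /eqP -> /eqP ->.
Qed.

Let yA : y1 \notin A.
Proof. by move: uy; rewrite -nuA !inE negb_or (t_s2 tp) => /andP[]. Qed.

Let uy1 : u != y1.
Proof. by move: uy; rewrite !inE negb_or => /andP[]. Qed.

Let zdom : z \notin dom (attach x1 u t A).
Proof.
rewrite attach_dom in_setU1 negb_or; apply/andP; split.
  by apply: contraTneq zx1 => ->; rewrite (t_i1 tp).
by apply/imsetP => -[w /tA'[_ h _] E]; move: h; rewrite -E zx1.
Qed.

Let ycod : y1 \notin cod (attach x1 u t A).
Proof. by rewrite attach_cod in_setU1 negb_or eq_sym uy1. Qed.

Let okA : okp e1 e2 e3 (attach x1 u t A).
Proof. by apply: attach_okp => //; [exact: (t_s1 tp) | exact: (t_i1 tp)]. Qed.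

Let okP0 : okp e1 e2 e3 P0.
Proof.
apply: okp_ext => //; [exact: (t_s1 tp) | exact: (t_s2 tp) | exact: (t_i1 tp) |].
apply/negP => /confP[|[p pP [ep ep']]]; first by apply/negP.
have : p.1 = x1 by apply: znb; rewrite (t_s1 tp).
case/attachP: pP ep ep' => [-> /= _ e _|[w wA ->] /= _ _ E].
  by move: uy; rewrite !inE negb_or e andbF.
by have [h _ _] := tA' wA; rewrite E eqxx in h.
Qed.

Let y1c : y1 \in cod P0. Proof. by rewrite /P0 /cod imsetU1 setU11. Qed.
Let x1d : x1 \in dom P0.
Proof. by apply/imsetP; exists (x1, u) => //; rewrite in_setU1 in_setU1 eqxx orbT. Qed.

Let size_res_mono (V : finType) (S S' : {set V}) (e : rel V) : S \subset S' ->
  size_e (res S' e) <= size_e (res S e).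
Proof.
move=> /subsetP sS; apply: leq_sum => x _; apply: leq_dg => y /and3P[e0 h1 h2].
by apply/and3P; split=> //; [apply: contra h1 | apply: contra h2]; apply: sS.
Qed.

Let sz1 : size_e r1 + 2 * s <= E1.
Proof.
have := attach_size1 (t_s1 tp) (t_i1 tp) u tA' tAA; rewrite -/s.
have : size_e r1 <= size_e (res (dom (attach x1 u t A)) e1).
  by apply/size_res_mono/imsetS/subsetUr.
by have [] := far_excess tp x1; nlia.
Qed.

Let sz2 : size_e r2 <= E2.
Proof.
have : size_e r2 <= size_e (res [set y1] e2).
  by apply: size_res_mono; rewrite sub1set.
have := size_res [set y1] (t_s2 tp); rewrite !big_set1.
have -> : nb e2 y1 :&: [set y1] = set0.
  by apply/setP => w; rewrite !inE; case: eqP => [->|]; rewrite ?(t_i2 tp) ?andbF.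
by rewrite cards0; have [] := far_excess (triple_sw tp) y1; nlia.
Qed.

Let sumP (Q : pred (V1 * V2)) (f : V1 * V2 -> nat) :
  \sum_(p in P0 | Q p) f p = (if Q (z, y1) then f (z, y1) else 0) +
     ((if Q (x1, u) then f (x1, u) else 0) + \sum_(w in A | Q (t w, w)) f (t w, w)).
Proof.
rewrite big_mkcondr big_setU1 /=; last by apply: contra zdom => /mem_dom.
by congr (_ + _); rewrite -big_mkcondr attach_sum.
Qed.

Lemma both_r3 x : dg r3 x <= dg e3 x + dg e2 u + \sum_(w in A | e1 x (t w)) dg e2 w.
Proof.
case: (boolP (x \in dom P0)) => [xd|xd]; first by rewrite dg_res3_0.
have := dg_res3 e1 e3 (t_s2 tp) P0 x; rewrite (sumP (fun p => e1 x p.1) (fun p => dg e2 p.2)) /=.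
case: (boolP (e1 x z)) => [/znb xx|_]; first by rewrite xx x1d in xd.
by case: ifP => _; nlia.
Qed.

Lemma both_r3' y : dg (tr r3) y <= dg (tr e3) y + 1 + \sum_(w in A | e2 y w) dg e1 (t w).
Proof.
case: (boolP (y \in cod P0)) => yP.
  suff -> : dg (tr r3) y = 0 by [].
  by apply/eqP; rewrite cards_eq0; apply/eqP/setP => x; rewrite !inE /tr /res3 yP andbF.
have := dg_res3' e2 e3 (t_s1 tp) P0 y; rewrite (sumP (fun p => e2 y p.2) (fun p => dg e1 p.1)) /=.
case: (boolP (e2 y u)) => [e|_].
  case/negP: yP; rewrite /P0 /cod imsetU1 -/(cod (attach x1 u t A)) attach_cod !in_setU1 -nuA.
  by rewrite inE (t_s2 tp) e !orbT.
by rewrite z1; case: ifP => _; nlia.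
Qed.

Lemma both_core : 2 * s <= E1 + 48 ->
  (forall x, 12 * dg r3 x + size_e r2 + 12 * (390 * k) <= 12 * n) ->
  #|[set x | n < 8 * dg r3 x]| <= 35 -> #|[set y | n < 8 * dg (tr r3) y]| <= 35 ->
  fullpack e1 e2 e3.
Proof.
move=> K1 K2 K3 K4.
have q1 := both_q1; have q2 := both_q2; have n20 := n2040 hk kn.
have r3y y : dg (tr r3) y <= dg (tr e3) y + 1 + s.
  apply: leq_trans (both_r3' y) _; rewrite leq_add2l.
  by rewrite big_mkcondr; apply: leq_sum => w _; case: ifP.
have [_ RE1] := far_excess tp x1; have [_ RE2] := far_excess (triple_sw tp) y1.
have r1x x : 2 * dg r1 x <= E1 + 2.
  have [->|xx] := eqVneq x x1; first by rewrite dg_res_in.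
  by have := dg_res (dom P0) e1 x; have := other_deg tp xx; nlia.
have r2y y : 2 * dg r2 y <= E2 + 2.
  have [->|xx] := eqVneq y y1; first by rewrite dg_res_in.
  by have := dg_res (cod P0) e2 y; have := other_deg (triple_sw tp) xx; nlia.
have e3y y : dg (tr e3) y <= size_e e3.
  by have := e3_sets e3 set0 [set y]; rewrite big_set0 big_set1 cards0 mul0n; nlia.
have t130 := tangent 130 kn.
apply: (pack_res_e0 tp hk kn kn' (P0 := P0)) => //.
- rewrite /P0 cardsU1 attach_card //; case: (_ \notin _); nlia.
- by move=> x; have := r1x x; nlia.
- by move=> y; have := r2y y; nlia.
- by move=> y; have := r3y y; have := e3y y; nlia.
- by move=> x y; have := r3y y; have := r1x x; have := e3y y; move: sz1; nlia.
by move=> y; have := r3y y; have := e3y y; move: sz1; nlia.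
Qed.

Lemma both_size2 : size_e r2 <= E2. Proof. exact: sz2. Qed.

End Core.
(** Here [leaf_star] is applied inside [far e2 y1] and yields a leaf [u] with neighbour [v], both
    without edges in G3; [v] is hosted at a vertex [t] of least degree in [far e1 x1]. *)
Lemma regime1 : E2 + 2 * size_e e3 + 2 <= 2 * R2 -> fullpack e1 e2 e3.
Proof.
move=> hR.
have tp' := triple_sw tp; have n20 := n2040 hk kn; have q1 := both_q1; have q2 := both_q2.
have [_ RE1] := far_excess tp x1; have [_ RE2] := far_excess tp' y1.
have RP1 := far_codeg_pos tp x1; have RP2 := far_codeg_pos tp' y1.
have cf1 := card_far tp x1; have cf2 := card_far tp' y1.
have Cn : C <= 3 * n by have [x0 _] := exV1 tp hk kn; have [y0 _] := exV2 tp hk kn;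
  have := size_ge1 tp x0; have := size_ge2 tp y0; have := t_f1 tp x0 y0; nlia.
pose m := (2 * R2 - E2 - 2 * size_e e3) %/ 2.
have hm : 2 * m + E2 + 2 * size_e e3 <= 2 * R2.
  by have := leq_trunc_div (2 * R2 - E2 - 2 * size_e e3) 2; rewrite -/m mulnC; nlia.
have hm2 : 2 * R2 <= 2 * m + 1 + E2 + 2 * size_e e3.
  by have := divn_eq (2 * R2 - E2 - 2 * size_e e3) 2; have := ltn_mod (2 * R2 - E2 - 2 * size_e e3) 2; rewrite -/m mulnC; nlia.
pose W := far e2 y1.
pose G := [set s in W | (dg (tr e3) s == 0) &&
   [exists t in W, [&& e2 s t, dg e2 t == 1 & dg (tr e3) t == 0]]].
have cG : m <= #|G|.
  apply: leaf_star (t_s2 tp) (t_l2 tp) _.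
  have := far_sum tp' y1; rewrite -/W -/(card_far _) => h.
  have : \sum_(x in W) dg (tr e3) x <= size_e e3 by rewrite -size_e_tr; apply: sum_inT.
  by rewrite -/W in cf2; nlia.
have G0 : 0 < #|G| by nlia.
case/card_gt0P: G0 => v0 v0G.
case: (arg_minnP (dg e2) v0G) => v vG minv.
have {}vG : v \in G := vG.
have sGW : G \subset W by apply/subsetP => y; rewrite inE => /andP[].
have gv : dg e2 v * #|G| + R2 <= E2 + #|G|.
  have h1 := @sum_card_mul _ G (dg e2) (dg e2 v) minv.
  have h2 : #|W :\: G| <= \sum_(y in W :\: G) dg e2 y.
    by rewrite -sum1_card; apply: leq_sum => y _; apply: (t_l2 tp).
  have h3 := sum_far tp' y1; have h4 := cardsID G W.
  rewrite -/W (big_setID G) /= (setIidPr sGW) in h3; rewrite (setIidPr sGW) in h4.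
  by rewrite -/W in cf2; nlia.
move: (vG); rewrite inE => /and3P[vW /eqP v3 /existsP[u /and4P[uW vu /eqP u1 /eqP u3]]].
have nuA : nb e2 u = [set v].
  have /cards1P[q qE] : #|nb e2 u| == 1 by rewrite -/(dg e2 u) u1.
  have : v \in nb e2 u by rewrite inE (t_s2 tp).
  by rewrite qE inE => /eqP ->.
have uA : u \notin [set v] by rewrite inE; apply: contraTneq vu => ->; rewrite (t_i2 tp).
have no3 w q : dg (tr e3) w = 0 -> ~~ e3 q w.
  move/eqP; rewrite cards_eq0 => /eqP/setP/(_ q); by rewrite !inE /tr => ->.
have : 0 < #|far e1 x1| by rewrite cf1.
case/card_gt0P => t0 t0f.
case: (arg_minnP (dg e1) t0f) => t tf mint.
have {}tf : t \in far e1 x1 := tf.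
have Rt : R1 * dg e1 t <= E1.
  by rewrite mulnC; have := @sum_card_mul _ (far e1 x1) (dg e1) (dg e1 t) mint; have := sum_far tp x1; rewrite cf1; nlia.
have tx1 : t != x1 by move: tf; rewrite !inE negb_or => /andP[].
have vy1 : v != y1 by move: vW; rewrite !inE negb_or => /andP[].
have ot := other_deg tp tx1; have ov := other_deg tp' vy1.
pose A := [set v]; pose P0 := both_pl u (fun=> t) A.
have tA w : w \in A -> t \in far e1 x1 /\ ~~ e3 t w.
  by rewrite inE => /eqP ->; split=> //; apply: no3.
have tAA w w' : w \in A -> w' \in A -> w != w' -> t != t /\ ~~ e1 t t.
  by rewrite !inE => /eqP -> /eqP ->; rewrite eqxx.
have cA : #|A| <= 3 by rewrite cards1.
have sA (Q : pred V2) (f : V2 -> nat) : \sum_(w in A | Q w) f w = if Q v then f v else 0.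
  by rewrite big_mkcondr big_set1.
have r3x x : dg (res3 e1 e2 e3 P0) x <= dg e3 x + 1 + (if e1 x t then dg e2 v else 0).
  have := both_r3 (t := fun=> t) uA tA tAA cA x.
  by rewrite (sA (fun w => e1 x t) (dg e2)) u1.
have r3y y : dg (tr (res3 e1 e2 e3 P0)) y <= dg (tr e3) y + 1 + (if e2 y v then dg e1 t else 0).
  have := both_r3' (t := fun=> t) uA tA tAA nuA cA y.
  by rewrite (sA (fun w => e2 y w) (fun=> dg e1 t)).
have e3x x : dg e3 x <= size_e e3.
  by have := e3_sets e3 [set x] set0; rewrite big_set0 big_set1 cards0 muln0; nlia.
have t130 := tangent 130 kn.
have size2 : size_e (res (cod P0) e2) <= E2 := both_size2 u (t := fun=> t) tA tAA cA.
have d8 := divn_eq n 8; have m8 := ltn_mod n 8; have d2 := divn_eq n 2; have m2 := ltn_mod n 2.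
have d16 := divn_eq n 16; have m16 := ltn_mod n 16.
apply: (both_core (u := u) (t := fun=> t) (A := A)) => //.
- exact: no3.
- by rewrite big_set1; nlia.
- by move=> x; have := r3x x; have := e3x x; rewrite -/P0; case: ifP => _; nlia.
(* A large [v] forces [m <= 6], hence [E1 < 5 * R1] and [dg e1 t <= 4]: only four vertices can gain
   a large G3-degree. *)
- case: (leqP (16 * dg e2 v) n) => hv.
    apply: (@leq_trans (0 + 9)) => //.
    apply: (@count_heavy _ _ (dg e3) set0 n 0 (n %/ 2) (n %/ 16 - 2)) => //.
    + move=> x _ h; have := r3x x; rewrite -/P0 in h => h3.
      have : n %/ 16 < (dg e3 x + 2).+1.
        by rewrite ltn_divLR // mulnC; move: h3; case: ifP => _; nlia.
      by nlia.
    + by rewrite cards0.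
    + by rewrite -/(size_e e3) leq_divRL // mulnC; nlia.
    + by nlia.
  have mm : m <= 6.
    rewrite leqNgt; apply/negP => lt.
    have h1 : (dg e2 v - 1) * 7 <= (dg e2 v - 1) * #|G|.
      by rewrite leq_mul2l; apply/orP; right; apply: leq_trans cG.
    by rewrite mulnBl mul1n in h1; nlia.
  have d4 : dg e1 t <= 4.
    rewrite leqNgt; apply/negP => lt; have : R1 * 5 <= R1 * dg e1 t by rewrite leq_mul2l lt orbT.
    by nlia.
  apply: (@leq_trans (4 + 5)) => //.
  apply: (@count_heavy _ _ (dg e3) (nb e1 t) n 4 (n %/ 2) (n %/ 8 - 2)) => //.
  + move=> x; rewrite inE (t_s1 tp) => xt h; have := r3x x; rewrite (negbTE xt) => h3; rewrite -/P0 in h.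
    have : n %/ 8 < (dg e3 x + 2).+1 by rewrite ltn_divLR // mulnC; nlia.
    by nlia.
  + by rewrite -/(size_e e3) leq_divRL // mulnC; nlia.
  + by nlia.
(* Conversely a large [t] forces [m] to be of order [n], hence [dg e2 v <= 20]. *)
case: (leqP (16 * dg e1 t) n) => ht.
  apply: (@leq_trans (0 + 9)) => //.
  apply: (@count_heavy _ _ (dg (tr e3)) set0 n 0 (n %/ 2) (n %/ 16 - 2)) => //.
  + move=> y _ h; have := r3y y; rewrite -/P0 in h => h3.
    have : n %/ 16 < (dg (tr e3) y + 2).+1.
      by rewrite ltn_divLR // mulnC; move: h3; case: ifP => _; nlia.
    by nlia.
  + by rewrite cards0.
  + by rewrite -/(size_e (tr e3)) size_e_tr leq_divRL // mulnC; nlia.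
  + by nlia.
have mm : n <= 40 * m.
  have h1 : n * R1 <= 16 * (R1 * dg e1 t) by rewrite mulnCA mulnC leq_mul2l (ltnW ht) orbT.
  have h2 : n * R1 = (n - 64) * R1 + 64 * R1 by rewrite -mulnDl subnK //; nlia.
  have h3 : (n - 64) * 1 <= (n - 64) * R1 by rewrite leq_mul2l RP1 orbT.
  by nlia.
have v20 : dg e2 v <= 20.
  rewrite leqNgt; apply/negP => lt.
  have h1 : 20 * #|G| <= (dg e2 v - 1) * #|G| by rewrite leq_mul2r; apply/orP; right; nlia.
  by rewrite mulnBl mul1n in h1; nlia.
apply: (@leq_trans (20 + 5)) => //.
apply: (@count_heavy _ _ (dg (tr e3)) (nb e2 v) n 20 (n %/ 2) (n %/ 8 - 2)) => //.
+ move=> y; rewrite inE (t_s2 tp) => yv h; have := r3y y; rewrite (negbTE yv) => h3; rewrite -/P0 in h.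
  have : n %/ 8 < (dg (tr e3) y + 2).+1 by rewrite ltn_divLR // mulnC; nlia.
  by nlia.
+ by rewrite -/(size_e (tr e3)) size_e_tr leq_divRL // mulnC; nlia.
+ by nlia.
Qed.

(** The first hypothesis and [both_q1] give [E1 + 2 * C <= 4 * R1 + 15], so [low] exceeds half of
    [R1] by enough to host the at most three neighbours of [u]. *)
Lemma regime2 u : 2 * R2 <= E2 + 2 * size_e e3 + 1 ->
  u \in far e2 y1 -> ~~ e3 x1 u -> dg e2 u <= 3 ->
  (forall w, e2 u w -> 2 * dg (tr e3) w <= R1) -> fullpack e1 e2 e3.
Proof.
move=> hR uW nxu u3 hw.
have tp' := triple_sw tp; have n20 := n2040 hk kn; have q1 := both_q1; have q2 := both_q2.
have [_ RE1] := far_excess tp x1; have [_ RE2] := far_excess tp' y1.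
have [x0 _] := exV1 tp hk kn; have [y0 _] := exV2 tp hk kn.
have Cn : C <= 3 * n by have := size_ge1 tp x0; have := size_ge2 tp y0; have := t_f1 tp x0 y0; nlia.
have lc := low_card tp x1.
pose A := nb e2 u.
have uA : u \notin A by rewrite inE (t_i2 tp).
have [||t [t1 t2]] := @choose_hosts _ _ e1 e3 (low e1 x1) 8 (enum A) x0 (t_s1 tp) _ (enum_uniq _).
- by move=> q; rewrite inE => /andP[].
- move=> w; rewrite mem_enum inE => uw; have := hw w uw.
  by rewrite -cardE -/(dg e2 u); move: u3; rewrite /A; nlia.
have tA w : w \in A -> t w \in far e1 x1 /\ ~~ e3 (t w) w.
  by rewrite -mem_enum => /t1[]; rewrite inE => /andP[].
have t8 w : w \in A -> dg e1 (t w) <= 8.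
  by rewrite -mem_enum => /t1[]; rewrite inE => /andP[].
have tAA w w' : w \in A -> w' \in A -> w != w' -> t w != t w' /\ ~~ e1 (t w) (t w').
  by move=> wA wA'; apply: t2; rewrite mem_enum.
have cA : #|A| <= 3 := u3.
have s24 (Q : pred V2) : \sum_(w in A | Q w) dg e1 (t w) <= 24.
  apply: leq_trans (_ : \sum_(w in A) 8 <= _); last by rewrite sum_nat_const; nlia.
  by rewrite big_mkcondr; apply: leq_sum => w wA; case: ifP => // _; apply: t8.
have s24' : \sum_(w in A) dg e1 (t w) <= 24.
  by apply: leq_trans (s24 xpredT); apply/eq_leq/eq_bigl => w; rewrite andbT.
pose P0 := both_pl u t A.
have yA : y1 \notin A by move: uW; rewrite !inE negb_or (t_s2 tp) => /andP[].
have sig : 2 * \sum_(w in A) dg e2 w <= E2 + 16.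
  have := size_res (y1 |: A) (t_s2 tp); rewrite big_setU1 //=.
  have : \sum_(x in y1 |: A) #|nb e2 x :&: (y1 |: A)| <= 16.
    apply: leq_trans (_ : \sum_(x in y1 |: A) 4 <= _).
      apply: leq_sum => x _; apply: leq_trans (subset_leq_card (subsetIr _ _)) _.
      by rewrite cardsU1 yA.
    by rewrite sum_nat_const cardsU1 yA; nlia.
  by have [] := far_excess tp' y1; nlia.
have r3x x : dg (res3 e1 e2 e3 P0) x <= dg e3 x + 3 + \sum_(w in A | e1 x (t w)) dg e2 w.
  by apply: leq_trans (both_r3 uA tA tAA cA x) _; rewrite leq_add2r leq_add2l.
have r3y y : dg (tr (res3 e1 e2 e3 P0)) y <= dg (tr e3) y + 25.
  apply: leq_trans (both_r3' uA tA tAA (erefl A) cA y) _.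
  by have := s24 (fun w => e2 y w); nlia.
have e3x x : dg e3 x <= size_e e3.
  by have := e3_sets e3 [set x] set0; rewrite big_set0 big_set1 cards0 muln0; nlia.
have t130 := tangent 130 kn.
have size2 : size_e (res (cod P0) e2) <= E2 := both_size2 u tA tAA cA.
have d8 := divn_eq n 8; have m8 := ltn_mod n 8; have d2 := divn_eq n 2; have m2 := ltn_mod n 2.
apply: (both_core (u := u) (t := t) (A := A)) => //.
- by nlia.
- move=> x; have := r3x x; have := e3x x; rewrite -/P0.
  have : \sum_(w in A | e1 x (t w)) dg e2 w <= \sum_(w in A) dg e2 w.
    by rewrite big_mkcondr; apply: leq_sum => w _; case: ifP.
  by nlia.
- apply: (@leq_trans (24 + 5)) => //.
  apply: (@count_heavy _ _ (dg e3) (\bigcup_(w in A) nb e1 (t w)) n 24 (n %/ 2) (n %/ 8 - 3)) => //.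
  + move=> x xB h; have := r3x x; rewrite -/P0 in h; rewrite big_pred0 => [h3|w]; last first.
      apply/negbTE; apply: contra xB => /andP[wA e]; apply/bigcupP; exists w => //.
      by rewrite inE (t_s1 tp).
    have : n %/ 8 < (dg e3 x + 3).+1 by rewrite ltn_divLR // mulnC; nlia.
    by nlia.
  + apply: leq_trans (leq_card_bigcup _ _) _; exact: s24'.
  + by rewrite -/(size_e e3) leq_divRL // mulnC; nlia.
  + by nlia.
apply: (@leq_trans (0 + 5)) => //.
apply: (@count_heavy _ _ (dg (tr e3)) set0 n 0 (n %/ 2) (n %/ 8 - 25)) => //.
+ move=> y _ h; have h3 := r3y y; rewrite -/P0 in h.
  have : n %/ 8 < (dg (tr e3) y + 25).+1 by rewrite ltn_divLR // mulnC; nlia.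
  by nlia.
+ by rewrite cards0.
+ by rewrite -/(size_e (tr e3)) size_e_tr leq_divRL // mulnC; nlia.
+ by nlia.
Qed.

Definition heavy3 : {set V2} := [set w | (w != y1) && (R1 < 2 * dg (tr e3) w)].

(** If no [u] is admissible for [regime2], each vertex of [far e2 y1] compatible with [x1] has
    degree at least 4 or a neighbour in [heavy3]. Discharging over [far e2 y1] turns this into lower
    bounds for [E2]. *)
Lemma regime2_fail : ~ fullpack e1 e2 e3 ->
  [/\ 2 * R2 <= E2 + 2 * size_e e3 + 1, 2 * R2 <= E2 + 2 * dg e3 x1 + 2 * #|heavy3| &
    #|heavy3| = 0 -> 4 * R2 <= E2 + 4 * dg e3 x1].
Proof.
move=> nf; have tp' := triple_sw tp.
have h1 : 2 * R2 <= E2 + 2 * size_e e3 + 1.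
  by rewrite leqNgt; apply/negP => lt; apply: nf; apply: regime1; nlia.
pose W := far e2 y1; pose B := heavy3.
have fs := far_sum tp' y1; rewrite -/W in fs.
have cW := card_far tp' y1; rewrite -/W in cW.
pose Av := W :\: nb e3 x1.
have cAv : R2 <= #|Av| + dg e3 x1.
  by have := card_ge_sub W (nb e3 x1); rewrite -/Av cW -/(dg e3 x1); nlia.
have alt u : u \in Av -> 4 <= dg e2 u \/ exists2 w, e2 u w & w \in B.
  rewrite in_setD inE => /andP[nxu uW]; case: (leqP 4 (dg e2 u)) => h; [by left | right].
  have [[w [uw wR]]|no] := classic (exists w, e2 u w /\ R1 < 2 * dg (tr e3) w).
    exists w => //; rewrite inE wR andbT.
    by apply: contraTneq uW => wy; rewrite !inE -wy (t_s2 tp) uw orbT.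
  case: nf; apply: (regime2 h1 uW nxu h) => w uw; rewrite leqNgt; apply/negP => lt.
  by apply: no; exists w.
split=> // [|B0].
  have : 2 * #|Av :\: B| <= E2.
    apply: leq_trans fs.
    pose g u := dg e2 u + #|nb e2 u :\: W| + #|nb e2 u :&: (W :&: B)|.
    have a1 : 2 * #|Av :\: B| <= \sum_(u in W :\: B) g u.
      apply: leq_trans (_ : \sum_(u in Av :\: B) g u <= _); last first.
        by apply/sum_subset/setSD/subsetDl.
      apply: sum_card_mul => u; rewrite in_setD => /andP[_ /alt[h|[w uw wB]]]; rewrite /g; first by nlia.
      have : 0 < dg e2 u by apply: (t_l2 tp).
      case: (boolP (w \in W)) => wW.
        have : 0 < #|nb e2 u :&: (W :&: B)| by apply/card_gt0P; exists w; rewrite !in_setI wW wB inE uw.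
        by nlia.
      have : 0 < #|nb e2 u :\: W| by apply/card_gt0P; exists w; rewrite in_setD wW inE uw.
      by nlia.
    have a2 : \sum_(u in W :\: B) #|nb e2 u :&: (W :&: B)| <= \sum_(w in W :&: B) dg e2 w.
      rewrite double_count; apply: leq_sum => w _; apply/subset_leq_card/subsetP => u.
      by rewrite !inE /tr (t_s2 tp) => /andP[].
    have a3 : \sum_(u in W) dg e2 u = \sum_(u in W :&: B) dg e2 u + \sum_(u in W :\: B) dg e2 u.
      by rewrite (big_setID B).
    have a4 : \sum_(u in W :\: B) #|nb e2 u :\: W| <= \sum_(u in W) #|nb e2 u :\: W|.
      by apply/sum_subset/subsetDl.
    by move: a1; rewrite /g !big_split /=; nlia.
  by have := card_ge_sub Av B; rewrite -/B; nlia.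
have a4 : 4 * #|Av| <= \sum_(u in Av) dg e2 u.
  apply: sum_card_mul => u /alt[//|[w _ wB]].
  by move/eqP: B0; rewrite cards_eq0 => /eqP E; rewrite /B E inE in wB.
have := sum_subset (dg e2) (subsetDl W (nb e3 x1)); have := sum_far tp' y1; rewrite -/W -/Av.
by nlia.
Qed.

End Both.

Lemma leaf_neighbour n (V1 V2 : finType) (e1 : rel V1) (e2 : rel V2) (e3 : V1 -> V2 -> bool) x1 y1 :
  triple n e1 e2 e3 -> size_e e1 - 2 * dg e1 x1 + dg (tr e3) y1 + 1 < n ->
  exists z, [/\ dg e1 z = 1, e1 x1 z & ~~ e3 z y1].
Proof.
move=> tp lt; have cg := far_codeg tp x1; have [EE _] := far_excess tp x1.
pose L := [set z in nb e1 x1 | dg e1 z == 1].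
have h1 : 2 * #|nb e1 x1| <= \sum_(z in nb e1 x1) dg e1 z + #|L|.
  have -> : #|L| = \sum_(z in nb e1 x1) (dg e1 z == 1).
    rewrite -sum1_card big_mkcond [RHS]big_mkcond /=; apply: eq_bigr => z _.
    by rewrite [z \in L]inE; case: (z \in nb e1 x1) => //=; case: eqP.
  rewrite mulnC -sum_nat_const -big_split /=; apply: leq_sum => z _.
  by have := t_l1 tp z; case: (dg e1 z) => [|[|d]].
have := size_pos (x1 |: nb e1 x1) (t_l1 tp); rewrite big_setU1 ?inE ?(t_i1 tp) //=.
rewrite cardsU1 inE (t_i1 tp) /= (t_n1 tp) -/(dg e1 x1) => h2.
have : #|nb (tr e3) y1| < #|L| by rewrite -/(dg (tr e3) y1); rewrite -/(dg e1 x1) in h1; nlia.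
case/set_exists_of_card => z; rewrite !inE => /andP[xz /eqP z1] nz.
by exists z.
Qed.

(** [m1] and [m2] are the sizes of the obstructing sets on the two sides, [h1] and [h2] their
    G3-degree sums. If one set is empty, the sharper bound [b1] or [b2] applies. If both are
    nonempty, the loss is the product [m1.+1 * m2.+1] of doubly counted edges, and [R2 * m1]
    outweighs it because [4 * j + 12 <= R2]. *)
Lemma both_contradiction R1 R2 E1 E2 S dx dy m1 m2 h1 h2 :
  E1 + E2 + 2 * S + 2 * dy + 2 * C <= 4 * R1 + 2 * R2 + 14 ->
  E1 + E2 + 2 * S + 2 * dx + 2 * C <= 2 * R1 + 4 * R2 + 14 ->
  R1 <= E1 -> R2 <= E2 ->
  2 * R1 <= E1 + 2 * S + 1 -> 2 * R2 <= E2 + 2 * S + 1 ->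
  2 * R1 <= E1 + 2 * dy + 2 * m1 -> 2 * R2 <= E2 + 2 * dx + 2 * m2 ->
  (m1 = 0 -> 4 * R1 <= E1 + 4 * dy) -> (m2 = 0 -> 4 * R2 <= E2 + 4 * dx) ->
  dx + h1 + (dy + h2) <= S + m1.+1 * m2.+1 -> R2 * m1 <= 2 * h1 -> R1 * m2 <= 2 * h2 ->
  h2 <= S -> False.
Proof.
move=> q1 q2 r1 r2 g1 g2 a1 a2 b1 b2 ss c1 c2 hS.
case: m1 a1 b1 ss c1 => [|i] a1 b1 ss c1.
  have {}b1 := b1 erefl.
  case: m2 a2 b2 ss c2 => [|j] a2 b2 ss c2; first by have {}b2 := b2 erefl; nlia.
  have : 5 * j.+1 <= R1 * j.+1 by rewrite leq_mul2r; apply/orP; right; nlia.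
  by nlia.
case: m2 a2 b2 ss c2 => [|j] a2 b2 ss c2.
  have {}b2 := b2 erefl.
  have : 5 * i.+1 <= R2 * i.+1 by rewrite leq_mul2r; apply/orP; right; nlia.
  by nlia.
clear b1 b2.
have j4 : 4 * j + 12 <= R2.
  have : R1 * j <= 2 * R1 + R2 by move: c2; rewrite mulnS; nlia.
  have R1c : 200 * 200 <= R1 by nlia.
  case: (leqP j 2) => [|lt]; first by nlia.
  have : R1 * j = R1 * (j - 2) + R1 * 2 by rewrite -mulnDr subnK // ltnW.
  have : 200 * 200 * (j - 2) <= R1 * (j - 2) by rewrite leq_mul2r R1c orbT.
  by nlia.
have p1 : i * (4 * j + 12) <= i * R2 by rewrite leq_mul2l j4 orbT.
have p2 : 12 * j <= R1 * j by rewrite leq_mul2r; apply/orP; right; nlia.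
move: c1 c2 ss; rewrite !mulnS !mulSn mulnC in p1 *; nlia.
Qed.

Theorem both_giants n k (V1 V2 : finType) (e1 : rel V1) (e2 : rel V2) (e3 : V1 -> V2 -> bool) x1 y1 :
  triple n e1 e2 e3 -> 102 <= k -> 20 * (k * k) <= n -> n < 20 * (k.+1 * k.+1) ->
  3 * n < 4 * dg e1 x1 -> 6 * n < 7 * (dg e2 y1 + 390 * k) -> fullpack e1 e2 e3.
Proof.
move=> tp hk kn kn' g1 g2; have tp' := triple_sw tp.
have cg1 := far_codeg tp x1; have cg2 := far_codeg tp' y1.
have [EE1 RE1] := far_excess tp x1; have [EE2 RE2] := far_excess tp' y1.
have t100 := tangent 91 kn.
have hR1 : 20 * (n - (dg e1 x1).+1) <= 5 * n + C by nlia.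
have hR2 : 20 * (n - (dg e2 y1).+1) <= 5 * n + C by nlia.
have q1 := both_q1 tp hk kn kn' hR1 hR2; have q2 := both_q2 tp hk kn kn' hR1 hR2.
have ox : dg e3 x1 <= size_e e3.
  by have := e3_sets e3 [set x1] set0; rewrite big_set0 big_set1 cards0 muln0; nlia.
have oy : dg (tr e3) y1 <= size_e e3.
  by have := e3_sets e3 set0 [set y1]; rewrite big_set0 big_set1 cards0 mul0n; nlia.
have t410 := tangent 410 kn; have t130 := tangent 130 kn.
have [z [z1 zx zy]] : exists z, [/\ dg e1 z = 1, e1 x1 z & ~~ e3 z y1].
  by apply: leaf_neighbour tp _; nlia.
have [w [w1 wy wx]] : exists w, [/\ dg e2 w = 1, e2 y1 w & ~~ tr e3 w x1].
  by apply: leaf_neighbour tp' _; rewrite -[tr (tr e3)]/e3; nlia.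
have [//|nf] := classic (fullpack e1 e2 e3); exfalso.
have [u1 u2 u3] := regime2_fail tp hk kn kn' hR1 hR2 z1 zx zy nf.
have nf' : ~ fullpack e2 e1 (tr e3).
  by move=> h; apply: nf; apply: fullpack_sw h; rewrite (t_n1 tp) (t_n2 tp).
have [v1 v2 v3] := regime2_fail tp' hk kn kn' hR2 hR1 w1 wy wx nf'.
pose B2 := heavy3 n e1 e3 x1 y1; pose B1 := heavy3 n e2 (tr e3) y1 x1.
have xB1 : x1 \notin B1 by rewrite inE eqxx.
have yB2 : y1 \notin B2 by rewrite inE eqxx.
have ss := e3_sets e3 (x1 |: B1) (y1 |: B2).
rewrite !big_setU1 // !cardsU1 xB1 yB2 !add1n /= in ss.
have c1 : (n - (dg e2 y1).+1) * #|B1| <= 2 * \sum_(x in B1) dg e3 x.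
  by rewrite big_distrr; apply: sum_card_mul => x; rewrite inE => /andP[_ /ltnW].
have c2 : (n - (dg e1 x1).+1) * #|B2| <= 2 * \sum_(x in B2) dg (tr e3) x.
  by rewrite big_distrr; apply: sum_card_mul => x; rewrite inE => /andP[_ /ltnW].
have hS : \sum_(x in B2) dg (tr e3) x <= size_e e3 by rewrite -size_e_tr; apply: sum_inT.
rewrite size_e_tr in v1.
exact: both_contradiction q1 q2 RE1 RE2 v1 u1 v2 u2 v3 u3 ss c1 c2 hS.
Qed.

(** * Conclusion for triples without isolated vertices *)

Theorem triple_fullpack n (V1 V2 : finType) (e1 : rel V1) (e2 : rel V2) (e3 : V1 -> V2 -> bool) :
  0 < n -> triple n e1 e2 e3 -> fullpack e1 e2 e3.
Proof.
move=> n0 tp; have tp' := triple_sw tp; have E : #|V1| = #|V2| by rewrite (t_n1 tp) (t_n2 tp).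
have [x0 _] : exists x : V1, True by move: n0; rewrite -(t_n1 tp) => /card_gt0P[x _]; exists x.
have [y0 _] : exists y : V2, True by move: n0; rewrite -(t_n2 tp) => /card_gt0P[y _]; exists y.
have [k [hk kn kn']] : exists k, [/\ 102 <= k, 20 * (k * k) <= n & n < 20 * (k.+1 * k.+1)].
  (* Both degree sums being at least [n], the bound on F gives [n >= C / 2], and [20 * (102 * 102)]
     lies just below that. *)
  apply: sqrt_scale; have := t_f1 tp x0 y0; have := size_ge1 tp x0; have := size_ge2 tp y0.
  by have := t_l1 tp x0; have := t_l2 tp y0; nlia.
have [[x1 g1]|ng1] := classic (exists x, 6 * n < 7 * (dg e1 x + 390 * k)).
  have [[y1 c1]|nc] := classic (exists y, 3 * n < 4 * dg e2 y).
    by apply: fullpack_sw E _; exact: (both_giants tp' hk kn kn' c1 g1).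
  apply: (single_giant tp hk kn kn' g1) => y; rewrite leqNgt; apply/negP => lt.
  by apply: nc; exists y.
have [[y1 g2]|ng2] := classic (exists y, 6 * n < 7 * (dg e2 y + 390 * k)).
  have [[x1 c1]|nc] := classic (exists x, 3 * n < 4 * dg e1 x).
    exact: (both_giants tp hk kn kn' c1 g2).
  apply: fullpack_sw E _; apply: (single_giant tp' hk kn kn' g2) => y; rewrite leqNgt; apply/negP => lt.
  by apply: nc; exists y.
have h1 x : 7 * (dg e1 x + 390 * k) <= 6 * n.
  by rewrite leqNgt; apply/negP => lt; apply: ng1; exists x.
have h2 y : 7 * (dg e2 y + 390 * k) <= 6 * n.
  by rewrite leqNgt; apply/negP => lt; apply: ng2; exists y.
have [[y1 q]|nq2] := classic (exists y, 8 * n < 10 * dg (tr e3) y).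
  exact: (near_full_G3_vertex tp hk kn kn' h1 h2 q).
have [[x1 q]|nq1] := classic (exists x, 8 * n < 10 * dg e3 x).
  by apply: fullpack_sw E _; exact: (near_full_G3_vertex tp' hk kn kn' h2 h1 q).
apply: (no_giant tp hk kn kn' h1 h2) => z; rewrite leqNgt; apply/negP => lt.
  by apply: nq1; exists z.
by apply: nq2; exists z.
Qed.

(** * Isolated vertices *)

(** Isolated vertices are now allowed. [g_f0] is a separate field because the bounds on F quantify
    over vertices and would say nothing about empty vertex sets. *)
Record gtriple (n : nat) (V1 V2 : finType) (e1 : rel V1) (e2 : rel V2) (e3 : V1 -> V2 -> bool) : Prop := GTriple {
  g_n1 : #|V1| = n; g_n2 : #|V2| = n;
  g_s1 : symmetric e1; g_i1 : irreflexive e1; g_s2 : symmetric e2; g_i2 : irreflexive e2;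
  g_u1 : forall x, dg e1 x + 2 <= n; g_u2 : forall y, dg e2 y + 2 <= n;
  g_u31 : forall x, dg e3 x < n; g_u32 : forall y, dg (tr e3) y < n;
  g_f0 : 2 * C <= 6 * n;
  g_f1 : forall x y, size_e e1 + size_e e2 + 2 * size_e e3 + 2 * (dg e1 x + (dg (tr e3) y - 4)) + 2 * C <= 6 * n;
  g_f2 : forall x y, size_e e1 + size_e e2 + 2 * size_e e3 + 2 * (dg e2 y + (dg e3 x - 4)) + 2 * C <= 6 * n }.

Lemma gtriple_sw n (V1 V2 : finType) (e1 : rel V1) (e2 : rel V2) (e3 : V1 -> V2 -> bool) :
  gtriple n e1 e2 e3 -> gtriple n e2 e1 (tr e3).
Proof.
case=> *; split=> // x y; rewrite size_e_tr; first by rewrite [size_e e2 + _]addnC; auto.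
by rewrite [size_e e2 + _]addnC; auto.
Qed.

Definition packs_below n := forall m (V1 V2 : finType) (e1 : rel V1) (e2 : rel V2) (e3 : V1 -> V2 -> bool),
  m < n -> gtriple m e1 e2 e3 -> fullpack e1 e2 e3.

Lemma dg_sub (T U : finType) (A : pred T) (B : pred U) (r : T -> U -> bool) (x : {x : T | A x}) :
  dg (fun (x : {x : T | A x}) (y : {y : U | B y}) => r (val x) (val y)) x <= dg r (val x).
Proof.
rewrite /dg -(card_imset _ val_inj); apply/subset_leq_card/subsetP => y /imsetP[z zx ->].
by move: zx; rewrite !inE.
Qed.

Lemma size_sub (T U : finType) (A : pred T) (B : pred U) (r : T -> U -> bool) :
  size_e (fun (x : {x : T | A x}) (y : {y : U | B y}) => r (val x) (val y)) <= size_e r.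
Proof.
apply: leq_trans (_ : \sum_(x : {x : T | A x}) dg r (val x) <= _).
  by apply: leq_sum => x _; apply: dg_sub.
have -> : \sum_(x : {x : T | A x}) dg r (val x) = \sum_(a in [set val x | x : {x : T | A x}]) dg r a.
  by rewrite big_imset //= => x y _ _; apply: val_inj.
exact: sum_inT.
Qed.

Section Reduct.
Variables (n : nat) (V1 V2 : finType) (e1 : rel V1) (e2 : rel V2) (e3 : V1 -> V2 -> bool).
Hypotheses (IH : packs_below n) (gt : gtriple n e1 e2 e3).
Variable P0 : {set V1 * V2}.
Hypotheses (ok0 : okp e1 e2 e3 P0) (j0 : 0 < #|P0|).
Local Notation j := #|P0|.
Local Notation r1 := (res (dom P0) e1).
Local Notation r2 := (res (cod P0) e2).
Local Notation r3 := (res3 e1 e2 e3 P0).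

(** Unlike a residual triple, the reduct lives on the vertices outside [P0]. So [n] drops by [j],
    and the doubled F has to drop by [6 * j]. *)
Lemma reduct :
  (forall x, x \notin dom P0 -> dg r1 x + 2 + j <= n) ->
  (forall y, y \notin cod P0 -> dg r2 y + 2 + j <= n) ->
  (forall x, x \notin dom P0 -> dg r3 x + j < n) ->
  (forall y, y \notin cod P0 -> dg (tr r3) y + j < n) ->
  (forall x y, x \notin dom P0 -> y \notin cod P0 ->
    size_e r1 + size_e r2 + 2 * size_e r3 + 2 * (dg r1 x + (dg (tr r3) y - 4)) + 2 * C + 6 * j <= 6 * n) ->
  (forall x y, x \notin dom P0 -> y \notin cod P0 ->
    size_e r1 + size_e r2 + 2 * size_e r3 + 2 * (dg r2 y + (dg r3 x - 4)) + 2 * C + 6 * j <= 6 * n) ->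
  fullpack e1 e2 e3.
Proof.
move=> u1 u2 u31 u32 f1 f2.
have jn : j <= n by rewrite -(card_dom ok0) -(g_n1 gt) max_card.
case: (leqP n j) => [nj|jn'].
  by exists P0; split=> //; apply/eqP; rewrite (g_n1 gt) eqn_leq jn.
pose W1 : finType := {x : V1 | x \notin dom P0}.
pose W2 : finType := {y : V2 | y \notin cod P0}.
pose d1 : rel W1 := fun x x' => r1 (val x) (val x').
pose d2 : rel W2 := fun x x' => r2 (val x) (val x').
pose d3 : W1 -> W2 -> bool := fun x y => r3 (val x) (val y).
have c1 : #|W1| = n - j.
  by rewrite card_sig -(card_dom ok0) -(g_n1 gt) -(cardC (mem (dom P0))) addKn.
have c2 : #|W2| = n - j.
  by rewrite card_sig -(card_cod ok0) -(g_n2 gt) -(cardC (mem (cod P0))) addKn.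
have [P' [[inj ne nc] cP']] : fullpack d1 d2 d3.
  have l1 x : dg d1 x <= dg r1 (val x) by apply: (@dg_sub _ _ _ _ r1).
  have l2 x : dg d2 x <= dg r2 (val x) by apply: (@dg_sub _ _ _ _ r2).
  have l3 x : dg d3 x <= dg r3 (val x) by apply: (@dg_sub _ _ _ _ r3).
  have l3' x : dg (tr d3) x <= dg (tr r3) (val x) by apply: (@dg_sub _ _ _ _ (tr r3)).
  have z1 : size_e d1 <= size_e r1 by apply: size_sub.
  have z2 : size_e d2 <= size_e r2 by apply: size_sub.
  have z3 : size_e d3 <= size_e r3 by apply: size_sub.
  have [x0 _] : exists x : W1, True.
    have : 0 < #|W1| by rewrite c1 subn_gt0.
    by case/card_gt0P => x _; exists x.
  have [y0 _] : exists y : W2, True.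
    have : 0 < #|W2| by rewrite c2 subn_gt0.
    by case/card_gt0P => x _; exists x.
  apply: (IH (m := n - j)); first by move: j0 jn'; clear; lia.
  split=> //.
  - by move=> x y; rewrite /d1 (res_sym _ (g_s1 gt)).
  - by move=> x; rewrite /d1 (res_irr _ (g_i1 gt)).
  - by move=> x y; rewrite /d2 (res_sym _ (g_s2 gt)).
  - by move=> x; rewrite /d2 (res_irr _ (g_i2 gt)).
  - by move=> x; have := l1 x; have := u1 _ (valP x); nlia.
  - by move=> x; have := l2 x; have := u2 _ (valP x); nlia.
  - by move=> x; have := l3 x; have := u31 _ (valP x); nlia.
  - by move=> x; have := l3' x; have := u32 _ (valP x); nlia.
  - by have := f1 _ _ (valP x0) (valP y0); nlia.
  - by move=> x y; have := f1 _ _ (valP x) (valP y); have := l1 x; have := l3' y; nlia.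
  - by move=> x y; have := f2 _ _ (valP x) (valP y); have := l2 y; have := l3 x; nlia.
have o1 (w : W1) : val w \notin dom P0 by exact: (valP w).
have o2 (w : W2) : val w \notin cod P0 by exact: (valP w).
pose I : {set V1 * V2} := [set (val p.1, val p.2) | p in P'].
have IP p : reflect (exists2 q, q \in P' & p = (val q.1, val q.2)) (p \in I) by apply: imsetP.
have cI : #|I| = n - j.
  by rewrite card_imset ?cP' // => -[a b] [a' b'] /= [] /val_inj -> /val_inj ->.
have dis : P0 :&: I = set0.
  apply/setP => p; rewrite in_set0 in_setI; apply/negP => /andP[pP0 /IP[q _ pE]].
  by have := valP q.1; rewrite (_ : val q.1 = p.1) ?mem_dom // pE.
exists (P0 :|: I); split; last first.
  by rewrite cardsU dis cards0 subn0 cI subnKC // (g_n1 gt).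
apply: (res_lift (g_s1 gt) (g_s2 gt) ok0 _ (subsetUl _ _)).
have [inj0 ne0 nc0] := res_okp ok0.
split=> [p q|p|p q]; rewrite !in_setU.
- case/orP=> [pP|/IP[p' p'P ->]] /orP[qP|/IP[q' q'P ->]] /=.
  + exact: inj0.
  + transitivity false; [|symmetry]; apply/negbTE.
      by apply: contraNneq (o1 q'.1) => /= <-; apply: mem_dom.
    by apply: contraNneq (o2 q'.2) => /= <-; apply: mem_cod.
  + transitivity false; [|symmetry]; apply/negbTE.
      by apply: contraNneq (o1 p'.1) => /= ->; apply: mem_dom.
    by apply: contraNneq (o2 p'.2) => /= ->; apply: mem_cod.
  + exact: inj.
- by case/orP=> [pP|/IP[p' p'P ->]]; [apply: ne0 | apply: ne p' p'P].
case/orP=> [pP|/IP[p' p'P ->]]; first by move=> _; rewrite /res mem_dom // andbF.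
case/orP=> [qP|/IP[q' q'P ->]]; first by rewrite /res (mem_dom qP) !andbF.
exact: nc.
Qed.

End Reduct.

(** * Reducts and the drop of F *)

Lemma dg0 (V W : finType) (r : V -> W -> bool) x y : dg r x = 0 -> r x y = false.
Proof. by move/eqP; rewrite cards_eq0 => /eqP E; have := in_set0 y; rewrite -E inE. Qed.

Lemma dg_gt0 (V W : finType) (r : V -> W -> bool) x y : r x y -> 0 < dg r x.
Proof. by move=> h; apply/card_gt0P; exists y; rewrite inE. Qed.

Lemma size_res1 (V : finType) (e : rel V) (A : {set V}) z : symmetric e -> irreflexive e -> z \in A ->
  size_e (res A e) + 2 * dg e z <= size_e e.
Proof.
move=> se ie zA; have := size_res [set z] se; rewrite !big_set1.
have -> : #|nb e z :&: [set z]| = 0.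
  apply/eqP; rewrite cards_eq0; apply/eqP/setP => y; rewrite !inE.
  by apply/negP => /andP[e1 /eqP E]; rewrite E ie in e1.
rewrite addn0; apply: leq_trans; rewrite leq_add2r; apply: leq_sum => x _; apply: leq_dg => y.
rewrite /res => /and3P[-> xA yA]; rewrite !inE /=.
by apply/andP; split; [apply: contraNneq xA | apply: contraNneq yA] => ->.
Qed.

Lemma size_ge_dg (V : finType) (e : rel V) z : symmetric e -> irreflexive e -> 2 * dg e z <= size_e e.
Proof. by move=> se ie; apply: leq_trans (size_res1 se ie (set11 z)); apply: leq_addl. Qed.

Lemma size_ge_row (V W : finType) (r : V -> W -> bool) x : dg r x <= size_e r.
Proof. by rewrite /size_e (bigD1 x) //=; apply: leq_addr. Qed.

Lemma size_ge_rows (V W : finType) (r : V -> W -> bool) x x' : x != x' -> dg r x + dg r x' <= size_e r.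
Proof. by move=> ne; rewrite /size_e (bigD1 x) //= leq_add2l (bigD1 x') 1?eq_sym //=; apply: leq_addr. Qed.

(* Weigh y by d(y) + 2 f(y), minus its number of weightless leaf neighbours, plus 1 if it is itself such a leaf. *)
Lemma free_leaf (V : finType) (e : rel V) (f : V -> nat) (B : pred V) : symmetric e ->
  (forall y, B y -> 0 < f y) -> size_e e + 2 * \sum_y f y < 2 * #|V| ->
  exists y, f y = 0 /\ (dg e y = 0 \/ exists p, nb e y = [set p] /\ ~~ B p).
Proof.
move=> se Bf lt; apply: NNPP => no; move: lt; apply/negP; rewrite -leqNgt.
pose L := [set y | (f y == 0) && (dg e y == 1)].
have cl y : 2 + #|nb e y :&: L| <= dg e y + 2 * f y + (y \in L).
  have le : #|nb e y :&: L| <= dg e y by apply/subset_leq_card/subsetIl.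
  have [f0|f0] := posnP (f y); last by move: le f0; clear; lia.
  have noB p : p \in nb e y -> f p = 0 -> dg e p = 1 -> False.
    rewrite inE => eyp fp /eqP/cards1P[q Eq]; apply: no; exists p; split=> //; right; exists q; split=> //.
    have : y \in nb e p by rewrite inE se.
    by rewrite Eq inE => /eqP <-; apply/negP => /Bf; rewrite f0.
  have -> : nb e y :&: L = set0.
    apply/setP => p; rewrite in_set0 in_setI [p \in L]inE; apply/negP => /andP[py /andP[/eqP fp /eqP dp]].
    exact: noB py fp dp.
  rewrite cards0 [y \in L]inE f0 eqxx /=.
  have : dg e y != 0 by apply/eqP => d0; apply: no; exists y; split=> //; left.
  by clear; case: (dg e y) => [//|[|m]] //=; lia.
have S : 2 * #|V| + \sum_(y in [set: V]) #|nb e y :&: L| <= size_e e + 2 * \sum_y f y + #|L|.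
  have E (g : V -> nat) : \sum_(y in [set: V]) g y = \sum_y g y by apply: eq_bigl => y; rewrite inE.
  rewrite E mulnC -sum_nat_const -big_split /= -sum1_card [\sum_(i in L) 1]big_mkcond /=.
  by rewrite /size_e big_distrr -!big_split /=; apply: leq_sum => y _; apply: cl.
have D : \sum_(y in [set: V]) #|nb e y :&: L| = #|L|.
  rewrite double_count -sum1_card; apply: eq_bigr => y; rewrite inE => /andP[_ /eqP <-].
  by apply: eq_card => z; rewrite !inE /tr se andbT.
by move: S; rewrite D; clear; lia.
Qed.

Section Reducts.
Variables (n : nat) (V1 V2 : finType) (e1 : rel V1) (e2 : rel V2) (e3 : V1 -> V2 -> bool).
Hypotheses (IH : packs_below n) (gt : gtriple n e1 e2 e3).

Section NoConflict.
Variable P0 : {set V1 * V2}.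
Hypothesis ok0 : okp e1 e2 e3 P0.
Hypothesis nc : forall p x y, p \in P0 -> x \notin dom P0 -> y \notin cod P0 -> e1 x p.1 -> e2 y p.2 -> False.
Local Notation j := #|P0|.
Local Notation r1 := (res (dom P0) e1).
Local Notation r2 := (res (cod P0) e2).
Local Notation r3 := (res3 e1 e2 e3 P0).

Lemma res3_nc x y : r3 x y -> e3 x y.
Proof. by case/and3P => xd yc /confP[//|[p pP [a b]]]; case: (nc pP xd yc a b). Qed.

Lemma dg_res3_nc' y : dg (tr r3) y <= dg (tr e3) y.
Proof. by apply: leq_dg => x; apply: res3_nc. Qed.

Lemma reduct_nc : 0 < j ->
  (forall x, x \notin dom P0 -> dg e1 x + 2 + j <= n) ->
  (forall y, y \notin cod P0 -> dg e2 y + 2 + j <= n) ->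
  (forall x, x \notin dom P0 -> dg e3 x + j < n) ->
  (forall y, y \notin cod P0 -> dg (tr r3) y + j < n) ->
  size_e r1 + size_e r2 + 2 * size_e r3 + 6 * j <= size_e e1 + size_e e2 + 2 * size_e e3 ->
  fullpack e1 e2 e3.
Proof.
move=> j0 u1 u2 u31 u32 drop.
have l1 x : dg r1 x <= dg e1 x by apply: dg_res.
have l2 x : dg r2 x <= dg e2 x by apply: dg_res.
have l3 x : dg r3 x <= dg e3 x by apply: leq_dg => y; apply: res3_nc.
have l3' := dg_res3_nc'.
apply: (reduct IH gt ok0 j0).
- by move=> x /u1; have := l1 x; nlia.
- by move=> x /u2; have := l2 x; nlia.
- by move=> x /u31; have := l3 x; nlia.
- exact: u32.
- by move=> x y _ _; have := g_f1 gt x y; have := l1 x; have := l3' y; nlia.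
- by move=> x y _ _; have := g_f2 gt x y; have := l2 y; have := l3 x; nlia.
Qed.

Lemma size_res3_row z : z \in dom P0 -> size_e r3 + dg e3 z <= size_e e3.
Proof.
move=> zd; rewrite /size_e (bigD1 z) //= [in leqRHS](bigD1 z) //= dg_res3_0 // add0n addnC leq_add2l.
by apply: leq_sum => x _; apply: leq_dg => y; apply: res3_nc.
Qed.

(** One large vertex [z], or its partner side through [w], pays for all pairs at once. *)
Lemma reduct_big z w : z \in dom P0 -> w \in cod P0 ->
  (forall x, x \notin dom P0 -> dg e1 x + 2 + j <= n) ->
  (forall y, y \notin cod P0 -> dg e2 y + 2 + j <= n) ->
  (forall x, x \notin dom P0 -> dg e3 x + j < n) ->
  (forall y, y \notin cod P0 -> dg (tr r3) y + j < n) ->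
  3 * j <= dg e1 z + dg e3 z + dg e2 w ->
  fullpack e1 e2 e3.
Proof.
move=> zd wc u1 u2 u31 u32 drop.
have j0 : 0 < j by rewrite -(card_dom ok0); apply/card_gt0P; exists z.
apply: reduct_nc => //.
have := size_res1 (g_s1 gt) (g_i1 gt) zd; have := size_res1 (g_s2 gt) (g_i2 gt) wc.
by have := size_res3_row zd; nlia.
Qed.

End NoConflict.

Lemma n_big : 139 * 1000 <= n.
Proof. by have := g_f0 gt; nlia. Qed.

Section Iso.
Variable x : V1.
Hypothesis x0 : dg e1 x = 0.

Lemma iso_l a : e1 x a = false. Proof. exact: dg0. Qed.
Lemma iso_r a : e1 a x = false. Proof. by rewrite (g_s1 gt) iso_l. Qed.

Lemma size_res3_pair y : ~~ e3 x y ->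
  size_e (res3 e1 e2 e3 [set (x, y)]) + dg e3 x + dg (tr e3) y <= size_e e3.
Proof.
move=> nxy.
have -> : dg (tr e3) y = \sum_(a | a != x) e3 a y.
  rewrite /dg -sum1_card (bigID (pred1 x)) /= big1 ?add0n => [|a /andP[]]; last first.
    by rewrite inE /tr => h /eqP E; rewrite E (negbTE nxy) in h.
  rewrite [RHS]big_mkcond /= [LHS]big_mkcond /=; apply: eq_bigr => a _.
  by rewrite inE /tr; case: (a != x); case: (e3 a y).
have xd : x \in dom [set (x, y)] by rewrite dom_singleton inE.
rewrite /size_e (bigD1 x) //= [in leqRHS](bigD1 x) //= dg_res3_0 // add0n addnAC addnC leq_add2l.
rewrite addnC -big_split /=; apply: leq_sum => a ax.
have -> : dg e3 a = #|nb e3 a :&: [set y]| + #|nb e3 a :\: [set y]| by rewrite /dg cardsID.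
apply: leq_add.
  by case: (boolP (e3 a y)) => //= h; apply/card_gt0P; exists y; rewrite !inE h eqxx.
apply/subset_leq_card/subsetP => b; rewrite !inE /res3 dom_singleton cod_singleton !inE => /and3P[_ -> /confP[//|[p]]].
by rewrite inE => /eqP -> /= []; rewrite iso_r.
Qed.

Lemma nc_pair y (p : V1 * V2) a b : p \in [set (x, y)] -> a \notin dom [set (x, y)] -> b \notin cod [set (x, y)] ->
   e1 a p.1 -> e2 b p.2 -> False.
Proof. by rewrite inE => /eqP -> /=; rewrite iso_r. Qed.

Lemma pair_reduct y : ~~ e3 x y -> 3 <= dg e2 y + dg e3 x + dg (tr e3) y ->
  (forall a, a != x -> dg e1 a + 3 <= n) ->
  (forall b, b != y -> dg e2 b + 3 <= n) ->
  (forall a, a != x -> dg e3 a + 2 <= n) ->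
  (forall b, b != y -> dg (tr e3) b + 2 <= n) ->
  fullpack e1 e2 e3.
Proof.
move=> nxy drop u1 u2 u31 u32.
have ok0 := okp_singleton e2 (g_i1 gt) nxy.
apply: (reduct_nc ok0 (@nc_pair y)); rewrite ?cards1 //.
- by move=> a; rewrite dom_singleton inE => /u1; nlia.
- by move=> a; rewrite cod_singleton inE => /u2; nlia.
- by move=> a; rewrite dom_singleton inE => /u31; nlia.
- by move=> a; rewrite cod_singleton inE => /u32; have := dg_res3_nc' (@nc_pair y) a; nlia.
have wc : y \in cod [set (x, y)] by rewrite cod_singleton inE.
have := size_res_le (dom [set (x, y)]) e1; have := size_res1 (g_s2 gt) (g_i2 gt) wc.
by have := size_res3_pair nxy; nlia.
Qed.

End Iso.
End Reducts.

Ltac blia :=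
  repeat match goal with
  | H : is_true (leq _ _) |- _ => revert H
  | H : @eq nat _ _ |- _ => revert H
  end;
  repeat match goal with |- context [nat_of_bool ?b] => generalize (nat_of_bool b) end;
  clear; intros; lia.

Section Iso.
Variables (n : nat) (V1 V2 : finType) (e1 : rel V1) (e2 : rel V2) (e3 : V1 -> V2 -> bool).
Hypotheses (IH : packs_below n) (gt : gtriple n e1 e2 e3).

Lemma okp_pair x y a b : ~~ e3 x y -> ~~ e3 a b -> x != a -> y != b -> ~~ (e1 x a && e2 y b) ->
  okp e1 e2 e3 ((x, y) |: [set (a, b)]).
Proof.
move=> n1 n2 ne1 ne2 nn; apply: okp_ext => //.
- exact: (g_s1 gt).
- exact: (g_s2 gt).
- exact: (g_i1 gt).
- exact: okp_singleton (g_i1 gt) n2.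
- by rewrite dom_singleton inE.
- by rewrite cod_singleton inE.
apply/confP => -[h|[p]]; first by rewrite h in n1.
by rewrite inE => /eqP -> [/= h1 h2]; rewrite h1 h2 in nn.
Qed.

Variable x : V1.
Hypothesis x0 : dg e1 x = 0.

(** [z] goes to [y], and if [y] is a leaf its neighbour [p] goes to the isolated [x]; no conflict
    arises, and [z] alone pays for the two pairs, hence the 6. The term [e3 x b] records that the
    deletion of [x] lowers the G3-degree of [b]. *)
Lemma leaf_reduct z y : z != x -> ~~ e3 z y ->
  dg e2 y = 0 \/ (exists p, nb e2 y = [set p] /\ ~~ e3 x p) ->
  6 <= dg e1 z + dg e3 z ->
  (forall a, a != z -> dg e1 a + 4 <= n) ->
  (forall b, b != y -> dg e2 b + 4 <= n) ->
  (forall a, a != z -> dg e3 a + 3 <= n) ->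
  (forall b, b != y -> dg (tr e3) b + 3 <= n + e3 x b) ->
  fullpack e1 e2 e3.
Proof.
move=> zx nzy [y0|[p [Ey nxp]]] big u1 u2 u31 u32.
  have nc (p : V1 * V2) a b : p \in [set (z, y)] -> a \notin dom [set (z, y)] -> b \notin cod [set (z, y)] ->
     e1 a p.1 -> e2 b p.2 -> False.
    by rewrite inE => /eqP -> _ _ _ /=; rewrite (g_s2 gt) dg0.
  apply: (reduct_big IH gt (okp_singleton e2 (g_i1 gt) nzy) nc (z := z) (w := y)); rewrite ?cards1 ?dom_singleton ?cod_singleton ?inE //.
  - by move=> a; rewrite inE => /u1; nlia.
  - by move=> a; rewrite inE => /u2; nlia.
  - by move=> a; rewrite inE => /u31; nlia.
  - move=> b; rewrite inE => /u32 h; apply: leq_ltn_trans (leq_add (dg_res3_nc' e3 nc b) (leqnn _)) _.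
    by have := leq_b1 (e3 x b); blia.
  by nlia.
have eyp : e2 y p by have := set11 p; rewrite -Ey inE.
have yp : y != p by apply: contraTneq eyp => ->; rewrite (g_i2 gt).
have ok0 : okp e1 e2 e3 ((z, y) |: [set (x, p)]).
  by apply: okp_pair => //; rewrite (iso_r gt x0).
have E1 : dom ((z, y) |: [set (x, p)]) = [set z; x] by rewrite /dom imsetU1 imset_set1.
have E2 : cod ((z, y) |: [set (x, p)]) = [set y; p] by rewrite /cod imsetU1 imset_set1.
have E3 : #|(z, y) |: [set (x, p)]| = 2 by rewrite -(card_dom ok0) E1 cards2 zx.
have nc (q : V1 * V2) a b : q \in (z, y) |: [set (x, p)] -> a \notin dom ((z, y) |: [set (x, p)]) ->
     b \notin cod ((z, y) |: [set (x, p)]) -> e1 a q.1 -> e2 b q.2 -> False.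
  rewrite E1 E2; case/setU1P => [->|/set1P ->] _ /=; last by rewrite (iso_r gt x0).
  move=> bn _; rewrite (g_s2 gt) => eyb; move: bn; rewrite in_set2 negb_or => /andP[_ /eqP]; apply.
  by apply/set1P; rewrite -Ey inE.
apply: (reduct_big IH gt ok0 nc (z := z) (w := y)); rewrite ?E1 ?E2 ?E3 ?in_set2 ?eqxx //.
- by move=> a; rewrite in_set2 negb_or => /andP[/u1]; nlia.
- by move=> a; rewrite in_set2 negb_or => /andP[/u2]; nlia.
- by move=> a; rewrite in_set2 negb_or => /andP[/u31]; nlia.
- move=> b; rewrite in_set2 negb_or => /andP[/u32 h _].
  suff : dg (tr (res3 e1 e2 e3 ((z, y) |: [set (x, p)]))) b + e3 x b <= dg (tr e3) b by blia.
  case: (boolP (e3 x b)) => [e|_]; last by rewrite addn0; exact: (dg_res3_nc' e3 nc b).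
  rewrite /dg [leqRHS](cardsD1 x) inE /tr e /= addn1 add1n ltnS.
  apply/subset_leq_card/subsetP => a; rewrite !inE => r; rewrite (res3_nc nc r) andbT.
  by case/and3P: r; rewrite E1 in_set2 negb_or => /andP[].
by nlia.
Qed.

(* A reduct by a single pair lowers the edge count by 2 only, and one more unit must come from the degree term of F. *)
Lemma pair_reduct_tight y : ~~ e3 x y -> 2 <= dg e2 y + dg e3 x + dg (tr e3) y ->
  (forall a, a != x -> dg e1 a + 3 <= n) ->
  (forall b, b != y -> dg e2 b + 3 <= n + e2 b y) ->
  (forall a, a != x -> dg e3 a + 2 <= n + e3 a y) ->
  (forall b, b != y -> dg (tr e3) b + 2 <= n + e3 x b) ->
  (forall a b, a != x -> b != y ->
    size_e e1 + size_e e2 + 2 * size_e e3 + 2 * (dg e1 a + (dg (tr e3) b - e3 x b - 4)) + 2 * C + 2 <= 6 * n) ->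
  (forall a b, a != x -> b != y ->
    size_e e1 + size_e e2 + 2 * size_e e3 + 2 * (dg e2 b - e2 b y + (dg e3 a - e3 a y - 4)) + 2 * C + 2 <= 6 * n) ->
  fullpack e1 e2 e3.
Proof.
move=> nxy drop u1 u2 u31 u32 f1 f2.
have ok0 := okp_singleton e2 (g_i1 gt) nxy.
pose r1 := res (dom [set (x, y)]) e1; pose r2 := res (cod [set (x, y)]) e2; pose r3 := res3 e1 e2 e3 [set (x, y)].
have nc := fun p a b => @nc_pair n V1 V2 e1 e2 e3 gt x x0 y p a b.
have l1 a : dg r1 a <= dg e1 a by apply: dg_res.
have l2 b : dg r2 b + e2 b y <= dg e2 b.
  case: (boolP (e2 b y)) => e; last by rewrite addn0; apply: dg_res.
  rewrite /dg [leqRHS](cardsD1 y) inE e /= addn1 add1n ltnS.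
  by apply/subset_leq_card/subsetP => c; rewrite !inE /r2 /res cod_singleton !inE => /and3P[-> _ ->].
have l3 a : dg r3 a + e3 a y <= dg e3 a.
  case: (boolP (e3 a y)) => e; last by rewrite addn0; apply: leq_dg => b; exact: (res3_nc nc).
  rewrite /dg [leqRHS](cardsD1 y) inE e /= addn1 add1n ltnS.
  apply/subset_leq_card/subsetP => c; rewrite inE => r; rewrite !inE (res3_nc nc r) andbT.
  by case/and3P: r; rewrite cod_singleton inE.
have l3' b : dg (tr r3) b + e3 x b <= dg (tr e3) b.
  case: (boolP (e3 x b)) => e; last by rewrite addn0; exact: (dg_res3_nc' e3 nc b).
  rewrite /dg [leqRHS](cardsD1 x) inE /tr e /= addn1 add1n ltnS.
  apply/subset_leq_card/subsetP => c; rewrite inE => r; rewrite !inE (res3_nc nc r) andbT.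
  by case/and3P: r; rewrite dom_singleton inE.
have drop' : size_e r1 + size_e r2 + 2 * size_e r3 + 4 <= size_e e1 + size_e e2 + 2 * size_e e3.
  have wc : y \in cod [set (x, y)] by rewrite cod_singleton inE.
  have := size_res_le (dom [set (x, y)]) e1; have := size_res1 (g_s2 gt) (g_i2 gt) wc.
  by have := size_res3_pair gt x0 nxy; rewrite -/r1 -/r2 -/r3; nlia.
apply: (reduct IH gt ok0); rewrite ?cards1 ?dom_singleton ?cod_singleton // -/r1 -/r2 -/r3.
- by move=> a; rewrite inE => /u1; have := l1 a; rewrite /r1 dom_singleton; blia.
- by move=> a; rewrite inE => /u2; have := l2 a; rewrite /r2 cod_singleton; blia.
- by move=> a; rewrite inE => /u31; have := l3 a; blia.
- by move=> a; rewrite inE => /u32; have := l3' a; blia.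
- move=> a b; rewrite !inE => ax bx; have := f1 a b ax bx; have := l1 a; have := l3' b; move: drop'.
  by rewrite /r1 /r2 dom_singleton cod_singleton; blia.
- move=> a b; rewrite !inE => ax bx; have := f2 a b ax bx; have := l2 b; have := l3 a; move: drop'.
  by rewrite /r1 /r2 dom_singleton cod_singleton; blia.
Qed.

End Iso.

(** * Vertices of extreme degree beside an isolated vertex *)

Section Extreme.
Variables (n : nat) (V1 V2 : finType) (e1 : rel V1) (e2 : rel V2) (e3 : V1 -> V2 -> bool).
Hypotheses (IH : packs_below n) (gt : gtriple n e1 e2 e3).

Lemma ge1 a : 2 * dg e1 a <= size_e e1. Proof. exact: size_ge_dg (g_s1 gt) (g_i1 gt). Qed.
Lemma ge2 b : 2 * dg e2 b <= size_e e2. Proof. exact: size_ge_dg (g_s2 gt) (g_i2 gt). Qed.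
Lemma ge3 a : dg e3 a <= size_e e3. Proof. exact: size_ge_row. Qed.
Lemma ge3' b : dg (tr e3) b <= size_e e3. Proof. by rewrite -size_e_tr; apply: size_ge_row. Qed.

Lemma some1 : exists a : V1, True.
Proof.
have : 0 < #|V1| by rewrite (g_n1 gt); have := n_big gt; nlia.
by case/card_gt0P => a _; exists a.
Qed.

Lemma some2 : exists b : V2, True.
Proof.
have : 0 < #|V2| by rewrite (g_n2 gt); have := n_big gt; nlia.
by case/card_gt0P => a _; exists a.
Qed.

Lemma far3 a : exists b, ~~ e3 a b.
Proof.
have [|b _ h] := @set_exists_of_card _ (nb e3 a) [set: V2]; first by rewrite cardsT (g_n2 gt); exact: (g_u31 gt).
by exists b; rewrite inE in h.
Qed.

Lemma far3' b : exists a, ~~ e3 a b.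
Proof.
have [|a _ h] := @set_exists_of_card _ (nb (tr e3) b) [set: V1]; first by rewrite cardsT (g_n1 gt); exact: (g_u32 gt).
by exists a; rewrite inE in h.
Qed.

Variable x : V1.
Hypothesis x0 : dg e1 x = 0.

(** A degree this close to [n] could violate the degree bound once [n] drops, so [z] itself is
    placed, at a vertex found by [free_leaf]. *)
Lemma giant_reduct z : n <= dg e1 z + 100 -> fullpack e1 e2 e3.
Proof.
move=> hz; have nbig := n_big gt; have [b0 _] := some2.
have h1 := ge1 z; have hf := g_f1 gt z b0.
have [||y [y3 hy]] := @free_leaf V2 e2 (dg (tr e3)) (e3 x) (g_s2 gt).
- by move=> y h; apply: dg_gt0 (x) _.
- by rewrite -/(size_e (tr e3)) size_e_tr (g_n2 gt); nlia.
apply: (leaf_reduct IH gt x0 (z := z) (y := y)).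
- by apply: contraTneq hz => ->; rewrite x0 -ltnNge; nlia.
- by rewrite -[e3 z y]/(tr e3 y z) dg0.
- exact: hy.
- by nlia.
- by move=> a az; have := size_pair (g_s1 gt) (g_i1 gt) az; nlia.
- by move=> b _; have := ge2 b; nlia.
- by move=> a _; have := ge3 a; nlia.
- by move=> b _; have := ge3' b; nlia.
Qed.

(** If G3 forbids pairing [x] with [y0], a neighbour of [y0] is used instead, which lowers the
    degree of [y0] together with [n]. *)
Lemma giant2_reduct y0 : n = dg e2 y0 + 2 -> fullpack e1 e2 e3.
Proof.
move=> hz; have nbig := n_big gt; have h1 := ge2 y0; have hf := g_f2 gt x y0.
have u1 a : dg e1 a + 3 <= n by have := ge1 a; nlia.
have u31 a : dg e3 a + 2 <= n by have := ge3 a; nlia.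
have u32 b : dg (tr e3) b + 2 <= n by have := ge3' b; nlia.
have hp b : b != y0 -> 2 * dg e2 b + 2 * dg e2 y0 <= size_e e2 + 2.
  by move=> /(size_pair (g_s2 gt) (g_i2 gt)); nlia.
case: (boolP (e3 x y0)) => [e|ne]; last first.
  apply: (pair_reduct IH gt x0 ne) => //; first by nlia.
  by move=> b /hp; nlia.
have [|y yN nxy] := @set_exists_of_card _ (nb e3 x) (nb e2 y0).
  by rewrite -/(dg e2 y0) -/(dg e3 x); have := ge3 x; nlia.
rewrite inE in yN; rewrite inE in nxy.
apply: (pair_reduct_tight IH gt x0 nxy).
- have : 0 < dg e2 y by apply: dg_gt0 (y0) _; rewrite (g_s2 gt).
  by have := dg_gt0 e; nlia.
- by [].
- move=> b _; case: (eqVneq b y0) => [->|/hp]; first by rewrite yN; nlia.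
  by move: (nat_of_bool _) => c; nlia.
- by move=> a _; have := u31 a; move: (nat_of_bool _) => c; nlia.
- by move=> a _; have := u32 a; move: (nat_of_bool _) => c; nlia.
- move=> a b _ _; have := ge1 a; have := ge3' b; move: (nat_of_bool _) => c; nlia.
move=> a b _ _; case: (eqVneq b y0) => [->|/hp].
  by rewrite yN; have := g_f2 gt a y0; move: (nat_of_bool (e3 a y)) => c /=; nlia.
by have := ge3 a; move: (nat_of_bool (e3 a y)) (nat_of_bool (e2 b y)) => c d; nlia.
Qed.

(** Pairing [x] with a G3-neighbour of [z] lowers the G3-degree of [z] together with [n]. If no such
    pair lowers F enough, all G3-neighbours of [z] are isolated in G2; then so is the single
    remaining vertex, and [z] is placed there. *)
Lemma full3_reduct z : n = dg e3 z + 1 -> fullpack e1 e2 e3.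
Proof.
move=> hz; have nbig := n_big gt; have h3 := ge3 z; have [b0 _] := some2; have hf := g_f2 gt z b0.
have u1 a : dg e1 a + 4 <= n by have := ge1 a; nlia.
have u2 b : dg e2 b + 4 <= n by have := ge2 b; nlia.
have hp a : a != z -> dg e3 a + dg e3 z <= size_e e3 by exact: size_ge_rows.
have hq b : dg (tr e3) b + dg e3 z <= size_e e3 + 1 by have := size_ge_cross e3 z b; nlia.
have u32 b : dg (tr e3) b + 3 <= n by have := hq b; nlia.
case: (eqVneq z x) => [E|zx].
  have [y nxy] := far3 x.
  apply: (pair_reduct IH gt x0 nxy).
  - by rewrite -E; nlia.
  - by move=> a _; have := u1 a; nlia.
  - by move=> a _; have := u2 a; nlia.
  - by move=> a; rewrite -E => /hp; nlia.
  by move=> b _; have := u32 b; nlia.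
have xs : dg e3 x < dg e3 z by move: zx; rewrite eq_sym => /hp; nlia.
case: (classic (exists y, [/\ e3 z y, ~~ e3 x y & 2 <= dg e2 y + dg e3 x + dg (tr e3) y])).
  move=> [y [ezy nxy drop]].
  apply: (pair_reduct_tight IH gt x0 nxy drop).
  - by move=> a _; have := u1 a; nlia.
  - by move=> b _; have := u2 b; move: (nat_of_bool _) => c; nlia.
  - move=> a _; case: (eqVneq a z) => [->|/hp]; first by rewrite ezy; nlia.
    by move: (nat_of_bool _) => c; nlia.
  - by move=> b _; have := u32 b; move: (nat_of_bool _) => c; nlia.
  - by move=> a b _ _; have := ge1 a; have := hq b; move: (nat_of_bool _) => c; nlia.
  move=> a b _ _; case: (eqVneq a z) => [->|/hp].
    by rewrite ezy; have := g_f2 gt z b; move: (nat_of_bool _) => c /=; nlia.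
  by have := ge2 b; move: (nat_of_bool (e3 a y)) (nat_of_bool (e2 b y)) => c d; nlia.
move=> no.
have no' y : e3 z y -> ~~ e3 x y -> dg e2 y + dg e3 x + dg (tr e3) y <= 1.
  by move=> a b; rewrite leqNgt; apply/negP => h; apply: no; exists y; split.
have [yc ycz ycx] := set_exists_of_card xs.
rewrite inE in ycz; rewrite inE in ycx.
have dx : dg e3 x = 0.
  have h : 0 < dg (tr e3) yc by apply: dg_gt0 (z) _.
  by have := no' _ ycz ycx; nlia.
have no2 y : e3 z y -> dg e2 y = 0.
  move=> ezy; have h : 0 < dg (tr e3) y by apply: dg_gt0 (z) _.
  by have := no' _ ezy; rewrite dg0 // => /(_ isT); nlia.
have [yb nzy] := far3 z.
have dyb : dg e2 yb = 0.
  apply/eqP; rewrite -leqn0 leqNgt; apply/negP => /card_gt0P[c]; rewrite inE => ec.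
  have cy : c != yb by apply: contraTneq ec => ->; rewrite (g_i2 gt).
  have nzc : ~~ e3 z c.
    by apply/negP => /no2 h; have := dg_gt0 (etrans (g_s2 gt c yb) ec); rewrite h.
  have := cardsC (nb e3 z); rewrite (g_n2 gt) -/(dg e3 z).
  have : #|[set c; yb]| <= #|~: nb e3 z|.
    by apply/subset_leq_card/subsetP => b; rewrite in_set2 in_setC inE => /orP[]/eqP ->.
  by rewrite cards2 cy; nlia.
apply: (leaf_reduct IH gt x0 zx nzy); first by left.
- by nlia.
- by move=> a _; exact: u1.
- by move=> a _; exact: u2.
- by move=> a /hp; nlia.
by move=> b _; have := u32 b; move: (nat_of_bool _) => c; nlia.
Qed.

End Extreme.

(** If no pairing of [x] works, there is a vertex [y] isolated in G2, and the previous lemma applies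
    with the graphs exchanged. *)
Lemma full3'_reduct n (V1 V2 : finType) (e1 : rel V1) (e2 : rel V2) (e3 : V1 -> V2 -> bool) x y0 :
  packs_below n -> gtriple n e1 e2 e3 -> dg e1 x = 0 -> n = dg (tr e3) y0 + 1 -> fullpack e1 e2 e3.
Proof.
move=> IH gt x0 hz; have nbig := n_big gt; have h3 := ge3' e3 y0; have [a0 _] := some1 gt.
have hf := g_f1 gt a0 y0.
have u1 a : dg e1 a + 4 <= n by have := ge1 gt a; nlia.
have u2 b : dg e2 b + 4 <= n by have := ge2 gt b; nlia.
have hp b : b != y0 -> dg (tr e3) b + dg (tr e3) y0 <= size_e e3.
  by rewrite -size_e_tr; exact: size_ge_rows.
have hq a : dg e3 a + dg (tr e3) y0 <= size_e e3 + 1 by exact: size_ge_cross.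
have u31 a : dg e3 a + 3 <= n by have := hq a; nlia.
case: (boolP (e3 x y0)) => [ex|ne]; last first.
  apply: (pair_reduct IH gt x0 ne).
  - by nlia.
  - by move=> a _; have := u1 a; nlia.
  - by move=> a _; have := u2 a; nlia.
  - by move=> a _; have := u31 a; nlia.
  by move=> b /hp; nlia.
case: (classic (exists y, ~~ e3 x y /\ 0 < dg e2 y + dg (tr e3) y)).
  move=> [y [nxy drop]].
  apply: (pair_reduct_tight IH gt x0 nxy).
  - by have := dg_gt0 ex; nlia.
  - by move=> a _; have := u1 a; nlia.
  - by move=> b _; have := u2 b; move: (nat_of_bool _) => c; nlia.
  - by move=> a _; have := u31 a; move: (nat_of_bool _) => c; nlia.
  - move=> b _; case: (eqVneq b y0) => [->|/hp]; first by rewrite ex; nlia.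
    by move: (nat_of_bool _) => c; nlia.
  - move=> a b _ _; case: (eqVneq b y0) => [->|/hp].
      by rewrite ex; have := g_f1 gt a y0; move=> /=; nlia.
    by have := ge1 gt a; move: (nat_of_bool _) => c; nlia.
  move=> a b _ _; have := ge2 gt b; have := hq a.
  by move: (nat_of_bool (e3 a y)) (nat_of_bool (e2 b y)) => c d; nlia.
move=> no; have [y nxy] := far3 gt x.
apply: fullpack_sw; first by rewrite (g_n1 gt) (g_n2 gt).
apply: (@full3_reduct _ _ _ _ _ _ IH (gtriple_sw gt) y _ y0) => //.
apply/eqP; rewrite -leqn0 leqNgt; apply/negP => h; apply: no; exists y; split=> //.
by rewrite addn_gt0 h.
Qed.

(** What is left when neither an extreme vertex nor a single pair at [x] permits a reduction. The
    degree bounds are sharpened because the extreme cases are gone. *)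
Record iso_bad n (V1 V2 : finType) (e1 : rel V1) (e2 : rel V2) (e3 : V1 -> V2 -> bool) (x : V1) : Prop := IsoBad {
  b_iso : dg e1 x = 0;
  b_bad : forall y, ~~ e3 x y -> dg e2 y + dg e3 x + dg (tr e3) y <= 2;
  b_u1 : forall a, dg e1 a + 101 <= n;
  b_u2 : forall b, dg e2 b + 3 <= n;
  b_u31 : forall a, dg e3 a + 2 <= n;
  b_u32 : forall b, dg (tr e3) b + 2 <= n }.

Lemma iso_cases n (V1 V2 : finType) (e1 : rel V1) (e2 : rel V2) (e3 : V1 -> V2 -> bool) x :
  packs_below n -> gtriple n e1 e2 e3 -> dg e1 x = 0 -> fullpack e1 e2 e3 \/ iso_bad n e1 e2 e3 x.
Proof.
move=> IH gt x0; apply: NNPP => /not_or_and[nf nbad].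
have u1 a : dg e1 a + 101 <= n.
  by rewrite leqNgt; apply/negP => h; apply: nf; apply: (giant_reduct IH gt x0 (z := a)); nlia.
have u2 b : dg e2 b + 3 <= n.
  rewrite leqNgt; apply/negP => h; apply: nf; apply: (giant2_reduct IH gt x0 (y0 := b)).
  by have := g_u2 gt b; nlia.
have u31 a : dg e3 a + 2 <= n.
  rewrite leqNgt; apply/negP => h; apply: nf; apply: (full3_reduct IH gt x0 (z := a)).
  by have := g_u31 gt a; nlia.
have u32 b : dg (tr e3) b + 2 <= n.
  rewrite leqNgt; apply/negP => h; apply: nf; apply: (full3'_reduct IH gt x0 (y0 := b)).
  by have := g_u32 gt b; nlia.
apply: nbad; split=> // y nxy; rewrite leqNgt; apply/negP => h; apply: nf.
by apply: (pair_reduct IH gt x0 nxy) => // a _; have := u1 a; nlia.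
Qed.

Lemma dg_conf_mul (V1 V2 : finType) (e1 : rel V1) (e2 : rel V2) (e3 : V1 -> V2 -> bool) P x c :
  symmetric e2 -> okp e1 e2 e3 P -> (forall p, p \in P -> e1 x p.1 -> dg e2 p.2 <= c) ->
  dg (conf e1 e2 e3 P) x <= dg e3 x + dg e1 x * c.
Proof.
move=> s2 [inj _ _] h; apply: leq_trans (dg_conf _ _ _ _ s2) _; rewrite leq_add2l.
apply: leq_trans (_ : \sum_(p in [set p in P | e1 x p.1]) c <= _).
  rewrite [leqRHS](eq_bigl (fun p => (p \in P) && e1 x p.1)); last by move=> p; rewrite inE.
  by apply: leq_sum => p /andP[]; apply: h.
rewrite sum_nat_const leq_mul2r; apply/orP; right.
rewrite -(@card_in_imset _ _ (fun p : V1 * V2 => p.1)).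
  by apply/subset_leq_card/subsetP => a /imsetP[p]; rewrite !inE => /andP[_ h'] ->.
move=> [a b] [a' b']; rewrite !inE /= => /andP[pP _] /andP[qP _] E.
by have := inj _ _ pP qP; rewrite /= E eqxx => /esym/eqP ->.
Qed.

Lemma dg_conf_mul' (V1 V2 : finType) (e1 : rel V1) (e2 : rel V2) (e3 : V1 -> V2 -> bool) P y c :
  symmetric e1 -> okp e1 e2 e3 P -> (forall p, p \in P -> e2 y p.2 -> dg e1 p.1 <= c) ->
  dg (tr (conf e1 e2 e3 P)) y <= dg (tr e3) y + dg e2 y * c.
Proof.
move=> s1 okP h; rewrite -dg_conf_sw; apply: dg_conf_mul => //; first exact: okp_sw.
by move=> [b a]; rewrite inE => /h.
Qed.

(** * Isolated vertices that admit no single-pair reduction *)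

Section Bad.
Variables (n : nat) (V1 V2 : finType) (e1 : rel V1) (e2 : rel V2) (e3 : V1 -> V2 -> bool).
Hypotheses (IH : packs_below n) (gt : gtriple n e1 e2 e3).
Variable x : V1.
Hypothesis bx : iso_bad n e1 e2 e3 x.

Lemma finish_small k l (P : {set V1 * V2}) : k <= 12 -> l <= 12 -> #|P| <= 12 -> okp e1 e2 e3 P ->
  (forall a, a \notin dom P -> dg e1 a <= k /\ dg (conf e1 e2 e3 P) a <= l) ->
  (forall b, b \notin cod P -> dg e2 b <= k /\ dg (tr (conf e1 e2 e3 P)) b <= l) ->
  fullpack e1 e2 e3.
Proof.
move=> k12 l12 p12 okP h1 h2; have nbig := n_big gt.
have [P' [ok' _ c']] : exists P', [/\ okp e1 e2 e3 P', P \subset P' & #|P'| = n].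
  apply: (finish0 (g_s1 gt) (g_i1 gt) (g_s2 gt) (g_n1 gt) (g_n2 gt) okP h1 h2).
  have : k * k <= 12 * 12 by apply: leq_mul.
  by nlia.
by exists P'; rewrite c' (g_n1 gt).
Qed.

(* If some vertex of V1 is nearly full in G3, it is z; then every other vertex is far from full. *)
Lemma choose_top c : 0 < c -> c <= 100 -> (exists z, c <= dg e1 z + dg e3 z) ->
  exists z, c <= dg e1 z + dg e3 z /\ forall a, a != z -> dg e3 a + 100 <= n.
Proof.
move=> c0 c1 [z hz]; have nbig := n_big gt.
case: (classic (exists z, n < dg e3 z + 100)) => [[w hw]|no].
  exists w; split; first by nlia.
  move=> a aw; have := size_ge_rows e3 aw; have [b0 _] := some2 gt; have := g_f2 gt w b0.
  by nlia.
exists z; split=> // a _; rewrite leqNgt; apply/negP => h; apply: no; by exists a.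
Qed.

Section Three.
Hypothesis x3 : dg e3 x = 0.
Hypothesis small : forall y, dg e2 y + dg (tr e3) y <= 2.
Variable z : V1.
Hypothesis big : 13 <= dg e1 z + dg e3 z.
Hypothesis others : forall a, a != z -> dg e3 a + 100 <= n.
Hypothesis two : forall y, ~~ e3 z y -> 2 <= dg e2 y.

(** By [two] the degree sum of G2 is at least [2 * (n - dg e3 z)], which leaves G1 so sparse that at
    least five nonneighbours of [z] have degree at most 3. Only [z], [x] and at most two
    G3-neighbours of [p2] are excluded. *)
Lemma third_host p2 : exists x2, [/\ x2 != z, x2 != x, ~~ e1 z x2, ~~ e3 x2 p2 & dg e1 x2 <= 3].
Proof.
pose S := [set a | (dg e1 a <= 3) && ~~ e1 z a].
have zx : z != x by apply: contraTneq big => ->; rewrite (b_iso bx) x3.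
have hS : 4 * (n - 1) + dg e1 z <= size_e e1 + 3 * dg e1 z + 4 * #|S|.
  have D : dg e1 z = \sum_a e1 z a.
    by rewrite /dg -sum1_card big_mkcond; apply: eq_bigr => a _; rewrite inE; case: (e1 z a).
  have S1 : #|S| = \sum_a (a \in S) by rewrite -sum1_card big_mkcond; apply: eq_bigr => a _; case: (a \in S).
  rewrite {2}D S1 /size_e !big_distrr -!big_split /= (bigD1 z) //= addnC.
  apply: leq_add; first by rewrite -addnA leq_addr.
  have -> : 4 * (n - 1) = \sum_(a | a != z) 4.
    by rewrite sum_nat_const mulnC cardC1 (g_n1 gt) subn1.
  apply: leq_sum => a _; rewrite [a \in S]inE; case: (boolP (e1 z a)) => h /=.
    by have : 0 < dg e1 a; [apply: dg_gt0 (z) _; rewrite (g_s1 gt) | lia].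
  by rewrite andbT; case: (leqP (dg e1 a) 3) => /=; lia.
have D2 : 2 * (n - dg e3 z) <= size_e e2.
  have -> : n - dg e3 z = #|~: nb e3 z| by rewrite -(g_n2 gt) -(cardsC (nb e3 z)) addKn.
  apply: leq_trans (sum_inT (~: nb e3 z) (dg e2)); apply: sum_card_mul => y.
  by rewrite in_setC inE => /two.
have big4 : 4 < #|S|.
  have [b0 _] := some2 gt; have := g_f1 gt z b0; have := ge3 e3 z; have := n_big gt; nlia.
have [|x2 x2S x2N] := @set_exists_of_card _ ([set z; x] :|: nb (tr e3) p2) S.
  apply: leq_ltn_trans big4; apply: leq_trans (leq_card_setU _ _) _.
  by rewrite cards2 zx -/(dg (tr e3) p2); have := small p2; nlia.
move: x2S x2N; rewrite inE in_setU in_set2 !negb_or inE => /andP[d nz] /andP[/andP[a b] c].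
by exists x2.
Qed.

(** [z] goes to [y'], and the two neighbours of [y'] go to [x] and [x2]. New conflicts join a
    neighbour of [x2] to the one other neighbour of [p2], at most 3 in all. This explains 13: the
    doubled F gains 2 * 3 from these edges and at most 2 from a growing G3-degree, and 26 - 6 - 2 =
    18 = 6 * 3. *)
Lemma three_pair_reduct : fullpack e1 e2 e3.
Proof.
have nbig := n_big gt; have x0 := b_iso bx.
have d30 y : 2 <= dg e2 y -> dg (tr e3) y = 0 by have := small y; nlia.
have [y' nzy] := far3 gt z.
have dy : dg e2 y' = 2 by have := two nzy; have := small y'; nlia.
have /cards2P[p1 [p2 [p12 Ey]]] : #|nb e2 y'| == 2 by rewrite -/(dg e2 y') dy.
have ey1 : e2 y' p1 by have := set21 p1 p2; rewrite -Ey inE.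
have ey2 : e2 y' p2 by have := set22 p1 p2; rewrite -Ey inE.
have yp1 : y' != p1 by apply: contraTneq ey1 => ->; rewrite (g_i2 gt).
have yp2 : y' != p2 by apply: contraTneq ey2 => ->; rewrite (g_i2 gt).
have [x2 [x2z x2x nzx nxp dx2]] := third_host p2.
have zx : z != x by apply: contraTneq big => ->; rewrite x0 x3.
have ok2 : okp e1 e2 e3 ((z, y') |: [set (x2, p2)]).
  by apply: okp_pair gt _ _ _ _ nzy nxp _ yp2 _; rewrite ?(negbTE nzx) // eq_sym.
pose P := (x, p1) |: ((z, y') |: [set (x2, p2)]).
have dom2 : dom ((z, y') |: [set (x2, p2)]) = [set z; x2] by rewrite /dom imsetU1 imset_set1.
have cod2 : cod ((z, y') |: [set (x2, p2)]) = [set y'; p2] by rewrite /cod imsetU1 imset_set1.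
have x3' b : e3 x b = false by rewrite dg0.
have okP : okp e1 e2 e3 P.
  apply: okp_ext (g_s1 gt) (g_s2 gt) (g_i1 gt) ok2 _ _ _.
  - by rewrite dom2 in_set2 negb_or [x == z]eq_sym zx eq_sym.
  - by rewrite cod2 in_set2 negb_or eq_sym yp1.
  by apply/confP => -[|[p _ []]]; rewrite ?x3' // (iso_l x0).
have domP' : dom P = x |: [set z; x2] by rewrite /dom imsetU1 -/(dom _) dom2.
have codP' : cod P = p1 |: [set y'; p2] by rewrite /cod imsetU1 -/(cod _) cod2.
have cP : #|P| = 3.
  by rewrite -(card_dom okP) domP' cardsU1 in_set2 negb_or [x == z]eq_sym zx eq_sym x2x cards2 eq_sym x2z.
pose r1 := res (dom P) e1; pose r2 := res (cod P) e2; pose r3 := res3 e1 e2 e3 P.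
have r3P a b : r3 a b -> e3 a b \/ (e1 a x2 && e2 b p2 && (b != y')).
  move=> /and3P[ad bd /confP[h|[p pP [h1 h2]]]]; first by left.
  move: bd; rewrite codP' in_setU1 in_set2 !negb_or => /and3P[b1 b2 b3].
  case/setU1P: pP h1 h2 => [->|/setU1P[->|/set1P->]] /= h1 h2; first by rewrite (iso_r gt x0) in h1.
    have : b \in nb e2 y' by rewrite inE (g_s2 gt).
    by rewrite Ey in_set2 (negbTE b1) (negbTE b3).
  by right; rewrite h1 h2 b2.
have dr3 a : dg r3 a <= dg e3 a + e1 a x2.
  apply: leq_trans (_ : #|nb e3 a :|: (if e1 a x2 then nb e2 p2 :\ y' else set0)| <= _).
    apply/subset_leq_card/subsetP => b; rewrite inE => /r3P[h|/andP[/andP[h1 h2] h3]]; rewrite in_setU !inE ?h //.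
    by rewrite h1 !inE (g_s2 gt p2) h2 h3 orbT.
  apply: leq_trans (leq_card_setU _ _) _; rewrite leq_add2l; case: (e1 a x2); last by rewrite cards0.
  have : y' \in nb e2 p2 by rewrite inE (g_s2 gt).
  move=> h; have := cardsD1 y' (nb e2 p2); rewrite h -/(dg e2 p2) /=.
  by have := small p2; nlia.
(* The bound 4 makes the truncated term of script D vanish on this side. *)
have dr3' b : dg (tr r3) b <= 4.
  have [e|ne] := boolP (e2 b p2).
    apply: leq_trans (_ : #|nb (tr e3) b :|: nb e1 x2| <= _).
      apply/subset_leq_card/subsetP => a; rewrite inE => /r3P[h|/andP[/andP[h1 h2] h3]]; rewrite in_setU !inE /tr.
        by rewrite h.
      by rewrite (g_s1 gt) h1 orbT.
    apply: leq_trans (leq_card_setU _ _) _; rewrite -/(dg (tr e3) b) -/(dg e1 x2).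
    by have := small b; have := dg_gt0 e; nlia.
  apply: leq_trans (_ : dg (tr e3) b <= _); last by have := small b; nlia.
  by apply: leq_dg => a /r3P[//|]; rewrite (negbTE ne) andbF.
have zd : z \in dom P by rewrite domP' in_setU1 in_set2 eqxx orbT.
have sr3 : size_e r3 + dg e3 z <= size_e e3 + 3.
  rewrite {1}/size_e (bigD1 z) //= dg_res3_0 // add0n.
  apply: leq_trans (_ : \sum_(a | a != z) (dg e3 a + e1 a x2) + dg e3 z <= _).
    by rewrite leq_add2r; apply: leq_sum => a _; apply: dr3.
  rewrite big_split /= addnAC; apply: leq_add.
    by rewrite addnC /size_e [leqRHS](bigD1 z).
  apply: leq_trans dx2; rewrite /dg -sum1_card [leqRHS]big_mkcond [leqRHS](bigID (fun a => a != z)) /=.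
  apply: leq_trans (leq_addr _ _); apply: leq_sum => a _; rewrite inE (g_s1 gt).
  by case: (e1 x2 a).
have s1 := size_res1 (g_s1 gt) (g_i1 gt) zd; have s2 := size_res_le (cod P) e2.
have l1 a : dg r1 a <= dg e1 a by apply: dg_res.
have l2 a : dg r2 a <= dg e2 a by apply: dg_res.
have dr3b a : dg r3 a <= dg e3 a + 1 by apply: leq_trans (dr3 a) _; rewrite leq_add2l leq_b1.
apply: (reduct IH gt okP); rewrite ?cP // -/r1 -/r2 -/r3.
- by move=> a _; have := l1 a; have := b_u1 bx a; nlia.
- by move=> b _; have := l2 b; have := small b; nlia.
- move=> a; rewrite domP' in_setU1 in_set2 !negb_or => /and3P[_ /others h _].
  by have := dr3b a; nlia.
- by move=> b _; have := dr3' b; nlia.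
- move=> a b _ _; have := g_f1 gt a b; have := l1 a; have := dr3' b; move: s1 s2; rewrite -/r1 -/r2; nlia.
by move=> a b _ _; have := g_f2 gt a b; have := l2 b; have := dr3b a; move: s1 s2; rewrite -/r1 -/r2; nlia.
Qed.

End Three.

Lemma pack_bad_deg3_0 : dg e3 x = 0 -> fullpack e1 e2 e3.
Proof.
move=> x3; have nbig := n_big gt; have x0 := b_iso bx.
have x3' b : ~~ e3 x b by rewrite dg0.
have small y : dg e2 y + dg (tr e3) y <= 2 by have := b_bad bx (x3' y); rewrite x3 addn0.
case: (classic (exists z, 13 <= dg e1 z + dg e3 z)) => [|no]; last first.
  have sm a : dg e1 a + dg e3 a <= 12.
    by rewrite leqNgt; apply/negP => h; apply: no; exists a.
  have ok0 : okp e1 e2 e3 set0 by split=> [p q|p|p q]; rewrite inE.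
  have c1 a : dg (conf e1 e2 e3 set0) a <= dg e3 a.
    rewrite -[leqRHS]addn0 -(muln0 (dg e1 a)); apply: dg_conf_mul (g_s2 gt) ok0 _ => p.
    by rewrite inE.
  have c2 b : dg (tr (conf e1 e2 e3 set0)) b <= dg (tr e3) b.
    rewrite -[leqRHS]addn0 -(muln0 (dg e2 b)); apply: dg_conf_mul' (g_s1 gt) ok0 _ => p.
    by rewrite inE.
  apply: (@finish_small 12 12 set0) => //; first by rewrite cards0.
    move=> a _; have := sm a; have := c1 a; split; nlia.
  by move=> b _; have := small b; have := c2 b; split; nlia.
move/(choose_top (c := 13) isT isT) => [z [big others]].
case: (classic (exists y, ~~ e3 z y /\ dg e2 y <= 1)) => [[y [nzy dy]]|no]; last first.
  apply: (@three_pair_reduct x3 small z big others) => y nzy.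
  by rewrite ltnNge; apply/negP => h; apply: no; exists y.
apply: (leaf_reduct IH gt x0 (z := z) (y := y)).
- by apply: contraTneq big => ->; rewrite x0 x3.
- exact: nzy.
- case: (posnP (dg e2 y)) => [->|d]; [by left | right].
  have /cards1P[p Ep] : #|nb e2 y| == 1 by rewrite eqn_leq -/(dg e2 y) dy.
  by exists p.
- by nlia.
- by move=> a _; have := b_u1 bx a; nlia.
- by move=> b _; have := small b; nlia.
- by move=> a /others; nlia.
by move=> b _; have := small b; nlia.
Qed.

End Bad.

(** * An isolated vertex with exactly one edge in G3 *)

Section Matching.
Variables (n : nat) (V1 V2 : finType) (e1 : rel V1) (e2 : rel V2) (e3 : V1 -> V2 -> bool).
Hypotheses (IH : packs_below n) (gt : gtriple n e1 e2 e3).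
Variables (x : V1) (ya : V2).
Hypotheses (bx : iso_bad n e1 e2 e3 x) (Ex : nb e3 x = [set ya]).

Lemma x_e3 b : e3 x b = (b == ya).
Proof. by have : (b \in nb e3 x) = (b == ya); [rewrite Ex inE | rewrite inE]. Qed.

Lemma dx3 : dg e3 x = 1. Proof. by rewrite /dg Ex cards1. Qed.

Lemma small1 b : b != ya -> dg e2 b + dg (tr e3) b <= 1.
Proof. by move=> bya; have := b_bad bx (y := b); rewrite x_e3 bya dx3 => /(_ isT); nlia. Qed.

Variables (y p : V2).
Hypotheses (eyp : e2 y p) (yya : y != ya) (pya : p != ya).

Let Ey : nb e2 y = [set p].
Proof.
apply/eqP; rewrite eq_sym eqEcard cards1 sub1set inE eyp /=.
by have := small1 yya; rewrite -/(dg e2 y); nlia.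
Qed.

Let y3 : dg (tr e3) y = 0.
Proof. by have := small1 yya; have := dg_gt0 eyp; nlia. Qed.

Let eya : e2 ya y = false.
Proof.
apply/negP; rewrite (g_s2 gt) => h; have : ya \in nb e2 y by rewrite inE.
by rewrite Ey inE eq_sym (negbTE pya).
Qed.

Let yp : y != p. Proof. by apply: contraTneq eyp => ->; rewrite (g_i2 gt). Qed.

(** [ya] goes to a vertex [a] of degree at most 1. If [a] has a neighbour [s], then [s] goes to the
    leaf [y], and the only neighbour [p] of [y] goes to the isolated [x]. No conflict arises, and
    the degree of [ya] pays for all three pairs. *)
Lemma matching_giant : n <= dg e2 ya + 100 -> fullpack e1 e2 e3.
Proof.
move=> hb; have nbig := n_big gt; have x0 := b_iso bx; have h2 := ge2 gt ya; have hf := g_f2 gt x ya.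
have u1 a : dg e1 a + 100 <= n by have := ge1 gt a; nlia.
have u2 b : b != ya -> dg e2 b + 100 <= n by move=> /small1; nlia.
have u31 a : dg e3 a + 100 <= n by have := ge3 e3 a; nlia.
have u32 b : dg (tr e3) b + 100 <= n by have := ge3' e3 b; nlia.
have [//||a [a3 ha]] := @free_leaf V1 e1 (dg e3) pred0 (g_s1 gt).
  by rewrite -/(size_e e3) (g_n1 gt); nlia.
have ax : a != x by apply: contra_eqN a3 => /eqP ->; rewrite dx3.
have na b : e3 a b = false by rewrite dg0.
have ny b : e3 b y = false by rewrite -[e3 b y]/(tr e3 y b) dg0.
case: ha => [a0|[s [Ea _]]].
  have naya : ~~ e3 a ya by rewrite na.
  have nc (q : V1 * V2) c d : q \in [set (a, ya)] -> c \notin dom [set (a, ya)] -> d \notin cod [set (a, ya)] ->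
     e1 c q.1 -> e2 d q.2 -> False.
    by rewrite inE => /eqP -> _ _ /=; rewrite (g_s1 gt) dg0.
  apply: (reduct_big IH gt (okp_singleton e2 (g_i1 gt) naya) nc (z := a) (w := ya)); rewrite ?cards1 ?dom_singleton ?cod_singleton ?inE //.
  - by move=> c _; have := u1 c; nlia.
  - by move=> c; rewrite inE => /u2; nlia.
  - by move=> c _; have := u31 c; nlia.
  - by move=> b _; apply: leq_ltn_trans (leq_add (dg_res3_nc' e3 nc b) (leqnn _)) _; have := u32 b; nlia.
  by nlia.
have eas : e1 a s by have := set11 s; rewrite -Ea inE.
have as' : a != s by apply: contraTneq eas => ->; rewrite (g_i1 gt).
have sx : s != x by apply: contraTneq eas => ->; rewrite (iso_r gt x0).
have ok2 : okp e1 e2 e3 ((a, ya) |: [set (s, y)]).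
  by apply: okp_pair gt _ _ _ _ _ _ as' _ _; rewrite ?na ?ny // 1?eq_sym // eya andbF.
pose P0 := (x, p) |: ((a, ya) |: [set (s, y)]).
have dom2 : dom ((a, ya) |: [set (s, y)]) = [set a; s] by rewrite /dom imsetU1 imset_set1.
have cod2 : cod ((a, ya) |: [set (s, y)]) = [set ya; y] by rewrite /cod imsetU1 imset_set1.
have okP : okp e1 e2 e3 P0.
  apply: okp_ext (g_s1 gt) (g_s2 gt) (g_i1 gt) ok2 _ _ _.
  - by rewrite dom2 in_set2 negb_or eq_sym ax eq_sym.
  - by rewrite cod2 in_set2 negb_or pya eq_sym.
  by apply/confP => -[|[q _ []]]; rewrite ?x_e3 ?(negbTE pya) // (iso_l x0).
have domP' : dom P0 = x |: [set a; s] by rewrite /dom imsetU1 -/(dom _) dom2.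
have codP' : cod P0 = p |: [set ya; y] by rewrite /cod imsetU1 -/(cod _) cod2.
have cP : #|P0| = 3.
  by rewrite -(card_dom okP) domP' cardsU1 in_set2 negb_or [x == a]eq_sym ax eq_sym sx cards2 as'.
have nc (q : V1 * V2) c d : q \in P0 -> c \notin dom P0 -> d \notin cod P0 -> e1 c q.1 -> e2 d q.2 -> False.
  rewrite domP' codP' !in_setU1 !inE !negb_or => qP /and3P[_ ca cs] /and3P[dp dya dy].
  case/predU1P: qP => [->|/orP[]/eqP->] /=; first by rewrite (iso_r gt x0).
    by move=> h _; have : c \in nb e1 a; [rewrite inE (g_s1 gt) | rewrite Ea inE (negbTE cs)].
  by move=> _ h; have : d \in nb e2 y; [rewrite inE (g_s2 gt) | rewrite Ey inE (negbTE dp)].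
apply: (reduct_big IH gt okP nc (z := a) (w := ya)); rewrite ?cP ?domP' ?codP' ?in_setU1 ?in_set2 ?eqxx ?orbT //.
- by move=> c _; have := u1 c; nlia.
- by move=> c; rewrite in_setU1 in_set2 !negb_or => /and3P[_ /u2 h _]; nlia.
- by move=> c _; have := u31 c; nlia.
- by move=> b _; apply: leq_ltn_trans (leq_add (dg_res3_nc' e3 nc b) (leqnn _)) _; have := u32 b; nlia.
by nlia.
Qed.

(** Only [ya] can have large degree. It goes to a vertex [a] that G3 allows, the neighbours of [a]
    are put outside the neighbourhood of [ya], and bounded degrees remain. *)
Lemma matching_small : (forall a, dg e1 a + dg e3 a <= 5) -> dg e2 ya + 101 <= n -> fullpack e1 e2 e3.
Proof.
move=> sm hb; have nbig := n_big gt; have x0 := b_iso bx.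
have [a na] := far3' gt ya.
pose S := ~: (ya |: nb e2 ya).
have SP t : t \in S -> t != ya /\ ~~ e2 ya t by rewrite in_setC in_setU1 negb_or inE => /andP.
have cS : 100 <= #|S|.
  have := cardsC (ya |: nb e2 ya); rewrite -/S (g_n2 gt) cardsU1 -/(dg e2 ya).
  by have := leq_b1 (ya \notin nb e2 ya); move: (nat_of_bool _) => c; nlia.
have [|||t [t1 t2]] := @choose_hosts V2 V1 e2 (tr e3) S 1 (enum (nb e1 a)) ya (g_s2 gt).
- by move=> t /SP[/small1]; nlia.
- exact: enum_uniq.
- move=> t _; rewrite -cardE -/(dg e1 a) -[dg (tr (tr e3)) t]/(dg e3 t).
  by apply: leq_trans cS; have := sm a; have := sm t; nlia.
have tA w : w \in nb e1 a -> [/\ t w != ya, ~~ e2 ya (t w) & ~~ tr e3 (t w) w].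
  by move=> wA; have [|/SP[q1 q2] q3] := t1 w; rewrite ?mem_enum.
have tAA w w' : w \in nb e1 a -> w' \in nb e1 a -> w != w' -> t w != t w' /\ ~~ e2 (t w) (t w').
  by move=> wA wA'; apply: t2; rewrite mem_enum.
have aA : a \notin nb e1 a by rewrite inE (g_i1 gt).
have naya : ~~ tr e3 ya a by [].
have okP := attach_okp e1 (g_s2 gt) (g_i2 gt) naya aA tA tAA.
have cP := attach_card ya t aA; rewrite -/(dg e1 a) in cP.
have codE := attach_cod ya a t (nb e1 a).
apply: fullpack_sw; first by rewrite (g_n1 gt) (g_n2 gt).
have smb b : b != ya -> dg e2 b + dg (tr e3) b <= 1 by exact: small1.
have yaP : ya \in dom (attach ya a t (nb e1 a)) by rewrite attach_dom in_setU1 eqxx.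
apply: (@finish_small _ _ _ e2 e1 (tr e3) (gtriple_sw gt) 5 10 (attach ya a t (nb e1 a))) => //.
- by rewrite cP; have := sm a; nlia.
- move=> b bP; have bya : b != ya by apply: contraNneq bP => ->.
  have h : dg (conf e2 e1 (tr e3) (attach ya a t (nb e1 a))) b <= dg (tr e3) b + dg e2 b * 5.
    by apply: dg_conf_mul (g_s1 gt) okP _ => q _ _; have := sm q.2; nlia.
  by have := smb b bya; split; nlia.
move=> c; rewrite codE in_setU1 negb_or inE => /andP[ca nac].
have h : dg (tr (conf e2 e1 (tr e3) (attach ya a t (nb e1 a)))) c <= dg e3 c + dg e1 c * 1.
  apply: dg_conf_mul' (g_s2 gt) okP _ => q /attachP[->|[w /tA[tw _ _] ->]] /=.
    by rewrite (g_s1 gt) (negbTE nac).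
  by move=> _; have := smb _ tw; nlia.
by have := sm c; split; nlia.
Qed.

Lemma pack_bad_matching : fullpack e1 e2 e3.
Proof.
have nbig := n_big gt; have x0 := b_iso bx.
case: (leqP n (dg e2 ya + 100)) => [|hb]; first exact: matching_giant.
case: (classic (exists z, 6 <= dg e1 z + dg e3 z)) => [|no]; last first.
  apply: matching_small; last by nlia.
  by move=> a; rewrite leqNgt; apply/negP => h; apply: no; exists a.
move/(choose_top gt (c := 6) isT isT) => [z [big others]].
apply: (leaf_reduct IH gt x0 (z := z) (y := y)).
- by apply: contraTneq big => ->; rewrite x0 dx3.
- by rewrite -[e3 z y]/(tr e3 y z) dg0.
- by right; exists p; rewrite x_e3.
- exact: big.
- by move=> a _; have := b_u1 bx a; nlia.
- by move=> b _; case: (eqVneq b ya) => [->|/small1]; nlia.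
- by move=> a /others; nlia.
move=> b _; rewrite x_e3; case: (eqVneq b ya) => [->|/small1] /=; last by nlia.
by have := b_u32 bx ya; nlia.
Qed.

End Matching.

(** All edges of G1 meet [xa] and all edges of G2 meet [ya]. Once both centres are placed
    compatibly, only degrees at most 1 are left. If no compatible choice exists, the edges at the
    two centres cover each side nearly twice over, more than F allows. *)
Lemma star_star n (V1 V2 : finType) (e1 : rel V1) (e2 : rel V2) (e3 : V1 -> V2 -> bool) x y xa ya :
  gtriple n e1 e2 e3 -> iso_bad n e1 e2 e3 x -> iso_bad n e2 e1 (tr e3) y ->
  nb e3 x = [set ya] -> nb (tr e3) y = [set xa] ->
  (forall a a', e1 a a' -> a = xa \/ a' = xa) -> (forall b b', e2 b b' -> b = ya \/ b' = ya) ->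
  fullpack e1 e2 e3.
Proof.
move=> gt bx by' Ex Ey st1 st2; have nbig := n_big gt.
have s1 a : a != xa -> dg e1 a + dg e3 a <= 1 := small1 by' Ey (b := a).
have s2 b : b != ya -> dg e2 b + dg (tr e3) b <= 1 := small1 bx Ex (b := b).
have H x1 y1 : x1 != xa -> y1 != ya -> ~~ e3 x1 ya -> ~~ e3 xa y1 -> ~~ (e1 x1 xa && e2 ya y1) ->
    fullpack e1 e2 e3.
  move=> n1 n2 m1 m2 m3.
  have okP : okp e1 e2 e3 ((x1, ya) |: [set (xa, y1)]) by apply: okp_pair gt _ _ _ _ m1 m2 n1 _ m3; rewrite eq_sym.
  apply: (finish_small gt (k := 1) (l := 2) _ _ _ okP) => //.
  - by apply: leq_trans (leq_card_setU _ _) _; rewrite !cards1.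
  - move=> a; rewrite /dom imsetU1 imset_set1 in_set2 negb_or /= => /andP[a1 a2].
    have h : dg (conf e1 e2 e3 ((x1, ya) |: [set (xa, y1)])) a <= dg e3 a + dg e1 a * 1.
      apply: dg_conf_mul (g_s2 gt) okP _ => q /setU1P[->|/set1P->] /=; last by have := s2 _ n2; nlia.
      by case/st1 => E; [rewrite E eqxx in a2 | rewrite E eqxx in n1].
    have := s1 a a2; split; first by nlia.
    by apply: leq_trans h _; nlia.
  move=> b; rewrite /cod imsetU1 imset_set1 in_set2 negb_or /= => /andP[b1 b2].
  have h : dg (tr (conf e1 e2 e3 ((x1, ya) |: [set (xa, y1)]))) b <= dg (tr e3) b + dg e2 b * 1.
    apply: dg_conf_mul' (g_s1 gt) okP _ => q /setU1P[->|/set1P->] /=; first by have := s1 _ n1; nlia.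
    by case/st2 => E; [rewrite E eqxx in b1 | rewrite E eqxx in n2].
  have := s2 b b1; split; first by nlia.
  by apply: leq_trans h _; nlia.
have [x1 x1a x1n] : exists2 x1, x1 != xa & ~~ e3 x1 ya.
  have [|a _ aN] := @set_exists_of_card _ (xa |: nb (tr e3) ya) [set: V1].
    rewrite cardsT (g_n1 gt) cardsU1 -/(dg (tr e3) ya); have := b_u32 bx ya.
    by have := leq_b1 (xa \notin nb (tr e3) ya); move: (nat_of_bool _) => c; nlia.
  by move: aN; rewrite in_setU1 negb_or inE => /andP[]; exists a.
have [y1 y1a y1n] : exists2 y1, y1 != ya & ~~ e3 xa y1.
  have [|b _ bN] := @set_exists_of_card _ (ya |: nb e3 xa) [set: V2].
    rewrite cardsT (g_n2 gt) cardsU1 -/(dg e3 xa); have := b_u31 bx xa.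
    by have := leq_b1 (ya \notin nb e3 xa); move: (nat_of_bool _) => c; nlia.
  by move: bN; rewrite in_setU1 negb_or inE => /andP[]; exists b.
case: (classic (exists a, [/\ a != xa, ~~ e3 a ya & ~~ e1 a xa])) => [[a [a1 a2 a3]]|no1].
  by apply: (H a y1) => //; rewrite (negbTE a3).
case: (classic (exists b, [/\ b != ya, ~~ e3 xa b & ~~ e2 ya b])) => [[b [b1 b2 b3]]|no2].
  by apply: (H x1 b) => //; rewrite (negbTE b3) andbF.
exfalso.
have c1 : n <= 1 + (dg (tr e3) ya + dg e1 xa).
  rewrite -(g_n1 gt) -cardsT; apply: leq_trans (_ : #|xa |: (nb (tr e3) ya :|: nb e1 xa)| <= _).
    apply/subset_leq_card/subsetP => a _; rewrite in_setU1 in_setU !inE /tr (g_s1 gt xa).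
    apply/or3P; case: (boolP (a == xa)) => [_|a1]; first by constructor.
    case: (boolP (e3 a ya)) => [_|a2]; first by constructor.
    case: (boolP (e1 a xa)) => [_|a3]; first by constructor.
    by case: no1; exists a.
  rewrite cardsU1 leq_add ?leq_b1 //; exact: leq_card_setU.
have c2 : n <= 1 + (dg e3 xa + dg e2 ya).
  rewrite -(g_n2 gt) -cardsT; apply: leq_trans (_ : #|ya |: (nb e3 xa :|: nb e2 ya)| <= _).
    apply/subset_leq_card/subsetP => b _; rewrite in_setU1 in_setU !inE.
    apply/or3P; case: (boolP (b == ya)) => [_|a1]; first by constructor.
    case: (boolP (e3 xa b)) => [_|a2]; first by constructor.
    case: (boolP (e2 ya b)) => [_|a3]; first by constructor.
    by case: no2; exists b.
  rewrite cardsU1 leq_add ?leq_b1 //; exact: leq_card_setU.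
have := g_f1 gt xa ya; have := ge1 gt xa; have := ge2 gt ya; have := size_ge_cross e3 xa ya; nlia.
Qed.

(** The cases are the values of [dg e3 x], at most 2. If it is 2, a vertex of G2 not joined to [x]
    has no edges at all, and the case of G3-degree 0 applies with the graphs exchanged. *)
Lemma pack_bad n (V1 V2 : finType) (e1 : rel V1) (e2 : rel V2) (e3 : V1 -> V2 -> bool) x :
  packs_below n -> gtriple n e1 e2 e3 -> iso_bad n e1 e2 e3 x ->
  (forall y, dg e2 y = 0 -> iso_bad n e2 e1 (tr e3) y) -> fullpack e1 e2 e3.
Proof.
move=> IH gt bx iso2; have gt' := gtriple_sw gt; have nbig := n_big gt.
have sw0 y : dg e2 y = 0 -> dg (tr e3) y = 0 -> fullpack e1 e2 e3.
  move=> y0 y3; apply: fullpack_sw; first by rewrite (g_n1 gt) (g_n2 gt).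
  exact: (pack_bad_deg3_0 IH gt' (iso2 y y0) y3).
have one (V W : finType) (r : V -> W -> bool) a : dg r a = 1 -> exists b, nb r a = [set b].
  by move=> h; apply/cards1P; rewrite -/(dg r a) h.
have [y1 ny1] := far3 gt x; have := b_bad bx ny1.
case D : (dg e3 x) => [|[|[|d]]]; first by move=> _; exact: (pack_bad_deg3_0 IH gt bx D).
- have [ya Ex] := one _ _ _ _ D; move=> _.
  case: (classic (exists b b', [/\ e2 b b', b != ya & b' != ya])) => [[b [b' [h1 h2 h3]]]|st2].
    exact: (pack_bad_matching IH gt bx Ex h1 h2 h3).
  have st2' b b' : e2 b b' -> b = ya \/ b' = ya.
    move=> h; apply: NNPP => /not_or_and[/eqP h1 /eqP h2]; by apply: st2; exists b, b'.
  have [y yN] : exists y, y \notin ya |: nb e2 ya.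
    have [|y _ yN] := @set_exists_of_card _ (ya |: nb e2 ya) [set: V2]; last by exists y.
    rewrite cardsT (g_n2 gt) cardsU1 -/(dg e2 ya); have := b_u2 bx ya.
    by have := leq_b1 (ya \notin nb e2 ya); move: (nat_of_bool _) => c; nlia.
  move: yN; rewrite in_setU1 negb_or inE => /andP[yya neya].
  have y0 : dg e2 y = 0.
    apply/eqP; rewrite -leqn0 leqNgt; apply/negP => /card_gt0P[b]; rewrite inE => eyb.
    case: (st2' _ _ eyb) => E; first by rewrite E eqxx in yya.
    by rewrite (g_s2 gt) -E eyb in neya.
  have b2 := iso2 y y0.
  have [x2 nx2] := far3 gt' y; have := b_bad b2 nx2.
  case D' : (dg (tr e3) y) => [|[|d]].
  + by move=> _; apply: sw0 D'.
  + have [xa Ey] := one _ _ _ _ D'; move=> _.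
    case: (classic (exists a a', [/\ e1 a a', a != xa & a' != xa])) => [[a [a' [h1 h2 h3]]]|st1].
      apply: fullpack_sw; first by rewrite (g_n1 gt) (g_n2 gt).
      exact: (pack_bad_matching IH gt' b2 Ey h1 h2 h3).
    apply: (star_star gt bx b2 Ex Ey) => // a a' h.
    apply: NNPP => /not_or_and[/eqP h1 /eqP h2]; by apply: st1; exists a, a'.
  move=> _; exfalso; have := small1 bx Ex yya; rewrite D'; clear; lia.
- move=> h; apply: (sw0 y1); move: h; clear; lia.
by clear; lia.
Qed.

Theorem gtriple_fullpack n (V1 V2 : finType) (e1 : rel V1) (e2 : rel V2) (e3 : V1 -> V2 -> bool) :
  gtriple n e1 e2 e3 -> fullpack e1 e2 e3.
Proof.
elim/ltn_ind: n V1 V2 e1 e2 e3 => n IHn V1 V2 e1 e2 e3 gt.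
have IH : packs_below n by move=> m W1 W2 d1 d2 d3 lt; exact: IHn.
have gt' := gtriple_sw gt; have E : #|V1| = #|V2| by rewrite (g_n1 gt) (g_n2 gt).
apply: NNPP => nf; have nf' : ~ fullpack e2 e1 (tr e3) by move=> h; apply: nf; apply: fullpack_sw.
have i1 x : dg e1 x = 0 -> iso_bad n e1 e2 e3 x by case/(iso_cases IH gt).
have i2 y : dg e2 y = 0 -> iso_bad n e2 e1 (tr e3) y by case/(iso_cases IH gt').
suff tp : triple n e1 e2 e3.
  by apply: nf; apply: (triple_fullpack _ tp); have := n_big gt; nlia.
case: (gt) => *; split=> // v; rewrite lt0n; apply/eqP => v0.
  by apply: nf; exact: (pack_bad IH gt (i1 v v0) i2).
by apply: nf'; exact: (pack_bad IH gt' (i2 v v0) i1).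
Qed.

(** * Passing from edge counts to degree sums *)

Lemma card_rel (V W : finType) (r : V -> W -> bool) : #|[set p : V * W | r p.1 p.2]| = size_e r.
Proof.
rewrite -sum1_card /size_e; transitivity (\sum_x \sum_(y | r x y) 1).
  by rewrite pair_big_dep /=; apply: eq_bigl => p; rewrite inE.
by apply: eq_bigr => x _; rewrite /dg -sum1_card; apply: eq_bigl => y; rewrite inE.
Qed.

(** An edge, as a set of two vertices, is the image of at most two ordered pairs. *)
Lemma handshake (V : finType) (e : rel V) : size_e e <= 2 * nedges e.
Proof.
rewrite -card_rel -sum1_card /nedges mulnC -sum_nat_const.
rewrite (partition_big (fun p : V * V => [set p.1; p.2])
  (mem [set A : {set V} | [exists u, exists w, (A == [set u; w]) && e u w]])) /=; last first.
  by move=> [u w]; rewrite !inE /= => h; apply/existsP; exists u; apply/existsP; exists w; rewrite eqxx.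
apply: leq_sum => A; rewrite inE => /existsP[u /existsP[w /andP[/eqP -> _]]].
rewrite sum1_card; apply: leq_trans (_ : #|[set (u, w); (w, u)]| <= _); last by rewrite cards2; case: (_ != _).
apply/subset_leq_card/subsetP => -[a b]; rewrite !inE /= => /andP[_ /eqP E].
have : a \in [set u; w] by rewrite -E set21.
have : b \in [set u; w] by rewrite -E set22.
have : u \in [set a; b] by rewrite E set21.
have : w \in [set a; b] by rewrite E set22.
rewrite !in_set2 !xpair_eqE [u == a]eq_sym [u == b]eq_sym [w == a]eq_sym [w == b]eq_sym.
by case: (a == u); case: (a == w); case: (b == u); case: (b == w).
Qed.

Theorem mainTheorem3 (n : nat) (V1 V2 : finType)
  (e1 : rel V1) (e2 : rel V2) (e3 : V1 -> V2 -> bool) :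
  2 <= n ->
  #|V1| = n -> #|V2| = n ->
  simple_graph e1 -> simple_graph e2 ->
  maxdeg e1 <= n - 2 -> maxdeg e2 <= n - 2 ->
  maxdeg3 e3 <= n - 1 ->
  Fval e1 e2 e3 + Cconst <= 3 * n ->
  packs e1 e2 e3.
Proof.
move=> n2 c1 c2 [s1 i1] [s2 i2] D1 D2 D3 F.
have d1 x : dg e1 x <= maxdeg e1 by apply: (leq_bigmax (F := deg e1)).
have d2 y : dg e2 y <= maxdeg e2 by apply: (leq_bigmax (F := deg e2)).
have d31 x : dg e3 x <= maxdeg3_1 e3 by apply: (leq_bigmax (F := deg3_1 e3)).
have d32 y : dg (tr e3) y <= maxdeg3_2 e3 by apply: (leq_bigmax (F := deg3_2 e3)).
have m1 : maxdeg3_1 e3 <= n - 1 by apply: leq_trans D3; apply: leq_maxl.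
have m2 : maxdeg3_2 e3 <= n - 1 by apply: leq_trans D3; apply: leq_maxr.
have h1 := handshake e1; have h2 := handshake e2.
have h3 : nedges3 e3 = size_e e3 by exact: card_rel.
have q1 : maxdeg e1 + (maxdeg3_2 e3 - 4) <= scriptD e1 e2 e3 by apply: leq_maxl.
have q2 : maxdeg e2 + (maxdeg3_1 e3 - 4) <= scriptD e1 e2 e3 by apply: leq_maxr.
have CE : Cconst = 11 * (195 * 195) + 4 by rewrite /Cconst -mulnn.
move: F; rewrite CE /Fval h3 => F.
have [P [okP cP]] : fullpack e1 e2 e3; last by apply: packs_of_okp okP _ cP; rewrite c1 c2.
apply: (@gtriple_fullpack n); split.
- exact: c1.
- exact: c2.
- exact: s1.
- exact: i1.
- exact: s2.
- exact: i2.
- by move=> x; have := d1 x; nlia.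
- by move=> y; have := d2 y; nlia.
- by move=> x; have := d31 x; nlia.
- by move=> y; have := d32 y; nlia.
- by nlia.
- by move=> x y; have := d1 x; have := d32 y; nlia.
by move=> x y; have := d2 y; have := d31 x; nlia.
Qed.
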